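(* Let $\varphi_*$ be a parametrized dynamical system over $\Lambda=\mathbb R$ (on a compact metric space) conjugate to the canonical parametrization $\psi_*$ for the transcritical bifurcation. Then $\mathcal A^{\varphi_*}$ is acyclic (i.e. $H^k(\Lambda;\mathcal A^{\varphi_*})=0$ for all $k\ge1$) and $$H^0(\Lambda;\mathcal A^{\varphi_*})\cong\mathbb Z_2^3 .$$ Moreover, there exists a value $\lambda_0\in\mathbb R$ such that, for $a\in\mathbb R$, $$H^k(\Lambda,\Lambda';\mathcal A^{\varphi_*})\cong\begin{cases}\mathbb Z_2&\text{if }k=1\text{ and }a>\lambda_0,\\0&\text{if }k\ne1\text{ or }a\le\lambda_0,\end{cases}\qquad\text{with }\Lambda'=[a,\infty),$$ $$H^k(\Lambda,\Lambda';\mathcal A^{\varphi_*})\cong\begin{cases}\mathbb Z_2&\text{if }k=1\text{ and }a<\lambda_0,\\0&\text{if }k\ne1\text{ or }a\ge\lambda_0,\end{cases}\qquad\text{with }\Lambda'=(-\infty,a].$$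
   Context: Canonical transcritical parametrization $\psi_*\colon\Lambda\to\mathbf{DS}(\mathbb T,X)$: phase space $X=\mathbb R\cup\{-\infty,\infty\}$, the two-point compactification of $\mathbb R$; time space $\mathbb T=\mathbb R$; parameter space $\Lambda=\mathbb R$. The parametrized flow is defined via the differential equation $\dot x=\lambda x-x^2$, $x\in\mathbb R$, $\lambda\in\mathbb R$, and $+\infty$ and $-\infty$ are a repelling and an attracting fixed point respectively. General definitions. Time space $\mathbb T\in\{\mathbb Z,\mathbb Z^+,\mathbb R,\mathbb R^+\}$ with usual topology. A dynamical system on a compact space $X$ is a continuous map $\phi\colon\mathbb T\times X\to X$ with $\phi(0,x)=x$ and $\phi(t,\phi(s,x))=\phi(t+s,x)$; $\phi_t=\phi(t,\cdot)$. $\mathbf{DS}(\mathbb T,X)$ is the set of dynamical systems with the compact-open topology. Attractors: $\omega_\phi(U)=\bigcap_{t\ge0}\mathrm{cl}\bigcup_{s\ge t}\phi_s(U)$; $U\subset X$ is an attracting neighborhood ($U\in\mathsf{ANbhd}(\phi)$) if $\omega_\phi(U)\subset\mathrm{int}\,U$; an attractor is a set $A=\omega_\phi(U)$ with $U\in\mathsf{ANbhd}(\phi)$. The set $\mathsf{Att}(\phi)$ of attractors is a bounded distributive lattice with $A\vee A'=A\cup A'$, $A\wedge A'=\omega_\phi(A\cap A')$, bottom $\emptyset$, top $\omega_\phi(X)$. Parametrized dynamical system over $\Lambda$ on $X$: a continuous map $\varphi\colon\mathbb T\times X\times\Lambda\to X$ with $\phi^\lambda:=\varphi(\cdot,\cdot,\lambda)\in\mathbf{DS}(\mathbb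 T,X)$ for all $\lambda$; it is identified with its transpose $\varphi_*\colon\lambda\mapsto\phi^\lambda$. Attractor sheaf: let $\mathcal S$ be the sheaf of bounded distributive lattices on $\Lambda$ with $\mathcal S(\Omega)$ the set of maps $\lambda\mapsto A_\lambda\in\mathsf{Att}(\phi^\lambda)$, $\lambda\in\Omega$, such that each $\mu\in\Omega$ has an open neighborhood $\Omega_0\subset\Omega$ and a set $U\subset X$ with $U\in\mathsf{ANbhd}(\phi^\lambda)$ and $A_\lambda=\omega_{\phi^\lambda}(U)$ for all $\lambda\in\Omega_0$; operations are pointwise. (This is the sheaf of sections of the pullback by $\varphi_*$ of the étale space of pairs $(\phi,A)$, $A\in\mathsf{Att}(\phi)$.) For a bounded distributive lattice $L$, $\mathsf R L$ is its Booleanization (minimal Boolean extension, i.e. the Boolean algebra of clopen subsets of the Priestley spectrum of $L$) regarded as a Boolean ring with symmetric difference as sum and intersection as product. $\mathcal A^{\varphi_*}$ is the sheafification of the presheaf of rings $\Omega\mapsto\mathsf R(\mathcal S(\Omega))$; its stalk at $\lambda$ is $\mathsf R\,\mathsf{Att}(\phi^\lambda)$. $H^k(\Lambda;\mathcal F)$ is sheaf cohomology, and $H^k(\Lambda,\Lambda';\mathcal F)$ is relative sheaf cohomology in the sense of Bredon, fitting in the long exact sequence of the pair $(\Lambda,\Lambda')$. Isomorphisms are of abelian groups. Conjugacy: $\varphi_*\colon\Lambda\to\mathbf{DS}(\mathbb T,Y)$ and $\psi_*\colon\Lambda\to\mathbf{DS}(\mathbb T,X)$ are conjugate if there are continuous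 $h\colon\Lambda\times Y\to X$ and $\tau\colon\Lambda\times\mathbb T\times Y\to\mathbb T$ such that (i) for every $\lambda$, $h^\lambda=h(\lambda,\cdot)$ is a homeomorphism, $\tau(\lambda,0,y)=0$, $t\mapsto\tau(\lambda,t,y)$ is strictly monotone and bijective on $\mathbb T$ for each $y$, and $h^\lambda(\phi^\lambda(t,y))=\psi^\lambda(\tau(\lambda,t,y),h^\lambda(y))$; (ii) $h^\lambda(Y_i)=X_i$ uniformly for all $\lambda\in\Lambda$, where $Y_i$ and $X_i$ are the connected components of $Y$ and $X$ (i.e. with an indexing independent of $\lambda$).
   Formalization: Solutions of x' = λx − x² blow up in finite time, so the canonical flow with T = ℝ and ±∞ fixed does not literally exist; ψ is taken to be any such flow whose real orbits solve x' = g(λ,x)(λx − x²) for some positive continuous g. *)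

(* Defs.v *)
From HB Require Import structures.
From mathcomp Require Import all_boot all_order all_algebra.
From mathcomp Require Import all_classical all_reals all_analysis.

Set Implicit Arguments.
Unset Strict Implicit.
Unset Printing Implicit Defensive.

Import Order.TTheory GRing.Theory Num.Theory.
Import numFieldTopology.Exports numFieldNormedType.Exports.

Local Open Scope classical_set_scope.
Local Open Scope ring_scope.

Local Obligation Tactic := idtac.

Record subgroup (V : zmodType) := Subgroup {
  sg_set :> V -> Prop;
  sg0 : sg_set 0;
  sgB : forall x y, sg_set x -> sg_set y -> sg_set (x - y) }.

Definition sg_mem (V : zmodType) (H : subgroup V) : {pred V} :=
  fun x => `[< H x >].

Lemma sg_memP (V : zmodType) (H : subgroup V) x : (x \in sg_mem H) = `[< H x >].
Proof. by []. Qed.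

Lemma sg_zmod_closed (V : zmodType) (H : subgroup V) : zmod_closed (sg_mem H).
Proof.
split; first by apply/asboolP; exact: sg0.
by move=> x y /asboolP Hx /asboolP Hy; apply/asboolP; exact: sgB.
Qed.

HB.instance Definition _ (V : zmodType) (H : subgroup V) :=
  GRing.isZmodClosed.Build V (sg_mem H) (sg_zmod_closed H).

Definition sg_type (V : zmodType) (H : subgroup V) := {x : V | x \in sg_mem H}.

HB.instance Definition _ V H := SubType.on (@sg_type V H).
HB.instance Definition _ V H := Choice.on (@sg_type V H).
HB.instance Definition _ V H := [SubChoice_isSubZmodule of @sg_type V H by <:].

Lemma sg_typeP (V : zmodType) (H : subgroup V) (x : sg_type H) : H (val x).
Proof. by apply/asboolP; exact: (valP x). Qed.

Definition sg_sub (V : zmodType) (H : subgroup V) (x : V) (Hx : H x) :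
  sg_type H := Sub x (asboolT Hx).

Definition quot_group (V : zmodType) (H : subgroup V) : zmodType :=
  Quotient.quot (sg_mem H).

Section QuotGroup.
Context (V : zmodType) (H : subgroup V).

Definition quot_pi (x : V) : quot_group H := (\pi_(Quotient.quot (sg_mem H)) x)%qT.

Lemma quot_pi_is_zmod_morphism : zmod_morphism quot_pi.
Proof.
by move=> x y; rewrite /quot_pi Quotient.pi_add Quotient.pi_opp.
Qed.

HB.instance Definition _ :=
  GRing.isZmodMorphism.Build V (quot_group H) quot_pi quot_pi_is_zmod_morphism.

Definition quot_repr (q : quot_group H) : V :=
  repr (q : Quotient.quot (sg_mem H)).

Lemma quot_reprK q : quot_pi (quot_repr q) = q.
Proof. exact: reprK. Qed.

Lemma quot_pi_eq0 x : quot_pi x = 0 <-> H x.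
Proof.
have -> : (0 : quot_group H) = quot_pi 0 by rewrite raddf0.
rewrite /quot_pi; split=> [e|Hx].
  apply/asboolP; rewrite -[x]subr0 -sg_memP Quotient.idealrBE.
  by apply/eqP.
apply/eqP; rewrite -Quotient.idealrBE subr0; exact/asboolP.
Qed.

End QuotGroup.

Section QuotMap.
Context (V W : zmodType) (H : subgroup V) (K : subgroup W).
Context (f : {additive V -> W}).

Definition quot_map (fHK : forall x, H x -> K (f x)) (q : quot_group H) :
  quot_group K := quot_pi K (f (quot_repr q)).

Variable fHK : forall x, H x -> K (f x).

Lemma quot_map_pi x : quot_map fHK (quot_pi H x) = quot_pi K (f x).
Proof.
apply/eqP; rewrite -subr_eq0 -!raddfB; apply/eqP/quot_pi_eq0.
by apply: fHK; apply/quot_pi_eq0; rewrite raddfB /= quot_reprK subrr.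
Qed.

Lemma quot_map_is_zmod_morphism : zmod_morphism (quot_map fHK).
Proof.
move=> p q; rewrite -[p]quot_reprK -[q]quot_reprK -raddfB.
by rewrite /= !quot_map_pi !raddfB.
Qed.

HB.instance Definition _ := GRing.isZmodMorphism.Build
  (quot_group H) (quot_group K) (quot_map fHK) quot_map_is_zmod_morphism.

End QuotMap.

Record complex := Complex {
  cochain :> nat -> zmodType;
  cdiff : forall n, {additive cochain n -> cochain n.+1};
  cdiffK : forall n (s : cochain n), cdiff n.+1 (cdiff n s) = 0 }.

Program Definition cocycles (C : complex) (n : nat) : subgroup (C n) :=
  @Subgroup _ [set s | cdiff C n s = 0] _ _.
Next Obligation. by move=> C n /=; rewrite raddf0. Qed.
Next Obligation. by move=> C n x y /= x0 y0; rewrite raddfB /= x0 y0 subr0. Qed.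

Definition is_coboundary (C : complex) (n : nat) : set (C n) :=
  match n with
  | 0%N => [set s | s = 0]
  | m.+1 => [set s | exists t : C m, cdiff C m t = s]
  end.

Program Definition coboundaries (C : complex) (n : nat) :
    subgroup (sg_type (cocycles C n)) :=
  @Subgroup _ [set s | is_coboundary (val s)] _ _.
Next Obligation.
by move=> C [|n] //=; exists 0; rewrite raddf0.
Qed.
Next Obligation.
move=> C [|n] x y /=; first by move=> -> ->; rewrite subr0.
by move=> [s sx] [t ty]; exists (s - t); rewrite raddfB /= sx ty.
Qed.

Definition cohomology (C : complex) (n : nat) : zmodType :=
  quot_group (coboundaries C n).

Record chain_map (C D : complex) := ChainMap {
  cmap :> forall n, {additive C n -> D n};
  cmap_diff : forall n s, cmap n.+1 (cdiff C n s) = cdiff D n (cmap n s) }.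

Section KernelComplex.
Context (C D : complex) (f : chain_map C D).

Program Definition kernel (n : nat) : subgroup (C n) :=
  @Subgroup _ [set s | f n s = 0] _ _.
Next Obligation. by move=> n /=; rewrite raddf0. Qed.
Next Obligation. by move=> n x y /= x0 y0; rewrite raddfB /= x0 y0 subr0. Qed.

Lemma kernel_diff_subproof n (s : sg_type (kernel n)) :
  kernel n.+1 (cdiff C n (val s)).
Proof. by have /= s0 := sg_typeP s; rewrite cmap_diff s0 raddf0. Qed.

Definition kernel_diff n (s : sg_type (kernel n)) : sg_type (kernel n.+1) :=
  sg_sub (kernel_diff_subproof s).

Lemma kernel_diff_is_zmod_morphism n : zmod_morphism (@kernel_diff n).
Proof. by move=> x y; apply: val_inj; rewrite /= !raddfB. Qed.

HB.instance Definition _ n := GRing.isZmodMorphism.Build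
  (sg_type (kernel n)) (sg_type (kernel n.+1)) (@kernel_diff n)
  (@kernel_diff_is_zmod_morphism n).

Lemma kernel_diffK n (s : sg_type (kernel n)) :
  kernel_diff (kernel_diff s) = 0.
Proof. by apply: val_inj; rewrite /= cdiffK. Qed.

Definition kernel_complex : complex :=
  @Complex (fun n => sg_type (kernel n)) (fun n => @kernel_diff n) kernel_diffK.

End KernelComplex.

Definition iso_group (G H : zmodType) : Prop :=
  exists f : {additive G -> H}, bijective f.

Definition trivial_group (G : zmodType) : Prop := forall x : G, x = 0.

Definition serrations (X : Type) (S : X -> zmodType) := forall x, S x.

Section Serrations.
Context (X : Type) (S : X -> zmodType).
Implicit Types s t u : serrations S.

HB.instance Definition _ := gen_eqMixin (serrations S).
HB.instance Definition _ := gen_choiceMixin (serrations S).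

Let addA : associative (fun s t : serrations S => fun x => s x + t x).
Proof. by move=> s t u; apply: functional_extensionality_dep => x; rewrite addrA. Qed.
Let addC : commutative (fun s t : serrations S => fun x => s x + t x).
Proof. by move=> s t; apply: functional_extensionality_dep => x; rewrite addrC. Qed.
Let add0 : left_id (fun=> 0) (fun s t : serrations S => fun x => s x + t x).
Proof. by move=> s; apply: functional_extensionality_dep => x; rewrite add0r. Qed.
Let addN : left_inverse (fun=> 0) (fun s x => - s x)
  (fun s t : serrations S => fun x => s x + t x).
Proof. by move=> s; apply: functional_extensionality_dep => x; rewrite addNr. Qed.

HB.instance Definition _ :=
  GRing.isZmodule.Build (serrations S) addA addC add0 addN.

Lemma serrB s t x : (s - t) x = s x - t x. Proof. by []. Qed.
Lemma serr0 x : (0 : serrations S) x = 0. Proof. by []. Qed.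

End Serrations.

(* The étalé space of a sheaf of abelian groups on X, given by its stalks and,
   for each x, by the serrations (arbitrary, possibly discontinuous, choices of
   an element in every stalk) that are continuous on a neighbourhood of x.  The
   last four axioms say that the sets s(U), for s continuous on the open set U,
   form a base of a topology on the disjoint union of the stalks that makes the
   projection to X a local homeomorphism. *)
Record sheaf (X : topologicalType) := Sheaf {
  stalk :> X -> zmodType;
  section_at : X -> subgroup (serrations stalk);
  section_near : forall x s, section_at x s ->
    \forall y \near x, section_at y s;
  section_local : forall x s t, section_at x s ->
    (\forall y \near x, s y = t y) -> section_at x t;
  section_surj : forall x (a : stalk x), exists2 s, section_at x s & s x = a;
  section_eq0 : forall x s, section_at x s -> s x = 0 ->
    \forall y \near x, s y = 0 }.
Arguments section_at {X} _ _.

Section InverseImage.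
Context (X Y : topologicalType) (f : Y -> X) (cf : continuous f) (S : sheaf X).

Program Definition inverse_image_section (y : Y) :
    subgroup (serrations (fun y => S (f y))) :=
  @Subgroup _ [set s | exists2 t, section_at S (f y) t &
                         \forall z \near y, s z = t (f z)] _ _.
Next Obligation.
move=> y /=; exists 0; first exact: sg0.
by apply: nearW => z.
Qed.
Next Obligation.
move=> y s1 s2 /= [t1 St1 e1] [t2 St2 e2]; exists (t1 - t2); first exact: sgB.
by near=> z; rewrite !serrB; congr (_ - _); near: z.
Unshelve. all: by end_near. Qed.

Program Definition inverse_image : sheaf Y :=
  @Sheaf Y (fun y => S (f y)) inverse_image_section _ _ _ _.
Next Obligation.
move=> y s /= [t St e].
have /cf Sft := section_near St; near=> z.
exists t; first by near: z; exact: Sft.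
by near: z; exact: near_join.
Unshelve. all: by end_near. Qed.
Next Obligation.
move=> y s s' /= [t St e] e'; exists t => //; near=> z.
have <- : s z = s' z by near: z.
by near: z.
Unshelve. all: by end_near. Qed.
Next Obligation.
move=> y a /=; have [t St ta] := section_surj a.
by exists (fun z => t (f z)) => //; exists t => //; exact: nearW.
Qed.
Next Obligation.
move=> y s /= [t St e] s0; have tf0 : t (f y) = 0.
  by rewrite -(nbhs_singleton e).
have /cf t0 := section_eq0 St tf0; near=> z.
have -> : s z = t (f z) by near: z.
by near: z; exact: t0.
Unshelve. all: by end_near. Qed.

End InverseImage.

(* f-cohomomorphisms from S to T, in the sense of Bredon. *)
Record cohomomorphism (X Y : topologicalType) (f : Y -> X)
    (S : sheaf X) (T : sheaf Y) := Cohomomorphism {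
  comap :> forall y, {additive S (f y) -> T y};
  comap_section : forall y s, section_at S (f y) s ->
    section_at T y (fun z => comap z (s (f z))) }.

Section InverseImageCanonical.
Context (X Y : topologicalType) (f : Y -> X) (cf : continuous f) (S : sheaf X).

Lemma inverse_image_comap_subproof y s : section_at S (f y) s ->
  section_at (inverse_image cf S) y (fun z => idfun (s (f z))).
Proof. by move=> Ss; exists s => //; exact: nearW. Qed.

Definition inverse_image_comap : cohomomorphism f S (inverse_image cf S) :=
  @Cohomomorphism _ _ f S (inverse_image cf S) (fun y => idfun)
    inverse_image_comap_subproof.

End InverseImageCanonical.

(* The sheaf C^0(S) / S, where C^0(S) is the sheaf of serrations of S.  A germ
   of serrations at x extends to a global serration, so the stalk at x is the
   group of all serrations modulo those that are continuous near x. *)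
Section GodementQuotient.
Context (X : topologicalType) (S : sheaf X).

Definition gquot_stalk (x : X) : zmodType := quot_group (section_at S x).

Program Definition gquot_section (x : X) : subgroup (serrations gquot_stalk) :=
  @Subgroup _ [set s | exists t : serrations S,
                 \forall y \near x, s y = quot_pi (section_at S y) t] _ _.
Next Obligation.
by move=> x /=; exists 0; apply: nearW => y; rewrite raddf0.
Qed.
Next Obligation.
move=> x s1 s2 /= [t1 e1] [t2 e2]; exists (t1 - t2).
by near=> y; rewrite raddfB serrB; congr (_ - _); near: y.
Unshelve. all: by end_near. Qed.

Program Definition gquot : sheaf X :=
  @Sheaf X gquot_stalk gquot_section _ _ _ _.
Next Obligation.
by move=> x s /= [t e]; near=> y; exists t; near: y; exact: near_join.
Unshelve. all: by end_near. Qed.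
Next Obligation.
move=> x s s' /= [t e] e'; exists t; near=> y.
have <- : s y = s' y by near: y.
by near: y.
Unshelve. all: by end_near. Qed.
Next Obligation.
move=> x a /=; exists (fun y => quot_pi (section_at S y) (quot_repr a)).
  by exists (quot_repr a); exact: nearW.
exact: quot_reprK.
Qed.
Next Obligation.
move=> x s /= [t e] s0.
have St : section_at S x t.
  by apply/quot_pi_eq0; rewrite -(nbhs_singleton e).
near=> y; have -> : s y = quot_pi (section_at S y) t by near: y.
by apply/quot_pi_eq0; near: y; exact: section_near.
Unshelve. all: by end_near. Qed.

End GodementQuotient.

Section GodementQuotientMap.
Context (X Y : topologicalType) (f : Y -> X) (cf : continuous f).
Context (S : sheaf X) (T : sheaf Y) (k : cohomomorphism f S T).

Definition serr_comap (s : serrations S) : serrations T :=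
  fun y => k y (s (f y)).

Lemma serr_comap_is_zmod_morphism : zmod_morphism serr_comap.
Proof.
move=> s t; apply: functional_extensionality_dep => y.
by rewrite serrB /serr_comap serrB raddfB.
Qed.

HB.instance Definition _ := GRing.isZmodMorphism.Build
  (serrations S) (serrations T) serr_comap serr_comap_is_zmod_morphism.

Definition gquot_comap_fun (y : Y) : gquot S (f y) -> gquot T y :=
  quot_map (f := serr_comap) (@comap_section _ _ _ _ _ k y).

HB.instance Definition _ (y : Y) :=
  GRing.Additive.on (@gquot_comap_fun y).

Lemma gquot_comap_subproof y s : section_at (gquot S) (f y) s ->
  section_at (gquot T) y (fun z => gquot_comap_fun (s (f z))).
Proof.
move=> [t /cf e]; exists (serr_comap t); near=> z.
have -> : s (f z) = quot_pi (section_at S (f z)) t by near: z; exact: e.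
by rewrite /gquot_comap_fun quot_map_pi.
Unshelve. all: by end_near. Qed.

Definition gquot_comap : cohomomorphism f (gquot S) (gquot T) :=
  @Cohomomorphism _ _ f (gquot S) (gquot T) (fun y => @gquot_comap_fun y)
    gquot_comap_subproof.

End GodementQuotientMap.

Section Godement.
Context (X : topologicalType) (S : sheaf X).

Fixpoint gsheaf (n : nat) : sheaf X :=
  if n is m.+1 then gquot (gsheaf m) else S.

Definition gdiff (n : nat) (s : serrations (gsheaf n)) :
  serrations (gsheaf n.+1) := fun x => quot_pi (section_at (gsheaf n) x) s.

Lemma gdiff_is_zmod_morphism n : zmod_morphism (@gdiff n).
Proof.
by move=> s t; apply: functional_extensionality_dep => x; rewrite serrB -raddfB.
Qed.

HB.instance Definition _ n := GRing.isZmodMorphism.Build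
  (serrations (gsheaf n)) (serrations (gsheaf n.+1)) (@gdiff n)
  (@gdiff_is_zmod_morphism n).

Lemma gdiffK n (s : serrations (gsheaf n)) : gdiff (gdiff s) = 0.
Proof.
apply: functional_extensionality_dep => x; apply/quot_pi_eq0.
by exists s; exact: nearW.
Qed.

(* The global sections of the canonical (Godement) resolution
   C^0(S) -> C^1(S) -> ... of S, where C^n(S) is the flabby sheaf of
   serrations of gsheaf n. *)
Definition godement : complex :=
  @Complex (fun n => serrations (gsheaf n)) (fun n => @gdiff n) gdiffK.

Definition sheaf_cohomology (n : nat) : zmodType := cohomology godement n.

End Godement.

Section GodementMap.
Context (X Y : topologicalType) (f : Y -> X) (cf : continuous f).
Context (S : sheaf X) (T : sheaf Y) (k : cohomomorphism f S T).

Fixpoint gsheaf_comap (n : nat) : cohomomorphism f (gsheaf S n) (gsheaf T n) :=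
  if n is m.+1 then gquot_comap cf (gsheaf_comap m) else k.

Lemma godement_map_subproof n (s : serrations (gsheaf S n)) :
  serr_comap (gsheaf_comap n.+1) (gdiff s) =
  gdiff (serr_comap (gsheaf_comap n) s).
Proof.
apply: functional_extensionality_dep => y.
by rewrite /serr_comap /= /gquot_comap_fun quot_map_pi.
Qed.

Definition godement_map : chain_map (godement S) (godement T) :=
  @ChainMap (godement S) (godement T) (fun n => serr_comap (gsheaf_comap n))
    godement_map_subproof.

End GodementMap.

(* Relative cohomology as in Bredon (Sheaf Theory, II.12): the cohomology of the
   kernel of the surjection C^*(X; S) -> C^*(A; S|A) between global sections of
   the canonical resolutions, where A carries the subspace topology. *)
Section RelativeCohomology.
Context (X : topologicalType) (A : set X) (S : sheaf X).

Definition inclusion_continuous : continuous (set_val : A -> X) :=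
  @initial_continuous A X set_val.

Definition sheaf_restriction : sheaf A := inverse_image inclusion_continuous S.

Definition relative_godement : complex :=
  kernel_complex (godement_map inclusion_continuous
    (inverse_image_comap inclusion_continuous S)).

Definition relative_cohomology (n : nat) : zmodType :=
  cohomology relative_godement n.

End RelativeCohomology.

Record opens (X : topologicalType) := Opens {
  open_set :> set X;
  open_setP : open open_set }.

Program Definition opensI (X : topologicalType) (U V : opens X) : opens X :=
  @Opens X (U `&` V) _.
Next Obligation. by move=> X U V; apply: openI; exact: open_setP. Qed.

Lemma opensIl (X : topologicalType) (U V : opens X) : opensI U V `<=` U.
Proof. by move=> y []. Qed.
Lemma opensIr (X : topologicalType) (U V : opens X) : opensI U V `<=` V.
Proof. by move=> y []. Qed.

Record presheaf (X : topologicalType) := Presheaf {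
  presheaf_group :> opens X -> zmodType;
  res : forall U V : opens X, V `<=` U ->
    {additive presheaf_group U -> presheaf_group V};
  res_id : forall (U : opens X) (UU : U `<=` U) s, res UU s = s;
  res_comp : forall (U V W : opens X) (VU : V `<=` U) (WV : W `<=` V)
    (WU : W `<=` U) s, res WV (res VU s) = res WU s }.
Arguments res {X} _ {U V} _.

Section Germs.
Context (X : topologicalType) (F : presheaf X) (x : X).

Record pregerm := Pregerm {
  pregerm_dom : opens X;
  pregerm_mem : open_set pregerm_dom x;
  pregerm_val : F pregerm_dom }.

HB.instance Definition _ := gen_eqMixin pregerm.
HB.instance Definition _ := gen_choiceMixin pregerm.

Definition germ_rel (a b : pregerm) : Prop :=
  exists (W : opens X) (Wa : W `<=` pregerm_dom a) (Wb : W `<=` pregerm_dom b),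
    open_set W x /\ res F Wa (pregerm_val a) = res F Wb (pregerm_val b).

Definition germ_eq : rel pregerm := fun a b => `[< germ_rel a b >].

Lemma germ_eq_is_equiv : equiv_class_of germ_eq.
Proof.
split.
- move=> a; apply/asboolP; exists (pregerm_dom a), (@subset_refl _ _).
  by exists (@subset_refl _ _); split=> //; exact: pregerm_mem.
- move=> a b; apply/idP/idP => /asboolP[W [Wa [Wb [Wx e]]]]; apply/asboolP;
  by exists W, Wb, Wa.
- move=> b a c /asboolP[W [Wa [Wb [Wx e]]]] /asboolP[W' [Wb' [Wc [Wx' e']]]].
  apply/asboolP; exists (opensI W W').
  have WW : opensI W W' `<=` W by move=> y [].
  have WW' : opensI W W' `<=` W' by move=> y [].
  exists (subset_trans WW Wa), (subset_trans WW' Wc); split=> //.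
  rewrite -(res_comp Wa WW) e (res_comp Wb WW (subset_trans WW' Wb')).
  by rewrite -(res_comp Wb' WW') e' (res_comp Wc WW' (subset_trans WW' Wc)).
Qed.

Canonical germ_equiv := EquivRelPack germ_eq_is_equiv.
Canonical germ_encModRel := defaultEncModRel germ_eq.

Definition germs := {eq_quot germ_eq}%qT.
HB.instance Definition _ := Choice.on germs.

Definition to_germ (a : pregerm) : germs := \pi_germs%qT a.
Definition of_germ (g : germs) : pregerm := repr g.

Lemma of_germK g : to_germ (of_germ g) = g.
Proof. exact: reprK. Qed.

Lemma to_germP a b : to_germ a = to_germ b <-> germ_rel a b.
Proof.
by split=> [/eqmodP/asboolP|ab]; last by apply/eqmodP/asboolP.
Qed.

Program Definition pregerm0 : pregerm :=
  @Pregerm (@Opens X setT openT) _ 0.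
Next Obligation. by []. Qed.

Definition pregermN (a : pregerm) : pregerm :=
  Pregerm (pregerm_mem a) (- pregerm_val a).

Definition pregermD (a b : pregerm) : pregerm :=
  @Pregerm (opensI (pregerm_dom a) (pregerm_dom b))
    (conj (pregerm_mem a) (pregerm_mem b))
    (res F (@opensIl _ _ _) (pregerm_val a) +
     res F (@opensIr _ _ _) (pregerm_val b)).

Definition germ0 : germs := to_germ pregerm0.
Definition germN (g : germs) : germs := to_germ (pregermN (of_germ g)).
Definition germD (g h : germs) : germs :=
  to_germ (pregermD (of_germ g) (of_germ h)).

Lemma pregerm_res a (W : opens X) (Wa : W `<=` pregerm_dom a)
    (Wx : open_set W x) : to_germ (Pregerm Wx (res F Wa (pregerm_val a))) = to_germ a.
Proof.
apply/to_germP; exists W, (@subset_refl _ _), Wa; split=> //=.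
by rewrite res_id.
Qed.

Lemma germ_common a b : exists (W : opens X) (Wx : open_set W x) (s t : F W),
  to_germ a = to_germ (Pregerm Wx s) /\ to_germ b = to_germ (Pregerm Wx t).
Proof.
exists (opensI (pregerm_dom a) (pregerm_dom b)).
exists (conj (pregerm_mem a) (pregerm_mem b)).
exists (res F (@opensIl _ _ _) (pregerm_val a)).
exists (res F (@opensIr _ _ _) (pregerm_val b)).
by rewrite !pregerm_res.
Qed.

Lemma germNE (W : opens X) (Wx : open_set W x) (s : F W) :
  germN (to_germ (Pregerm Wx s)) = to_germ (Pregerm Wx (- s)).
Proof.
apply/to_germP; have /to_germP[V [Va [Vb [Vx e]]]] :=
  of_germK (to_germ (Pregerm Wx s)).
by exists V, Va, Vb; split=> //=; rewrite !raddfN e.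
Qed.

Lemma germDE (W : opens X) (Wx : open_set W x) (s t : F W) :
  germD (to_germ (Pregerm Wx s)) (to_germ (Pregerm Wx t)) =
  to_germ (Pregerm Wx (s + t)).
Proof.
apply/to_germP.
have /to_germP[V [Va [Vb [Vx e]]]] := of_germK (to_germ (Pregerm Wx s)).
have /to_germP[U [Ua [Ub [Ux e']]]] := of_germK (to_germ (Pregerm Wx t)).
have VUl : opensI V U `<=` V by move=> y [].
have VUr : opensI V U `<=` U by move=> y [].
have VUD : opensI V U `<=` pregerm_dom (pregermD
    (of_germ (to_germ (Pregerm Wx s))) (of_germ (to_germ (Pregerm Wx t)))).
  by move=> y [/Va ? /Ua ?].
exists (opensI V U), VUD, (subset_trans VUl Vb); split=> //=.
rewrite !raddfD /=.
rewrite (res_comp _ _ (subset_trans VUl Va)) (res_comp _ _ (subset_trans VUr Ua)).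
rewrite -(res_comp Va VUl) e (res_comp Vb VUl (subset_trans VUl Vb)).
by rewrite -(res_comp Ua VUr) e' (res_comp Ub VUr (subset_trans VUl Vb)).
Qed.

Lemma germ0E (W : opens X) (Wx : open_set W x) :
  germ0 = to_germ (Pregerm Wx 0).
Proof.
apply/to_germP; have WT : W `<=` setT by [].
by exists W, WT, (@subset_refl _ _); rewrite !raddf0.
Qed.

Lemma germDA : associative germD.
Proof.
move=> g h k; rewrite -[g]of_germK -[h]of_germK -[k]of_germK.
have [W [Wx [s [t [-> ->]]]]] := germ_common (of_germ g) (of_germ h).
have [V [Vx [u [v [e ->]]]]] :=
  germ_common (Pregerm Wx s) (of_germ k).
have [U [Ux [a [b [ea eb]]]]] := germ_common (Pregerm Wx t) (Pregerm Vx v).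
pose Z := opensI W (opensI V U).
have ZW : Z `<=` W by move=> y [].
have ZV : Z `<=` V by move=> y [_ []].
have Zx : open_set Z x by [].
rewrite -(@pregerm_res (Pregerm Wx s) Z ZW Zx).
rewrite -(@pregerm_res (Pregerm Wx t) Z ZW Zx).
rewrite -(@pregerm_res (Pregerm Vx v) Z ZV Zx).
by rewrite !germDE addrA.
Qed.

Lemma germDC : commutative germD.
Proof.
move=> g h; rewrite -[g]of_germK -[h]of_germK.
have [W [Wx [s [t [-> ->]]]]] := germ_common (of_germ g) (of_germ h).
by rewrite !germDE addrC.
Qed.

Lemma germ0D : left_id germ0 germD.
Proof.
move=> g; rewrite -[g]of_germK; case: (of_germ g) => W Wx s.
by rewrite (germ0E Wx) germDE add0r.
Qed.

Lemma germND : left_inverse germ0 germN germD.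
Proof.
move=> g; rewrite -[g]of_germK; case: (of_germ g) => W Wx s.
by rewrite germNE germDE addNr (germ0E Wx).
Qed.

HB.instance Definition _ := GRing.isZmodule.Build germs
  germDA germDC germ0D germND.

Definition germ (U : opens X) (Ux : open_set U x) (s : F U) : germs :=
  to_germ (Pregerm Ux s).

Lemma germ_is_zmod_morphism U (Ux : open_set U x) : zmod_morphism (@germ U Ux).
Proof.
move=> s t; rewrite /germ.
have -> : - to_germ (Pregerm Ux t) = to_germ (Pregerm Ux (- t)) by exact: germNE.
exact/esym/germDE.
Qed.

HB.instance Definition _ U Ux := GRing.isZmodMorphism.Build
  (F U) germs (@germ U Ux) (@germ_is_zmod_morphism U Ux).

Lemma germ_res (U V : opens X) (VU : V `<=` U) (Vx : open_set V x) s :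
  germ Vx (res F VU s) = germ (VU _ Vx) s.
Proof. exact: (@pregerm_res (Pregerm (VU _ Vx) s)). Qed.

Lemma germ_surj (g : germs) : exists U Ux s, g = @germ U Ux s.
Proof.
by rewrite -[g]of_germK; case: (of_germ g) => U Ux s; exists U, Ux, s.
Qed.

Lemma germ_eq0 U (Ux : open_set U x) s : germ Ux s = 0 ->
  exists (V : opens X) (VU : V `<=` U), open_set V x /\ res F VU s = 0.
Proof.
move=> /to_germP[V [VU [VT [Vx e]]]]; exists V, VU; split=> //.
by move: e; rewrite /= raddf0.
Qed.

End Germs.

Section Sheafification.
Context (X : topologicalType) (F : presheaf X).

Program Definition sheafification_section (x : X) :
    subgroup (serrations (fun y => germs F y : zmodType)) :=
  @Subgroup _ [set s | exists (U : opens X) (f : F U), open_set U x /\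
    forall y (Uy : open_set U y), s y = germ Uy f] _ _.
Next Obligation.
move=> x /=; exists (@Opens X setT openT), 0; split=> // y Uy.
by rewrite raddf0.
Qed.
Next Obligation.
move=> x s t /= [U [f [Ux sf]]] [V [g [Vx tg]]].
exists (opensI U V), (res F (@opensIl _ _ _) f - res F (@opensIr _ _ _) g).
split=> // y Uy; have [Uy1 Vy1] := Uy.
rewrite serrB raddfB /= (germ_res (U := U)) (germ_res (U := V)).
by congr (_ - _); [exact: sf|exact: tg].
Qed.

Program Definition sheafification : sheaf X :=
  @Sheaf X (fun y => germs F y) sheafification_section _ _ _ _.
Next Obligation.
move=> x s /= [U [f [Ux sf]]].
have : \forall y \near x, open_set U y.
  by apply: open_nbhs_nbhs; split=> //; exact: open_setP.
by apply: filterS => y Uy; exists U, f.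
Qed.
Next Obligation.
move=> x s t /= [U [f [Ux sf]]]; rewrite -[X in X -> _]/(nbhs x _).
rewrite nbhsE => -[V [oV Vx] Vst].
exists (opensI U (Opens oV)), (res F (@opensIl _ _ _) f); split=> // y Uy.
have [Uy1 Vy1] := Uy; rewrite -Vst // (germ_res (U := U)); exact: sf.
Qed.
Next Obligation.
move=> x a /=; have [U [Ux [f ->]]] := germ_surj a.
exists (fun y => if pselect (open_set U y) is left Uy then germ Uy f else 0).
  exists U, f; split=> // y Uy; case: pselect => // Uy'.
  by congr (germ _ f); exact: Prop_irrelevance.
case: pselect => // Ux'.
by congr (germ _ f); exact: Prop_irrelevance.
Qed.
Next Obligation.
move=> x s /= [U [f [Ux sf]]]; rewrite (sf x Ux) => /germ_eq0[V [VU [Vx f0]]].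
have : \forall y \near x, open_set V y.
  by apply: open_nbhs_nbhs; split=> //; exact: open_setP.
apply: filterS => y Vy; rewrite (sf y (VU _ Vy)).
by rewrite -(germ_res VU Vy) f0 raddf0.
Qed.

End Sheafification.

Record blattice_hom d (L : tbDistrLatticeType d) d' (K : tbDistrLatticeType d')
    := BLatticeHom {
  bhom :> L -> K;
  bhom0 : bhom \bot%O = \bot%O;
  bhom1 : bhom \top%O = \top%O;
  bhomI : {morph bhom : x y / (x `&` y)%O};
  bhomU : {morph bhom : x y / (x `|` y)%O} }.

Definition prime_ideal d (L : tbDistrLatticeType d) (I : L -> bool) : Prop :=
  [/\ I \bot%O, ~~ I \top%O,
      forall x y, (x <= y)%O -> I y -> I x,
      forall x y, I x -> I y -> I (x `|` y)%O &
      forall x y, I (x `&` y)%O -> I x \/ I y].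

Section Priestley.
Context d (L : tbDistrLatticeType d).

Record spectrum := PrimeIdeal {
  ideal :> L -> bool;
  idealP : prime_ideal ideal }.

HB.instance Definition _ := gen_eqMixin spectrum.
HB.instance Definition _ := gen_choiceMixin spectrum.

(* the Priestley topology, generated by the sets {I | x \in I} and
   {I | x \notin I} *)
HB.instance Definition _ := Topological.copy spectrum
  (initial_topology (ideal : spectrum -> {ptws L -> bool})).

Lemma spectrum_eq (I J : spectrum) : ideal I =1 ideal J -> I = J.
Proof.
case: I J => [I PI] [J PJ] /= /funext e.
by move: PJ; rewrite -e => PJ; congr PrimeIdeal; exact: Prop_irrelevance.
Qed.

Record booleanization := Clopen {
  clopen_set :> set spectrum;
  clopen_setP : clopen clopen_set }.

HB.instance Definition _ := gen_eqMixin booleanization.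
HB.instance Definition _ := gen_choiceMixin booleanization.

Lemma booleanization_eq (A B : booleanization) :
  clopen_set A = clopen_set B -> A = B.
Proof.
case: A B => [A cA] [B cB] /= e.
by move: cB; rewrite -e => cB; congr Clopen; exact: Prop_irrelevance.
Qed.

Lemma clopenY (A B : set spectrum) : clopen A -> clopen B -> clopen (A `+` B).
Proof.
move=> cA cB; rewrite /setY !setDE; apply: clopenU; apply: clopenI => //;
exact: (clopenC set0).
Qed.

Definition bool_add (A B : booleanization) : booleanization :=
  Clopen (clopenY (clopen_setP A) (clopen_setP B)).
Definition bool_mul (A B : booleanization) : booleanization :=
  Clopen (clopenI (clopen_setP A) (clopen_setP B)).
Definition bool_zero : booleanization := Clopen clopen0.
Definition bool_one : booleanization := Clopen clopenT.

Lemma bool_addA : associative bool_add.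
Proof. by move=> A B C; apply: booleanization_eq; exact: setYA. Qed.
Lemma bool_addC : commutative bool_add.
Proof. by move=> A B; apply: booleanization_eq; exact: setYC. Qed.
Lemma bool_add0 : left_id bool_zero bool_add.
Proof. by move=> A; apply: booleanization_eq; exact: set0Y. Qed.
Lemma bool_addN : left_inverse bool_zero id bool_add.
Proof. by move=> A; apply: booleanization_eq; exact: setYK. Qed.

HB.instance Definition _ := GRing.isZmodule.Build booleanization
  bool_addA bool_addC bool_add0 bool_addN.

Lemma bool_mulA : associative bool_mul.
Proof. by move=> A B C; apply: booleanization_eq; exact: setIA. Qed.
Lemma bool_mulC : commutative bool_mul.
Proof. by move=> A B; apply: booleanization_eq; exact: setIC. Qed.
Lemma bool_mul1 : left_id bool_one bool_mul.
Proof. by move=> A; apply: booleanization_eq; exact: setTI. Qed.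
Lemma bool_mulDl : left_distributive bool_mul bool_add.
Proof. by move=> A B C; apply: booleanization_eq; exact: setIYl. Qed.

HB.instance Definition _ := GRing.Zmodule_isComPzRing.Build booleanization
  bool_mulA bool_mulC bool_mul1 bool_mulDl.

End Priestley.

Section BooleanizationMap.
Context d (L : tbDistrLatticeType d) d' (K : tbDistrLatticeType d').
Context (f : blattice_hom L K).

Lemma spectrum_map_subproof (I : spectrum K) : prime_ideal (fun x => I (f x)).
Proof.
have [I0 I1 Ile IU II] := idealP I; split.
- by rewrite bhom0.
- by rewrite bhom1.
- move=> x y xy; apply: Ile; rewrite -(meet_idPl xy) bhomI; exact: leIr.
- by move=> x y Ix Iy; rewrite bhomU; exact: IU.
- by move=> x y; rewrite bhomI => /II.
Qed.

Definition spectrum_map (I : spectrum K) : spectrum L :=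
  PrimeIdeal (spectrum_map_subproof I).

Lemma spectrum_map_continuous : continuous spectrum_map.
Proof.
have ev x : continuous (fun I : spectrum K => (spectrum_map I : L -> bool) x).
  move=> I; apply: (@continuous_comp _ {ptws K -> bool} _ (@ideal _ K)
    (@proj K (fun=> bool) (f x))); last exact: proj_continuous.
  exact: (@initial_continuous _ {ptws K -> bool} (@ideal _ K)).
apply: continuous_comp_initial => I.
apply/cvg_sup; first exact/fmap_filter/nbhs_filter.
by move=> x; move: I; exact: (continuous_comp_initial (ev x)).
Qed.

Definition booleanization_map (A : booleanization L) : booleanization K :=
  Clopen (preimage_clopen (clopen_setP A) spectrum_map_continuous).

Lemma booleanization_map_is_zmod_morphism : zmod_morphism booleanization_map.
Proof. by move=> A B; exact: booleanization_eq. Qed.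

HB.instance Definition _ := GRing.isZmodMorphism.Build
  (booleanization L) (booleanization K) booleanization_map
  booleanization_map_is_zmod_morphism.

End BooleanizationMap.

Record dynsys (R : realType) (X : topologicalType) := DynSys {
  flow :> R -> X -> X;
  flow_continuous : continuous (fun z : R * X => flow z.1 z.2);
  flow0 : forall x, flow 0 x = x;
  flowD : forall s t x, flow t (flow s x) = flow (t + s) x }.

Record pdynsys (R : realType) (Lambda X : topologicalType) := PDynSys {
  pflow :> Lambda -> dynsys R X;
  pflow_continuous :
    continuous (fun z : R * X * Lambda => pflow z.2 z.1.1 z.1.2) }.

Section Attractors.
Context (R : realType) (X : topologicalType).
Implicit Types (phi : R -> X -> X) (U A : set X).

Definition omega phi U : set X :=
  \bigcap_(t in [set t : R | 0 <= t])
    closure (\bigcup_(s in [set s : R | t <= s]) (phi s @` U)).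

Definition attracting_nbhd phi U : Prop := omega phi U `<=` U^°.

Definition attractor phi A : Prop :=
  exists2 U, attracting_nbhd phi U & A = omega phi U.

Lemma omegaS phi U V : U `<=` V -> omega phi U `<=` omega phi V.
Proof.
move=> UV x Ux t t0; apply: closure_subset (Ux t t0).
by move=> y [s ts [z Uz <-]]; exists s => //; exists z => //; exact: UV.
Qed.

Lemma omegaU phi U V : omega phi (U `|` V) = omega phi U `|` omega phi V.
Proof.
apply/seteqP; split; last first.
  by rewrite subUset; split; apply: omegaS => ? ?; [left|right].
move=> x UVx; apply: contrapT => /not_orP[].
move=> /existsNP[t1 /not_implyP[t10 n1]] /existsNP[t2 /not_implyP[t20 n2]].
have t12 : 0 <= Num.max t1 t2 by rewrite le_max t10.
have := UVx _ t12; rewrite [X in closure X](_ : _ =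
   (\bigcup_(s in [set s : R | Num.max t1 t2 <= s]) (phi s @` U)) `|`
   (\bigcup_(s in [set s : R | Num.max t1 t2 <= s]) (phi s @` V))).
  rewrite closureU => -[]; [move: n1|move: n2]; apply: contra_not.
    apply: closure_subset => y [s /= ms sy]; exists s => //=.
    by rewrite (le_trans _ ms)// le_max lexx.
  apply: closure_subset => y [s /= ms sy]; exists s => //=.
  by rewrite (le_trans _ ms)// le_max lexx orbT.
by rewrite -bigcupU; apply: eq_bigcupr => s _; rewrite image_setU.
Qed.

Lemma omega0 phi : omega phi set0 = set0.
Proof.
apply/seteqP; split=> // x /(_ 0 (lexx 0)).
by rewrite bigcup0 ?closure0// => s _; rewrite image_set0.
Qed.

End Attractors.

Section AttractorLattice.
Context (R : realType) (X : topologicalType) (phi : dynsys R X).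
Implicit Types (U V A B : set X).

Lemma flow_cont t : continuous (phi t).
Proof.
move=> x; apply: (@continuous_comp _ _ _ (fun y => (t, y))
  (fun z : R * X => phi z.1 z.2)); last exact: flow_continuous.
by apply: (@cvg_pair _ _ _ (nbhs x) (nbhs t) (nbhs x)); [exact: cvg_cst|exact: cvg_id].
Qed.

Lemma flowK t : cancel (phi t) (phi (- t)).
Proof. by move=> x; rewrite flowD addNr flow0. Qed.

Lemma flowNK t : cancel (phi (- t)) (phi t).
Proof. by move=> x; rewrite flowD subrr flow0. Qed.

Lemma omega_flow U t x : omega phi U x -> omega phi U (phi t x).
Proof.
move=> Ux r r0 N Nx.
pose r' := Num.max 0 (r - t).
have r'0 : 0 <= r' by rewrite le_max lexx.
have /(_ (phi t @^-1` N)) := Ux r' r'0; case.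
  exact: (@flow_cont t x).
move=> y [[s /= r's [z Uz zy]] Ny]; exists (phi t y); split=> //.
exists (t + s); last by exists z => //; rewrite -zy flowD.
by rewrite /= -lerBlDl (le_trans _ r's)// le_max lexx orbT.
Qed.

Lemma omega_closed U : closed (omega phi U).
Proof. by apply: closed_bigI => t _; exact: closed_closure. Qed.

Lemma omegaK U : omega phi (omega phi U) = omega phi U.
Proof.
apply/seteqP; split=> x.
  move=> /(_ 0 (lexx 0)) Ux.
  have /closure_id Ucl := @omega_closed U.
  rewrite Ucl; apply: closure_subset Ux.
  by move=> y [s _ [z Uz <-]]; exact: omega_flow.
move=> Ux t t0; apply: subset_closure; exists t => //=.
by exists (phi (- t) x); [exact: omega_flow|exact: flowNK].
Qed.

Lemma omegaT : omega phi setT = setT.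
Proof.
apply/seteqP; split=> // x _ t t0; apply: subset_closure.
by exists t => //=; exists (phi (- t) x) => //; exact: flowNK.
Qed.

Lemma attracting_nbhdU U V : attracting_nbhd phi U -> attracting_nbhd phi V ->
  attracting_nbhd phi (U `|` V).
Proof.
move=> nU nV; rewrite /attracting_nbhd omegaU => x [/nU|/nV].
  by apply: interiorS => y; left.
by apply: interiorS => y; right.
Qed.

Lemma attracting_nbhdI U V : attracting_nbhd phi U -> attracting_nbhd phi V ->
  attracting_nbhd phi (U `&` V).
Proof.
move=> nU nV x UVx; rewrite interiorI; split.
  by apply: nU; apply: omegaS UVx => y [].
by apply: nV; apply: omegaS UVx => y [].
Qed.

Lemma omegaI_omega U V : attracting_nbhd phi U -> attracting_nbhd phi V ->
  omega phi (omega phi U `&` omega phi V) = omega phi (U `&` V).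
Proof.
move=> nU nV; apply/seteqP; split.
  by apply: omegaS; apply: setISS => x; [move=> /nU|move=> /nV];
    exact: interior_subset.
by rewrite -[X in X `<=` _]omegaK; apply: omegaS => x UVx; split;
  apply: omegaS UVx => y [].
Qed.

Lemma attractor_omega A : attractor phi A -> omega phi A = A.
Proof. by move=> [U _ ->]; exact: omegaK. Qed.

Lemma attractorU A B : attractor phi A -> attractor phi B ->
  attractor phi (A `|` B).
Proof.
move=> [U nU ->] [V nV ->]; exists (U `|` V); first exact: attracting_nbhdU.
by rewrite omegaU.
Qed.

Lemma attractorI A B : attractor phi A -> attractor phi B ->
  attractor phi (omega phi (A `&` B)).
Proof.
move=> [U nU ->] [V nV ->]; exists (U `&` V); first exact: attracting_nbhdI.
exact: omegaI_omega.
Qed.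

Lemma attracting_nbhd0 : attracting_nbhd phi set0.
Proof. by rewrite /attracting_nbhd omega0. Qed.

Lemma attracting_nbhdT : attracting_nbhd phi setT.
Proof. by rewrite /attracting_nbhd interiorT. Qed.

Lemma attractor0 : attractor phi set0.
Proof. by exists set0; [exact: attracting_nbhd0|rewrite omega0]. Qed.

Lemma attractorT : attractor phi (omega phi setT).
Proof. by exists setT; first exact: attracting_nbhdT. Qed.

End AttractorLattice.

Section AttractorSections.
Context (R : realType) (Lambda X : topologicalType) (phi : pdynsys R Lambda X).

Definition attractor_continuation (Omega : opens Lambda)
    (A : Omega -> set X) : Prop :=
  (forall l : Omega, attractor (phi (val l)) (A l)) /\
  forall m : Omega, exists (Omega0 : opens Lambda) (U : set X),
    [/\ Omega0 `<=` Omega, open_set Omega0 (val m) &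
        forall l : Omega, open_set Omega0 (val l) ->
          attracting_nbhd (phi (val l)) U /\ A l = omega (phi (val l)) U].

Section OnOpen.
Context (Omega : opens Lambda).

Record attractor_section := AttractorSection {
  att :> Omega -> set X;
  attP : attractor_continuation att }.
Implicit Types A B C : attractor_section.

HB.instance Definition _ := gen_eqMixin attractor_section.
HB.instance Definition _ := gen_choiceMixin attractor_section.

Lemma attractor_section_eq A B : (forall l, att A l = att B l) -> A = B.
Proof.
case: A B => [A PA] [B PB] /= /funext e.
by move: PB; rewrite -e => PB; congr AttractorSection; exact: Prop_irrelevance.
Qed.

Lemma att_attractor A l : attractor (phi (val l)) (att A l).
Proof. exact: (attP A).1. Qed.

Program Definition att_join A B : attractor_section :=
  @AttractorSection (fun l => att A l `|` att B l) _.
Next Obligation.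
move=> A B; split=> [l|m]; first by apply: attractorU; exact: att_attractor.
have [W1 [U [W1O W1m HU]]] := (attP A).2 m.
have [W2 [V [W2O W2m HV]]] := (attP B).2 m.
exists (opensI W1 W2), (U `|` V); split=> //; first by move=> x [/W1O].
move=> l [/HU[nU ->] /HV[nV ->]]; rewrite omegaU; split=> //.
exact: attracting_nbhdU.
Qed.

Program Definition att_meet A B : attractor_section :=
  @AttractorSection (fun l => omega (phi (val l)) (att A l `&` att B l)) _.
Next Obligation.
move=> A B; split=> [l|m]; first by apply: attractorI; exact: att_attractor.
have [W1 [U [W1O W1m HU]]] := (attP A).2 m.
have [W2 [V [W2O W2m HV]]] := (attP B).2 m.
exists (opensI W1 W2), (U `&` V); split=> //; first by move=> x [/W1O].
move=> l [/HU[nU ->] /HV[nV ->]]; rewrite omegaI_omega //; split=> //.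
exact: attracting_nbhdI.
Qed.

Program Definition att_bot : attractor_section :=
  @AttractorSection (fun l => set0) _.
Next Obligation.
split=> [l|m]; first exact: attractor0.
exists Omega, set0; split=> //; first exact: set_valP.
by move=> l _; rewrite omega0; split=> //; exact: attracting_nbhd0.
Qed.

Program Definition att_top : attractor_section :=
  @AttractorSection (fun l => omega (phi (val l)) setT) _.
Next Obligation.
split=> [l|m]; first exact: attractorT.
exists Omega, setT; split=> //; first exact: set_valP.
by move=> l _; split=> //; exact: attracting_nbhdT.
Qed.

Definition att_le : rel attractor_section := fun A B => `[< att_meet A B = A >].
Definition att_lt : rel attractor_section :=
  fun A B => (B != A) && att_le A B.

Lemma att_le_def A B : att_le A B = (att_meet A B == A).
Proof. by apply/asboolP/eqP. Qed.

Lemma att_meet_le A B l : att (att_meet A B) l `<=` att A l `&` att B l.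
Proof.
move=> x ABx; split.
  by rewrite -(attractor_omega (att_attractor A l)); apply: omegaS ABx => y [].
by rewrite -(attractor_omega (att_attractor B l)); apply: omegaS ABx => y [].
Qed.

Lemma att_meet_glb A B C l : att C l `<=` att A l -> att C l `<=` att B l ->
  att C l `<=` att (att_meet A B) l.
Proof.
move=> CA CB; rewrite -(attractor_omega (att_attractor C l)).
by apply: omegaS => x Cx; split; [exact: CA|exact: CB].
Qed.

Lemma att_meetC : commutative att_meet.
Proof. by move=> A B; apply: attractor_section_eq => l /=; rewrite setIC. Qed.

Lemma att_joinC : commutative att_join.
Proof. by move=> A B; apply: attractor_section_eq => l /=; rewrite setUC. Qed.

Lemma att_joinA : associative att_join.
Proof. by move=> A B C; apply: attractor_section_eq => l /=; rewrite setUA. Qed.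

Lemma att_meetA : associative att_meet.
Proof.
move=> A B C; apply: attractor_section_eq => l; apply/seteqP; split.
- apply: att_meet_glb; first apply: att_meet_glb.
  + by move=> x /att_meet_le[].
  + by move=> x /att_meet_le[_ /att_meet_le[]].
  + by move=> x /att_meet_le[_ /att_meet_le[]].
- apply: att_meet_glb; last apply: att_meet_glb.
  + by move=> x /att_meet_le[/att_meet_le[]].
  + by move=> x /att_meet_le[/att_meet_le[]].
  + by move=> x /att_meet_le[].
Qed.

Lemma att_joinKI B A : att_meet A (att_join A B) = A.
Proof.
apply: attractor_section_eq => l /=.
rewrite setIidl; last by move=> x; left.
exact/attractor_omega/att_attractor.
Qed.

Lemma att_meetKU B A : att_join A (att_meet A B) = A.
Proof.
apply: attractor_section_eq => l; apply/seteqP; split=> x /=; last by left.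
by move=> [//|/att_meet_le[]].
Qed.

Lemma att_meetUl : left_distributive att_meet att_join.
Proof.
by move=> A B C; apply: attractor_section_eq => l /=; rewrite setIUl omegaU.
Qed.

Lemma att_meetxx : idempotent_op att_meet.
Proof.
move=> A; apply: attractor_section_eq => l /=.
by rewrite setIid attractor_omega//; exact: att_attractor.
Qed.

HB.instance Definition _ := Order.isMeetJoinDistrLattice.Build
  Order.default_display attractor_section att_le_def (fun _ _ => erefl)
  att_meetC att_joinC att_meetA att_joinA att_joinKI att_meetKU att_meetUl
  att_meetxx.

Lemma att_bot_le (A : attractor_section) : (att_bot <= A)%O.
Proof.
apply/asboolP; apply: attractor_section_eq => l /=.
by rewrite set0I omega0.
Qed.

Lemma att_le_top (A : attractor_section) : (A <= att_top)%O.
Proof.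
apply/asboolP; apply: attractor_section_eq => l /=.
by rewrite omegaT setIT attractor_omega//; exact: att_attractor.
Qed.

HB.instance Definition _ := Order.hasBottom.Build
  Order.default_display attractor_section att_bot_le.
HB.instance Definition _ := Order.hasTop.Build
  Order.default_display attractor_section att_le_top.

End OnOpen.

Section Restriction.
Context (U V : opens Lambda) (VU : V `<=` U).

Definition opens_incl (l : V) : U := SigSub (mem_set (VU (set_valP l))).

Program Definition att_res (A : attractor_section U) : attractor_section V :=
  @AttractorSection V (fun l => att A (opens_incl l)) _.
Next Obligation.
move=> A; split=> [l|m]; first exact: (att_attractor A (opens_incl l)).
have [W1 [W [W1U W1m HW]]] := (attP A).2 (opens_incl m).
exists (opensI W1 V), W; split; first exact: opensIr.
  by split=> //; exact: set_valP.
by move=> l [/(HW (opens_incl l))].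
Qed.

Lemma att_resI : {morph att_res : A B / (A `&` B)%O}.
Proof. by move=> A B; exact: attractor_section_eq. Qed.
Lemma att_resU : {morph att_res : A B / (A `|` B)%O}.
Proof. by move=> A B; exact: attractor_section_eq. Qed.
Lemma att_res0 : att_res \bot%O = \bot%O.
Proof. exact: attractor_section_eq. Qed.
Lemma att_res1 : att_res \top%O = \top%O.
Proof. exact: attractor_section_eq. Qed.

Definition att_res_hom :
    blattice_hom (attractor_section U) (attractor_section V) :=
  BLatticeHom att_res0 att_res1 att_resI att_resU.

End Restriction.

Lemma booleanization_att_res_id (U : opens Lambda) (UU : U `<=` U) s :
  booleanization_map (att_res_hom UU) s = s.
Proof.
apply: booleanization_eq; apply/seteqP; split=> I /=;
rewrite (_ : spectrum_map _ I = I) //; apply: spectrum_eq => A /=;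
congr (ideal I _); apply: attractor_section_eq => l /=;
by congr (att A _); exact: val_inj.
Qed.

Lemma booleanization_att_res_comp (U V W : opens Lambda) (VU : V `<=` U)
    (WV : W `<=` V) (WU : W `<=` U) s :
  booleanization_map (att_res_hom WV) (booleanization_map (att_res_hom VU) s) =
  booleanization_map (att_res_hom WU) s.
Proof.
apply: booleanization_eq; apply/seteqP; split=> I /=;
rewrite (_ : spectrum_map _ (spectrum_map _ I) = spectrum_map (att_res_hom WU) I)
  //; apply: spectrum_eq => A /=;
congr (ideal I _); apply: attractor_section_eq => l /=;
by congr (att A _); exact: val_inj.
Qed.

Definition attractor_presheaf : presheaf Lambda :=
  @Presheaf Lambda (fun U => booleanization (attractor_section U))
    (fun U V VU => booleanization_map (att_res_hom VU))
    booleanization_att_res_id booleanization_att_res_comp.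

Definition attractor_sheaf : sheaf Lambda := sheafification attractor_presheaf.

End AttractorSections.

Definition repeller (R : realType) (X : topologicalType) (phi : R -> X -> X)
  (A : set X) : Prop := attractor (fun t => phi (- t)) A.

(* The vector field l * x - x ^ 2 is not complete: its solutions leave the real
   line in finite time, so with speed g = 1 there is no flow on the extended
   line having both ends as fixed points.  As conjugacies reparametrize time,
   only the orbits matter; psi is required to follow the solution
   curves of the equation with some positive continuous speed g, for instance
   g (l, x) = 1 / (1 + x ^ 2). *)
Definition transcritical (R : realType) (psi : pdynsys R R (\bar R)) : Prop :=
  exists g : R * R -> R,
    [/\ continuous g,
        forall z, 0 < g z,
        forall l x : R, exists xi : R -> R, forall t,
          psi l t x%:E = (xi t)%:E /\
          is_derive t 1 xi (g (l, xi t) * (l * xi t - xi t ^+ 2)),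
        forall l t, psi l t +oo%E = +oo%E /\ psi l t -oo%E = -oo%E &
        forall l, repeller (psi l) [set +oo%E] /\ attractor (psi l) [set -oo%E]].

Definition homeomorphism (X Y : topologicalType) (f : X -> Y) : Prop :=
  exists g : Y -> X, [/\ continuous f, continuous g, cancel f g & cancel g f].

Definition strictly_monotone (R : realType) (f : R -> R) : Prop :=
  (forall s t, s < t -> f s < f t) \/ (forall s t, s < t -> f t < f s).

(* The last clause matches the connected components of Y with those of X by a
   correspondence that does not depend on l. *)
Definition conjugate (R : realType) (Lambda Y X : topologicalType)
    (phi : pdynsys R Lambda Y) (psi : pdynsys R Lambda X) : Prop :=
  exists (h : Lambda * Y -> X) (tau : Lambda * R * Y -> R),
    [/\ continuous h /\ continuous tau,
        forall l, homeomorphism (fun y => h (l, y)),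
        forall l y, [/\ tau (l, 0, y) = 0,
          strictly_monotone (fun t => tau (l, t, y)) &
          bijective (fun t => tau (l, t, y))],
        forall l t y, h (l, phi l t y) = psi l (tau (l, t, y)) (h (l, y)) &
        forall y, exists x, forall l,
          (fun z => h (l, z)) @` connected_component setT y =
          connected_component setT x].

Definition acyclic (X : topologicalType) (S : sheaf X) : Prop :=
  forall k, (1 <= k)%N -> trivial_group (sheaf_cohomology S k).

(* Main.v *)
Require Import Defs.
From HB Require Import structures.
From mathcomp Require Import all_boot all_order all_algebra.
From mathcomp Require Import all_classical all_reals all_analysis.
From mathcomp Require Import lra.

Set Implicit Arguments.
Unset Strict Implicit.
Unset Printing Implicit Defensive.

Import Order.TTheory GRing.Theory Num.Theory.
Import numFieldTopology.Exports numFieldNormedType.Exports.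

Local Open Scope classical_set_scope.
Local Open Scope ring_scope.

(* The fixed points of the flow at l are -oo, n = min 0 l, m = max 0 l and +oo,
   with connecting orbits -oo <- n -> m <- +oo.  An attractor is determined by
   the fixed points it contains, since every orbit issues from one, and whether
   a continuous curve of fixed points lies in a continued attractor is locally
   constant in the parameter.  The clopens generated by {-oo}, [-oo, m] and the
   whole space are therefore global sections of the attractor sheaf, whereas
   {m} is an attractor for l <> 0 only: at l = 0 the points n and m coincide and
   a fourth generator is lost.  So the sheaf is the sum of the constant sheaf
   Z_2^3 and of the extension by zero of Z_2 from R \ {0}.  A conjugacy
   that reverses time exchanges the roles of attracting and repelling points,
   which amounts to replacing x by -x and (n, m) by (-m, -n).

   Each germ of this sheaf extends to the half-line pointing away from 0.  On an
   interval this makes global sections of C^0(S) / S liftable, by gluing local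
   lifts along the interval, and it holds for C^0(S) / S itself, where all germs
   extend globally; hence acyclicity, over R and over closed half-lines.
   H^1(R, A) is then the cokernel of the restriction of sections to A, which is
   generated by the section {m} when A does not contain 0. *)

(** * Sheaves on intervals *)

(** The section {m} over a half-line away from 0 does not extend across 0, so the sheaf is not soft
    and the usual vanishing criteria fail; extension of germs in one direction takes their place.
    The stalks are Booleanizations, made of all clopens of a spectrum that is never listed. Its
    compactness turns each clopen into a finite sum of attractors, and A + B = (A join B) + (A meet
    B) rewrites each attractor in the four generators. Conversely, the attractors that miss a fixed
    point q form a prime ideal, hence q evaluates germs in Z_2; the evaluations at the four fixed
    points prove independence. The speed in the equation is only continuous, so no uniqueness
    theorem applies. An estimate shows that the roots of the field are fixed points, and
    invertibility of the flow then keeps the other orbits away from them. The direction of time in a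
    conjugacy does not depend on the parameter: the time change at time 1 has no zero on the
    connected plane of pairs (l, x). *)

Section SheafGlue.
Context (X : topologicalType) (S : sheaf X).
Implicit Types (t u : serrations S).

Lemma section_eq_near x t u : section_at S x t -> section_at S x u ->
  t x = u x -> \forall y \near x, t y = u y.
Proof.
move=> St Su e.
have : (t - u) x = 0 by rewrite serrB e subrr.
move=> /(section_eq0 (sgB St Su)); apply: filterS => y.
by rewrite serrB => /eqP; rewrite subr_eq0 => /eqP.
Qed.

Lemma quot_pi_near x t u : (\forall y \near x, t y = u y) ->
  quot_pi (section_at S x) t = quot_pi (section_at S x) u.
Proof.
move=> tu; apply/eqP; rewrite -subr_eq0 -raddfB; apply/eqP/quot_pi_eq0.
apply: (section_local (sg0 (section_at S x))).
by apply: filterS tu => y tuy; rewrite serrB serr0 tuy subrr.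
Qed.

Lemma quot_pi_section x t u : quot_pi (section_at S x) t =
  quot_pi (section_at S x) u <-> section_at S x (t - u).
Proof.
split=> [e|tu]; first by apply/quot_pi_eq0; rewrite raddfB /= e subrr.
by apply/eqP; rewrite -subr_eq0 -raddfB; apply/eqP/quot_pi_eq0.
Qed.

End SheafGlue.

(* A chart v identifies X with an interval of R.  Replacing v by -v exchanges
   left and right. *)
Definition interval_chart (R : realType) (X : topologicalType) (v : X -> R) :=
  [/\ continuous v, injective v,
      forall x (N : set X), nbhs x N ->
        exists2 e, 0 < e & forall y, `|v y - v x| < e -> N y,
      forall x z r, v x <= r -> r <= v z -> exists y, v y = r &
      (forall x r, v x <= r -> exists2 b, v b <= r &
         forall y, v y <= r -> v y <= v b) /\
      (forall x r, r <= v x -> exists2 b, r <= v b &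
         forall y, r <= v y -> v b <= v y)].

Lemma interval_chartN (R : realType) (X : topologicalType) (v : X -> R) :
  interval_chart v -> interval_chart (fun x => - v x).
Proof.
move=> [cv iv bv ev [clR clL]]; split.
- by move=> x; apply: cvgN; exact: cv.
- by move=> x y /oppr_inj /iv.
- move=> x N /bv[e e0 He]; exists e => // y; rewrite -opprD normrN; exact: He.
- move=> x z r xr rz; have [||y vy] := ev z x (- r); [lra|lra|].
  by exists y; rewrite vy opprK.
- split=> x r xr.
    have [|b rb bm] := clL x (- r); first lra.
    exists b; first lra.
    by move=> y yr; have := bm y; rewrite lerN2; apply; lra.
  have [|b rb bm] := clR x (- r); first lra.
  exists b; first lra.
  by move=> y yr; have := bm y; rewrite lerN2; apply; lra.
Qed.

(** A one-sided form of flabbiness. Since r is continuous at p itself, it agrees on both sides of p,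
    near p, with every section through a; its values further left are free. *)
Definition extends_right (R : realType) (X : topologicalType) (v : X -> R)
    (S : sheaf X) (c : X) :=
  forall p, v c <= v p -> forall a : S p, exists2 r : serrations S,
    r p = a & forall y, v p <= v y -> section_at S y r.

Section HalfLine.
Context (R : realType) (X : topologicalType) (v : X -> R).
Hypothesis chv : interval_chart v.
Context (S : sheaf X) (c : X) (s : serrations (gquot S)).
Hypothesis ext : extends_right v S c.
Hypothesis gs : forall x, section_at (gquot S) x s.

Let L (t : serrations S) (y : X) := s y = quot_pi (section_at S y) t.

Lemma near_left (x : X) r : v x < r -> \forall y \near x, v y < r.
Proof.
have [cv _ _ _ _] := chv; move=> xr; apply: (cv x [set z | z < r]).
by apply: open_nbhs_nbhs; split => //; exact: open_lt.
Qed.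

Lemma near_right (x : X) r : r < v x -> \forall y \near x, r < v y.
Proof.
have [cv _ _ _ _] := chv; move=> xr; apply: (cv x [set z | r < z]).
by apply: open_nbhs_nbhs; split => //; exact: open_gt.
Qed.

Lemma lift_near t u y : (\forall z \near y, t z = u z) -> L t y -> L u y.
Proof. by move=> /quot_pi_near e; rewrite /L e. Qed.

(** Two lifts at b differ there by a section. Its germ extends to a section r on the right of b, and
    adding r to u does not change the class of u there; so w is t up to b and u + r beyond. *)
Lemma glue_right b t u : v c <= v b -> L t b -> L u b ->
  exists w, [/\ forall y, v y <= v b -> w y = t y,
    forall y, v y <= v b -> L t y -> L w y &
    forall y, v b < v y -> L u y -> L w y].
Proof.
have [cv iv bv ev [clR clL]] := chv => cb Lt Lu.
have Stu : section_at S b (t - u) by apply/quot_pi_section; rewrite -Lt.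
have [r rb Sr] := ext cb ((t - u) b).
exists (fun y => if v y <= v b then t y else (u + r) y).
(* Both sides are continuous at b with the same value. Hence u + r equals t near b, and w has the
   germ of t at b. *)
have nb : \forall y \near b, r y = (t - u) y.
  by apply: section_eq_near => //; exact: Sr.
split=> y.
- by move=> ->.
- rewrite le_eqVlt => /predU1P[/iv -> | yb]; apply: lift_near.
    apply: filterS nb => z rz; case: ifP => // _.
    by rewrite -[(u + r) z]/(u z + r z) rz serrB addrCA subrr addr0.
  by have := near_left yb; apply: filterS => z zb; rewrite ltW.
- move=> by_ Luy.
  have Lur : L (u + r) y.
    rewrite /L raddfD /= -[LHS]addr0; congr (_ + _); first exact: Luy.
    by apply/esym/quot_pi_eq0; apply: Sr; exact: ltW.
  apply: lift_near Lur.
  by have := near_right by_; apply: filterS => z bz; rewrite leNgt bz.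
Qed.

Lemma local_lift p : exists t, exists2 e, 0 < e & forall y, `|v y - v p| < e -> L t y.
Proof.
have [cv iv bv ev [clR clL]] := chv; have [t /bv[e e0 He]] := gs p.
by exists t, e.
Qed.

(** Compactness of a segment in the form of a supremum: E collects the right ends up to which a lift
    exists, and a local lift around sup E pushes the end further unless v b' is reached. *)
Lemma lift_segment b b' : v c <= v b -> v b <= v b' ->
  exists t, forall y, v b <= v y <= v b' -> L t y.
Proof.
have [cv iv bv ev [clR clL]] := chv => cb bb'.
pose E := [set r : R | v b <= r <= v b' /\
  exists t, forall y, v b <= v y <= r -> L t y].
have Eb : E (v b).
  split; first by rewrite lexx bb'.
  have [t [e e0 He]] := local_lift b; exists t => y /andP[h1 h2].
  have -> : y = b by apply: iv; apply/eqP; rewrite eq_le h1 h2.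
  by apply: He; rewrite subrr normr0.
have supE : has_sup E.
  by split; [exists (v b)|exists (v b') => r [/andP[]]].
have bm : v b <= sup E by apply: ub_le_sup => //; case: supE.
have mb' : sup E <= v b'.
  by apply: ge_sup; [exists (v b)|move=> r [/andP[]]].
have [p vp] := ev _ _ _ bm mb'.
have [t' [e e0 He]] := local_lift p.
(* The end r lies within the radius e of the local lift t' around sup E, so both lifts are valid at
   the point q above r and are glued there. *)
have [r [/andP[br rb'] [t Ht]] mr] := sup_adherent e0 supE.
have rm : r <= sup E by apply: ub_le_sup; [case: supE|split; [rewrite br|exists t]].
have [q vq] := ev _ _ _ br rb'.
have [|||w [w1 w2 w3]] := @glue_right q t t'.
- by rewrite vq; exact: le_trans br.
- by apply: Ht; rewrite vq br lexx.
- by apply: He; rewrite vq vp ltr_norml; apply/andP; split; lra.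
have Lw y : v b <= v y < sup E + e -> L w y.
  move=> /andP[by_ ye]; have [yq|qy] := leP (v y) (v q).
    by apply: w2 => //; apply: Ht; rewrite by_ -vq.
  by apply: w3 => //; apply: He; rewrite vp ltr_norml; apply/andP; split; lra.
have [mb|b'm] := ltP (sup E) (v b'); last first.
  by exists w => y /andP[h1 h2]; apply: Lw; apply/andP; split => //; lra.
have : E (Num.min (sup E + e / 2) (v b')).
  split; first by rewrite ge_min lexx orbT andbT le_min bb' andbT; lra.
  exists w => y /andP[h1]; rewrite le_min => /andP[h2 _]; apply: Lw.
  by rewrite h1 /=; lra.
move=> /(ub_le_sup supE.2); rewrite ge_min => /orP[]; lra.
Qed.

(** The bounds r and r' need not be values of v; the last points b and b' below them replace them,
    by the closedness clauses of [interval_chart]. Keeping t up to r makes the iteration in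
    [lift_right] stabilize at every point. *)
Lemma lift_step t (r r' : R) : v c <= r -> r <= r' ->
  (forall y, v c <= v y <= r -> L t y) ->
  exists w, (forall y, v y <= r -> w y = t y) /\
    forall y, v c <= v y <= r' -> L w y.
Proof.
have [cv iv bv ev [clR clL]] := chv => cr rr' Lt.
have [b br mb] := clR _ _ cr.
have [b' br' mb'] := clR _ _ (le_trans cr rr').
have cb : v c <= v b by exact: mb.
have bb' : v b <= v b' by apply: mb'; exact: le_trans rr'.
have [u Lu] := lift_segment cb bb'.
have [||w [w1 w2 w3]] := @glue_right b t u cb.
- by apply: Lt; rewrite cb br.
- by apply: Lu; rewrite lexx bb'.
exists w; split=> [y yr|y /andP[cy yr']]; first by apply: w1; exact: mb.
have [yb|yb] := leP (v y) (v b).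
  by apply: w2 => //; apply: Lt; rewrite cy (le_trans yb br).
by apply: w3 => //; apply: Lu; rewrite (ltW yb) mb'.
Qed.

(** The half-line is exhausted by the segments up to v c + n. The value at c is prescribed so that
    [gquot_lift] can join the lifts of the two half-lines. *)
Lemma lift_right t0 : L t0 c -> exists t,
  (forall y, v y <= v c -> t y = t0 y) /\ forall y, v c <= v y -> L t y.
Proof.
have [cv iv bv ev [clR clL]] := chv => L0.
pose P (n : nat) t := forall y, v c <= v y <= v c + n%:R -> L t y.
have P0 : P 0%N t0.
  move=> y; rewrite addr0 => /andP[h1 h2].
  by have -> : y = c by apply: iv; apply/eqP; rewrite eq_le h1 h2.
have step n (t : {t | P n t}) : {w : {w | P n.+1 w} |
    forall y, v y <= v c + n%:R -> sval w y = sval t y}.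
  apply: cid; have [|||w [w1 w2]] := @lift_step (sval t) (v c + n%:R) (v c + n.+1%:R).
  - by rewrite lerDl.
  - by rewrite lerD2l ler_nat.
  - exact: (svalP t).
  by exists (exist _ w w2).
pose F := nat_rect (fun n => {t | P n t}) (exist _ t0 P0)
  (fun n t => sval (step n t)).
have FS n y : v y <= v c + n%:R -> sval (F n.+1) y = sval (F n) y.
  by move=> yn; rewrite /= (svalP (step n (F n))).
have Fle n m y : (n <= m)%N -> v y <= v c + n%:R -> sval (F m) y = sval (F n) y.
  move=> + yn; elim: m => [|m IH]; first by rewrite leqn0 => /eqP ->.
  rewrite leq_eqVlt => /predU1P[-> //|nm]; rewrite FS ?IH //.
  by apply: le_trans yn _; rewrite lerD2l ler_nat.
have ex y : exists n : nat, v y <= v c + n%:R.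
  have [n yn] : exists n : nat, v y - v c < n%:R.
    exists (Num.bound `|v y - v c|); apply: le_lt_trans (ler_norm _) _.
    exact: archi_boundP.
  by exists n; lra.
pose N y := projT1 (cid (ex y)).
have NP y : v y <= v c + (N y)%:R by rewrite /N; case: cid.
have tE n y : v y <= v c + n%:R -> sval (F (N y)) y = sval (F n) y.
  move=> yn; have [nm|mn] := leqP n (N y); first exact: Fle.
  by apply/esym/Fle; [exact: ltnW|exact: NP].
exists (fun y => sval (F (N y)) y); split=> [y yc|y cy].
  by rewrite (tE 0%N) // addr0.
(* One stage more than N y: points near y may exceed v c + N y, and the germ at y needs a stage that
   is final for all of them. *)
have yN : v y < v c + (N y).+1%:R.
  by apply: le_lt_trans (NP y) _; rewrite ltrD2l ltr_nat.
have : L (sval (F (N y).+1)) y.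
  by apply: (svalP (F (N y).+1)); rewrite cy ltW.
apply: lift_near; have := near_left yN; apply: filterS => z zN.
by rewrite (tE (N y).+1) // ltW.
Qed.

End HalfLine.

(** The core of the vanishing results: global sections of the quotient of C^0(S) by S come from
    serrations. The left half is [lift_right] for the chart -v. *)
Lemma gquot_lift (R : realType) (X : topologicalType) (v : X -> R)
    (S : sheaf X) (c : X) : interval_chart v ->
  extends_right v S c -> extends_right (fun x => - v x) S c ->
  forall s, (forall x, section_at (gquot S) x s) ->
    exists t, forall y, s y = quot_pi (section_at S y) t.
Proof.
move=> chv eR eL s gs; have [t0 e0] := gs c.
have L0 := nbhs_singleton e0.
have [t [tc Lt]] := lift_right chv eR gs L0.
have [u [uc Lu]] := lift_right (interval_chartN chv) eL gs L0.
(* Two lifts at c differ by a section, which vanishes near c if it vanishes at c; so the right and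
   left lifts share the germ of t0 at c. *)
have agree w : s c = quot_pi (section_at S c) w -> w c = t0 c ->
    \forall y \near c, w y = t0 y.
  move=> Lw wc; have Sw : section_at S c (w - t0).
    by apply/quot_pi_section; rewrite -Lw.
  have : \forall y \near c, (w - t0) y = 0.
    by apply: section_eq0 Sw _; rewrite serrB wc subrr.
  apply: filterS => y; rewrite serrB => /eqP.
  by rewrite subr_eq0 => /eqP.
have nt := agree _ (Lt _ (lexx _)) (tc _ (lexx _)).
have nu := agree _ (Lu _ (lexx _)) (uc _ (lexx _)).
have [cv iv _ _ _] := chv.
exists (fun y => if v y <= v c then u y else t y) => y.
have [yc|cy|/iv yc] := ltgtP (v y) (v c).
- rewrite (Lu y) ?lerN2 ?ltW //; apply: quot_pi_near.
  by have := near_left chv yc; apply: filterS => z zc; rewrite ltW.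
- rewrite (Lt y (ltW cy)); apply: quot_pi_near.
  by have := near_right chv cy; apply: filterS => z zc; rewrite leNgt zc.
- rewrite yc (nbhs_singleton e0); apply: quot_pi_near.
  by near=> z; case: ifP => _; apply/esym; near: z.
Unshelve. all: by end_near. Qed.

(** * Vanishing in positive degrees on an interval *)

Lemma cohomology_trivial (C : complex) n :
  (forall s : C n, cdiff C n s = 0 -> is_coboundary s) ->
  trivial_group (cohomology C n).
Proof.
move=> H q; rewrite -[q]quot_reprK; apply/quot_pi_eq0.
exact/H/(sg_typeP (quot_repr q)).
Qed.

Lemma gdiff_eq0 (X : topologicalType) (S : sheaf X) n
    (s : serrations (gsheaf S n)) :
  gdiff s = 0 <-> forall x, section_at (gsheaf S n) x s.
Proof.
split=> [e x|H]; first by apply/quot_pi_eq0; have := congr1 (@^~ x) e.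
by apply: functional_extensionality_dep => x; apply/quot_pi_eq0.
Qed.

Lemma gquot_extends_right (R : realType) (X : topologicalType) (v : X -> R)
  (S : sheaf X) c : extends_right v (gquot S) c.
Proof.
move=> p _ a; exists (fun y => quot_pi (section_at S y) (quot_repr a)).
  exact: quot_reprK.
by move=> y _; exists (quot_repr a); exact: nearW.
Qed.

(** Each step of the resolution is an instance of [gquot_lift]. The extension hypotheses on S serve
    for n = 0; for larger n the sheaf is a quotient and [gquot_extends_right] applies. *)
Lemma gdiff_lift (R : realType) (X : topologicalType) (v : X -> R)
    (S : sheaf X) (c : X) : interval_chart v ->
  extends_right v S c -> extends_right (fun x => - v x) S c ->
  forall n (s : serrations (gsheaf S n.+1)), gdiff s = 0 ->
  exists t : serrations (gsheaf S n), gdiff t = s.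
Proof.
move=> chv eR eL n s /gdiff_eq0 gs.
have [||t Ht] := @gquot_lift R X v (gsheaf S n) c chv _ _ s gs.
- by case: n s gs => //= n _ _; exact: gquot_extends_right.
- by case: n s gs => //= n _ _; exact: gquot_extends_right.
exists t; apply: functional_extensionality_dep => x.
by rewrite Ht.
Qed.

(** * Lifting cochains from a subspace *)

Section Restriction.
Context (X : topologicalType) (A : set X).

Lemma serr_comap_surj (S : sheaf X) (T : sheaf A)
    (k : cohomomorphism (set_val : A -> X) S T) :
  (forall y (b : T y), exists a, k y a = b) ->
  forall u : serrations T, exists w, serr_comap k w = u.
Proof.
move=> ks u.
exists (fun x => if pselect (x \in A) is left Ax then
  projT1 (cid (ks (SigSub Ax) (u (SigSub Ax)))) : S x else 0).
apply: functional_extensionality_dep => -[x Ax].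
rewrite /serr_comap /=; case: pselect => // Ax'.
by rewrite (bool_irrelevance Ax' Ax); case: cid.
Qed.

Context (S : sheaf X).
Let incl := @inclusion_continuous X A.
Let k := inverse_image_comap incl S.

Lemma gsheaf_comap_surj n y (b : gsheaf (sheaf_restriction A S) n y) :
  exists a, gsheaf_comap incl k n y a = b.
Proof.
elim: n y b => [|n IH] y b; first by exists b.
have [w ew] := serr_comap_surj IH (quot_repr b).
exists (quot_pi _ w); rewrite /= /gquot_comap_fun quot_map_pi /= ew.
exact: quot_reprK.
Qed.

(** Right exactness of the sequence of complexes behind relative cohomology: serrations carry no
    continuity, so they are lifted stalkwise and set to 0 off A. *)
Lemma godement_map_surj n (u : serrations (gsheaf (sheaf_restriction A S) n)) :
  exists w, godement_map incl k n w = u.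
Proof. exact: (serr_comap_surj (@gsheaf_comap_surj n)). Qed.

End Restriction.

(** * Relative cohomology *)

Lemma iso_Z2 (G : zmodType) (e : G) : e != 0 ->
  (forall x : G, x = 0 \/ x = e) -> iso_group G 'Z_2.
Proof.
move=> e0 He; have ee : e + e = 0.
  case: (He (e + e)) => // /eqP; rewrite -subr_eq0 addrK => /eqP e00.
  by move: e0; rewrite e00 eqxx.
pose f (x : G) : 'Z_2 := if x == 0 then 0 else 1.
have fD : zmod_morphism f.
  have Ne : - e = e by apply/eqP; rewrite eq_sym -addr_eq0 ee.
  move=> x y; have -> : x - y = x + y by case: (He y) => ->; rewrite ?oppr0 ?Ne.
  rewrite /f; case: (He x) => ->; case: (He y) => ->;
  by rewrite ?addr0 ?add0r ?ee ?eqxx ?(negPf e0); apply/eqP.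
pose F := GRing.isZmodMorphism.Build G 'Z_2 f fD.
pose g : {additive G -> 'Z_2} := HB.pack f F.
exists g; exists (fun z : 'Z_2 => if z == 0 then 0 else e) => [x|z] /=.
  by rewrite /f; case: (He x) => ->; rewrite ?eqxx ?(negPf e0) ?eqxx.
rewrite /f; have [->|] := eqVneq z 0; first by rewrite eqxx.
by rewrite (negPf e0); case: z => -[|[|]] //= i h; apply/eqP.
Qed.

Section RelativeComputation.
Context (X : topologicalType) (A : set X) (S : sheaf X).

Let T := sheaf_restriction A S.
Let rho := godement_map (@inclusion_continuous X A)
  (inverse_image_comap (@inclusion_continuous X A) S).

Hypothesis liftX : forall n (s : serrations (gsheaf S n.+1)), gdiff s = 0 ->
  exists t : serrations (gsheaf S n), gdiff t = s.

Lemma relative_cocycle n (s : relative_godement A S n) :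
  cdiff (relative_godement A S) n s = 0 -> gdiff (val s) = 0 /\ rho n (val s) = 0.
Proof. by move=> /(congr1 val) s0; split=> //; exact: (sg_typeP s). Qed.

Lemma relative_cohomology0 :
  (forall s : serrations S, (forall x, section_at S x s) ->
     (forall y : A, s (set_val y) = 0) -> s = 0) ->
  trivial_group (relative_cohomology A S 0).
Proof.
move=> H; apply: cohomology_trivial => s /relative_cocycle[s0 r0].
apply: val_inj; apply: (H (val s)); first exact/(@gdiff_eq0 _ S 0).
by move=> y; exact: (congr1 (@^~ y) r0).
Qed.

Lemma relative_coboundary n (s : relative_godement A S n.+1)
    (t : serrations (gsheaf S n)) : gdiff t = val s -> rho n t = 0 ->
  is_coboundary s.
Proof. by move=> ts t0; exists (@sg_sub _ (Defs.kernel rho n) t t0); apply: val_inj. Qed.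

(** The exact sequence H^{n+1}(A) -> H^{n+2}(X, A) -> H^{n+2}(X) with both ends zero, as a chase: a
    primitive t over X is a cocycle on A, hence the differential of some u there, and subtracting
    the differential of a lift of u makes t vanish on A. *)
Lemma relative_cohomology_ge2 n :
  (forall s : serrations (gsheaf T n.+1), gdiff s = 0 ->
     exists t : serrations (gsheaf T n), gdiff t = s) ->
  trivial_group (relative_cohomology A S n.+2).
Proof.
move=> liftA; apply: cohomology_trivial => s /relative_cocycle[/liftX[t ts] r0].
have [|u ut] := liftA (rho n.+1 t).
  by have := cmap_diff rho t; rewrite /= ts => <-.
have [w wu] := godement_map_surj u.
apply: (@relative_coboundary n.+1 s (t - gdiff w)).
  by rewrite raddfB /= gdiffK subr0.
rewrite raddfB /=; apply/eqP; rewrite subr_eq0 -ut -wu; apply/eqP.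
exact/esym/(cmap_diff rho).
Qed.

(** The connecting map H^0(A) -> H^1(X, A) read backwards: s comes from the section of T that its
    primitive over X induces on A. *)
Lemma relative_cocycle1 (s : relative_godement A S 1) :
  cdiff (relative_godement A S) 1 s = 0 ->
  exists2 t : serrations S, gdiff (S := S) (n := 0) t = val s &
    forall y, section_at T y (rho 0 t).
Proof.
move=> /relative_cocycle[/(liftX (n := 0))[t ts] r0]; exists t => //.
apply/(@gdiff_eq0 _ T 0); rewrite -r0 -ts.
exact/esym/(@cmap_diff _ _ rho 0).
Qed.

Lemma relative_cohomology1_trivial :
  (forall u : serrations T, (forall y, section_at T y u) ->
    exists2 g : serrations S, (forall x, section_at S x g) & rho 0 g = u) ->
  trivial_group (relative_cohomology A S 1).
Proof.
move=> H; apply: cohomology_trivial => s /relative_cocycle1[t ts /H[g Sg gt]].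
apply: (@relative_coboundary 0 s (t - g)).
  by rewrite raddfB /= (iffRL (@gdiff_eq0 _ S 0 g) Sg) subr0.
by rewrite raddfB /= gt subrr.
Qed.

(** The generator is the image of the section [rho 0 w] under the connecting map, that is, the class
    of the differential of w. *)
Lemma relative_cohomology1_Z2 (w : serrations S) :
  (forall y, section_at T y (rho 0 w)) ->
  (forall u : serrations T, (forall y, section_at T y u) ->
    exists2 g : serrations S, (forall x, section_at S x g) &
      u = rho 0 g \/ u = rho 0 g + rho 0 w) ->
  (forall g : serrations S, (forall x, section_at S x g) ->
    rho 0 g <> rho 0 w) ->
  iso_group (relative_cohomology A S 1) 'Z_2.
Proof.
move=> Tw H nw.
have k0 : rho 1 (gdiff (S := S) (n := 0) w) = 0.
  by have := @cmap_diff _ _ rho 0 w; rewrite /= => ->;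
    exact: (iffRL (@gdiff_eq0 _ T 0 (rho 0 w)) Tw).
pose dw : relative_godement A S 1 := @sg_sub _ (Defs.kernel rho 1) _ k0.
have dw0 : cdiff (relative_godement A S) 1 dw = 0.
  by apply: val_inj; exact: (@gdiffK _ S 0 w).
pose e := quot_pi (coboundaries (relative_godement A S) 1)
  (@sg_sub _ (cocycles (relative_godement A S) 1) _ dw0).
have e0 : e != 0.
  apply/eqP => /quot_pi_eq0[t /(congr1 val) /= tw].
  have rt : rho 0 (val t) = 0 by exact: (sg_typeP t).
  (* If dw is the differential of a cochain t that vanishes on A, then w - t is a global section
     with the restriction of w. *)
  apply: (nw (w - val t)).
    by apply/(@gdiff_eq0 _ S 0); rewrite raddfB /= tw subrr.
  by rewrite raddfB /= rt subr0.
apply: (iso_Z2 e0) => q; rewrite -[q]quot_reprK.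
have qP := sg_typeP (quot_repr q); move: (quot_repr q) qP => /= s qP.
have [t ts /H[g Sg [tg|tg]]] := relative_cocycle1 qP; [left|right].
- apply/quot_pi_eq0; apply: (@relative_coboundary 0 (val s) (t - g)).
    by rewrite raddfB /= (iffRL (@gdiff_eq0 _ S 0 g) Sg) subr0.
  by rewrite raddfB /= tg subrr.
- apply/eqP; rewrite -subr_eq0 -raddfB; apply/eqP/quot_pi_eq0.
  apply: (@relative_coboundary 0 _ (t - g - w)).
    rewrite !raddfB /= (iffRL (@gdiff_eq0 _ S 0 g) Sg) subr0 ts.
    by [].
  by rewrite !raddfB /= tg [X in X - _ - _]addrC addrK subrr.
Qed.

End RelativeComputation.

(** * Cohomology from a frame of sections *)

(** Let sup E be the end of the longest stretch of P starting at x. The point above it lies in P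
    because the complement is open, and the stretch continues past it because P is open. *)
Lemma chart_connected_right (R : realType) (X : topologicalType) (v : X -> R)
    (P : set X) (x z : X) : interval_chart v -> open P -> open (~` P) ->
  P x -> v x <= v z -> P z.
Proof.
move=> [cv iv bv ev _] oP oC Px xz.
pose E := [set r : R | v x <= r <= v z /\ forall y, v x <= v y <= r -> P y].
have Ex : E (v x).
  split=> [|y /andP[h1 h2]]; first by rewrite lexx xz.
  by have -> : y = x by apply: iv; apply/eqP; rewrite eq_le h1 h2.
have supE : has_sup E by split; [exists (v x)|exists (v z) => r [/andP[]]].
have xm : v x <= sup E by apply: ub_le_sup => //; case: supE.
have mz : sup E <= v z by apply: ge_sup; [exists (v x)|move=> r [/andP[]]].
have [p vp] := ev _ _ _ xm mz.
have Ep (e : R) : 0 < e -> exists2 r, E r & sup E - e < r.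
  by move=> e0; have [r] := sup_adherent e0 supE; exists r.
have Pp : P p.
  apply: contrapT => nPp.
  have /bv[e e0 He] : nbhs p (~` P) by apply: open_nbhs_nbhs.
  have [r [/andP[xr rz] Hr] mr] := Ep e e0.
  have rm : r <= sup E by apply: ub_le_sup; [case: supE|split; [rewrite xr|]].
  have [q vq] := ev _ _ _ xr rz.
  have : (~` P) q by apply: He; rewrite vp vq ltr_norml; apply/andP; split; lra.
  by apply; apply: Hr; rewrite vq xr lexx.
have /bv[e e0 He] : nbhs p P by apply: open_nbhs_nbhs.
have Py y : v x <= v y < sup E + e -> P y.
  move=> /andP[xy ye]; have [ym|my] := ltP (v y) (sup E).
    have [|r [_ Hr] mr] := Ep (sup E - v y); first by lra.
    by apply: Hr; rewrite xy /=; lra.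
  by apply: He; rewrite vp ltr_norml; apply/andP; split; lra.
have [mz'|zm] := ltP (sup E) (v z); last by apply: Py; rewrite xz /=; lra.
have : E (Num.min (sup E + e / 2) (v z)).
  split; first by rewrite ge_min lexx orbT andbT le_min xz andbT; lra.
  move=> y /andP[h1]; rewrite le_min => /andP[h2 _]; apply: Py.
  by rewrite h1 /=; lra.
by move=> /(ub_le_sup supE.2); rewrite ge_min => /orP[]; lra.
Qed.

Lemma chart_connected (R : realType) (X : topologicalType) (v : X -> R)
    (P : set X) (x z : X) : interval_chart v -> open P -> open (~` P) ->
  P x -> P z.
Proof.
move=> chv oP oC Px; have [xz|/ltW zx] := leP (v x) (v z).
  exact: (chart_connected_right chv oP oC Px).
by apply: (chart_connected_right (interval_chartN chv) oP oC Px); rewrite lerN2.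
Qed.

(* The étalé space of S is Hausdorff, so sections over a connected space are
   determined by one value. *)
Lemma section_identity (R : realType) (X : topologicalType) (v : X -> R)
    (S : sheaf X) (s : serrations S) (x : X) : interval_chart v ->
  (forall x, section_at S x s) ->
  (forall x, s x != 0 -> \forall y \near x, s y != 0) ->
  s x = 0 -> s = 0.
Proof.
move=> chv Ss Hs sx; apply: functional_extensionality_dep => z.
apply: (chart_connected (P := [set y | s y = 0]) z chv _ _ sx).
- rewrite openE => y /= y0; apply: section_eq0 => //.
- rewrite openE => y /= /eqP/Hs; rewrite /interior /=.
  by apply: filterS => w /eqP.
Qed.

Lemma interval_chart_id (R : realType) : interval_chart (@id R).
Proof.
split.
- by move=> x; exact: cvg_id.
- by [].
- move=> x N; rewrite -filter_from_ballE => -[e /= e0 He]; exists e => //.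
  by move=> y xy; apply: He; rewrite /ball /= distrC.
- by move=> x z r _ _; exists r.
- by split=> x r _; exists r.
Qed.

Lemma interval_chart_set_val (R : realType) (A : set R) :
  (forall x z r, A x -> A z -> x <= r <= z -> A r) ->
  (forall x r, A x -> x <= r -> exists b, [/\ A b, b <= r &
     forall y, A y -> y <= r -> y <= b]) ->
  (forall x r, A x -> r <= x -> exists b, [/\ A b, r <= b &
     forall y, A y -> r <= y -> b <= y]) ->
  interval_chart (set_val : A -> R).
Proof.
move=> Aconv Aup Adn.
have AP (x : A) : A (set_val x) by exact: set_valP.
split.
- exact: initial_continuous.
- exact: val_inj.
- move=> x N [B [[C oC CB] Bx BN]].
  have : nbhs (set_val x) C by apply: open_nbhs_nbhs; split=> //; rewrite -CB in Bx.
  rewrite -filter_from_ballE => -[e /= e0 He]; exists e => // y xy; apply: BN.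
  by rewrite -CB /=; apply: He; rewrite /ball /= distrC.
- move=> x z r xr rz; have Ar : A r by apply: (Aconv _ _ r (AP x) (AP z)); rewrite xr.
  by exists (SigSub (mem_set Ar)).
- split=> x r xr; [have [b [Ab br Hb]] := Aup _ _ (AP x) xr|
    have [b [Ab br Hb]] := Adn _ _ (AP x) xr];
  by exists (SigSub (mem_set Ab)) => // y; apply: Hb.
Qed.

Lemma iso_of_bijective (G H : zmodType) (g : {additive H -> G}) :
  (forall x, g x = 0 -> x = 0) -> (forall y, exists x, g x = y) ->
  iso_group G H.
Proof.
move=> g0 gs; pose f y := projT1 (cid (gs y)).
have fK : cancel f g by move=> y; rewrite /f; case: cid.
have gI : injective g.
  by move=> x y e; apply/eqP; rewrite -subr_eq0; apply/eqP/g0; rewrite raddfB e subrr.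
have fB : zmod_morphism f by move=> x y; apply: gI; rewrite raddfB !fK.
pose F := GRing.isZmodMorphism.Build G H f fB.
pose h : {additive G -> H} := HB.pack f F.
by exists h; exists g => // x; apply: gI; exact: fK.
Qed.

Section Frame.
Context (R : realType) (S : sheaf R).
Implicit Types x : R.

(** Booleans stand for coefficients in Z_2. Since f generates only away from 0, the uses below admit
    d at x only if x != 0. *)
Definition frame_comb (e1 e2 e3 f : serrations S) (c1 c2 c3 d : bool) : serrations S :=
  fun x => e1 x *+ c1 + e2 x *+ c2 + e3 x *+ c3 + f x *+ d.

(* S is the direct sum of a constant sheaf Z_2^3 with basis e1, e2, e3 and of
   the extension by zero of the constant sheaf Z_2 on R \ {0} with generator f. *)
Record frame (e1 e2 e3 f : serrations S) : Prop := Frame {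
  frame_e1 : forall x, section_at S x e1;
  frame_e2 : forall x, section_at S x e2;
  frame_e3 : forall x, section_at S x e3;
  frame_f : forall x, x != 0 -> section_at S x f;
  frame_char2 : forall x (a : S x), a + a = 0;
  frame_span : forall x (a : S x), exists c1 c2 c3 d : bool,
    (d -> x != 0) /\ a = frame_comb e1 e2 e3 f c1 c2 c3 d x;
  frame_free : forall x (c1 c2 c3 d : bool), (d -> x != 0) ->
    frame_comb e1 e2 e3 f c1 c2 c3 d x = 0 ->
    [/\ c1 = false, c2 = false, c3 = false & d = false] }.

Context (e1 e2 e3 f : serrations S) (F : frame e1 e2 e3 f).
Let comb := frame_comb e1 e2 e3 f.

Lemma comb_section x (c1 c2 c3 d : bool) : (d -> x != 0) ->
  section_at S x (comb c1 c2 c3 d).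
Proof.
have sgD (s t : serrations S) : section_at S x s -> section_at S x t ->
    section_at S x (s + t).
  move=> Ss St; rewrite -[t]opprK; apply: sgB => //; rewrite -sub0r.
  by apply: sgB => //; exact: sg0.
have sgb (s : serrations S) (b : bool) : (b -> section_at S x s) ->
    section_at S x (fun x => s x *+ b).
  by case: b => [/(_ isT) //| _]; exact: sg0.
move=> dx; apply: (sgD (fun x => e1 x *+ c1 + e2 x *+ c2 + e3 x *+ c3)
  (fun x => f x *+ d)).
  apply: (sgD (fun x => e1 x *+ c1 + e2 x *+ c2) (fun x => e3 x *+ c3)).
    apply: (sgD (fun x => e1 x *+ c1) (fun x => e2 x *+ c2)).
      by apply: sgb => _; exact: frame_e1 F _.
    by apply: sgb => _; exact: frame_e2 F _.
  by apply: sgb => _; exact: frame_e3 F _.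
by apply: sgb => /dx; exact: frame_f F _.
Qed.

(** Near x the section s is the combination with the coefficients of s x. They are not all zero, and
    the frame stays independent at nearby points because the complement of 0 is open. *)
Lemma frame_near_neq0 x (s : serrations S) : section_at S x s -> s x != 0 ->
  \forall y \near x, s y != 0.
Proof.
move=> Ss sx0; have [c1 [c2 [c3 [d [dx sx]]]]] := frame_span F (s x).
have := section_eq_near Ss (@comb_section x c1 c2 c3 d dx) sx.
have dy : \forall y \near x, d -> y != 0.
  case: d dx {sx} => [/(_ isT) x0|_]; last first.
    by apply: (filterS (F := nbhs x) _ (@filterT _ (nbhs x) _)).
  have : nbhs x (~` [set (0 : R)]).
    apply: open_nbhs_nbhs; split; last exact/eqP.
    by apply: closed_openC; apply: accessible_closed_set1; exact: hausdorff_accessible.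
  by apply: filterS => y /eqP.
move=> sy; near=> y.
have dy' : d -> y != 0 by near: y.
have -> : s y = comb c1 c2 c3 d y by near: y.
apply/eqP => /(frame_free F dy')[h1 h2 h3 h4].
by move: sx0; rewrite sx /frame_comb h1 h2 h3 h4 !addr0 eqxx.
Unshelve. all: by end_near. Qed.

Lemma frame_extends_right : extends_right id S 0.
Proof.
move=> p p0 a; have [c1 [c2 [c3 [d [dp ->]]]]] := frame_span F a.
exists (comb c1 c2 c3 d) => // y py; apply: comb_section => /dp p1.
have p_gt0 : 0 < p by rewrite lt_neqAle eq_sym p1.
exact/lt0r_neq0/(lt_le_trans p_gt0).
Qed.

Lemma frame_extends_left : extends_right (fun x : R => - x) S 0.
Proof.
move=> p; rewrite lerN2 => p0 a; have [c1 [c2 [c3 [d [dp ->]]]]] := frame_span F a.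
exists (comb c1 c2 c3 d) => // y; rewrite lerN2 => py; apply: comb_section => /dp p1.
have p_lt0 : p < 0 by rewrite lt_neqAle p1.
exact/ltr0_neq0/(le_lt_trans py).
Qed.

Lemma frame_lift n (s : serrations (gsheaf S n.+1)) : gdiff s = 0 ->
  exists t : serrations (gsheaf S n), gdiff t = s.
Proof.
apply: (gdiff_lift (@interval_chart_id R) frame_extends_right).
exact: frame_extends_left.
Qed.

Lemma frame_acyclic : acyclic S.
Proof.
move=> [//|k] _; apply: cohomology_trivial => s s0.
exact: frame_lift.
Qed.

(** The comparison is made at 0, where f cannot contribute; [section_identity] carries it to the
    whole line. *)
Lemma frame_global (s : serrations S) : (forall x, section_at S x s) ->
  exists c1 c2 c3 : bool, s = comb c1 c2 c3 false.
Proof.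
move=> Ss; have [c1 [c2 [c3 [d [d0 s0]]]]] := frame_span F (s 0).
have {d0}dF : d = false by apply/negP => /d0; rewrite eqxx.
rewrite {}dF in s0; exists c1, c2, c3; apply/eqP; rewrite -subr_eq0; apply/eqP.
have Su x : section_at S x (s - comb c1 c2 c3 false).
  by apply: sgB => //; exact: comb_section.
apply: (section_identity (x := 0) (@interval_chart_id R) Su).
  by move=> x; exact: frame_near_neq0.
by rewrite serrB s0 subrr.
Qed.

(** The map sends coordinate vectors to combinations of e1, e2, e3. Independence at 0 gives
    injectivity, [frame_global] surjectivity. *)
Lemma frame_cohomology0 : iso_group (sheaf_cohomology S 0) 'rV['Z_2]_3.
Proof.
pose G := sheaf_cohomology S 0.
have cz (s : serrations S) : cocycles (godement S) 0 s <->
    forall x, section_at S x s by exact: (@gdiff_eq0 _ S 0).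
pose b (v : 'rV['Z_2]_3) i : bool := v ord0 (inord i) != 0.
pose cb (v : 'rV['Z_2]_3) := comb (b v 0%N) (b v 1%N) (b v 2%N) false.
have cbP v : cocycles (godement S) 0 (cb v).
  by apply/cz => x; exact: comb_section.
pose g v : G := quot_pi _ (sg_sub (cbP v)).
have gB : zmod_morphism g.
  move=> v w; rewrite /g -raddfB; congr (quot_pi _ _); apply: val_inj => /=.
  apply: functional_extensionality_dep => x; rewrite serrB /cb /comb /frame_comb.
  have bB i (a : S x) : a *+ b (v - w) i = a *+ b v i - a *+ b w i.
    have aa : - a = a by apply/eqP; rewrite eq_sym -addr_eq0 (frame_char2 F).
    rewrite /b !mxE; case: (v _ _) => -[|[|]] // ? ; case: (w _ _) => -[|[|]] // ? /=;
    by rewrite ?subr0 ?sub0r ?subrr ?aa.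
  rewrite !bB !mulr0n !addr0 !opprD [RHS]addrACA; congr (_ + _).
  by rewrite [RHS]addrACA.
pose F' := GRing.isZmodMorphism.Build 'rV['Z_2]_3 G g gB.
pose h : {additive 'rV['Z_2]_3 -> G} := HB.pack g F'.
apply: (iso_of_bijective (g := h)) => [v /quot_pi_eq0 /= v0|q].
  have [] := frame_free F (x := 0) (c1 := b v 0%N) (c2 := b v 1%N)
    (c3 := b v 2%N) (d := false); rewrite // -?/(comb _ _ _ _).
    exact: (congr1 (@^~ 0) v0).
  move=> b0 b1 b2 _; apply/rowP => -[i i3]; rewrite mxE.
  have bi j : b v j = false -> v ord0 (inord j) = 0 by move=> /negbFE/eqP.
  have -> : Ordinal i3 = inord i by apply: val_inj; rewrite /= inordK.
  by case: i i3 => [|[|[|]]] // _; exact: bi.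
rewrite -[q]quot_reprK; have := sg_typeP (quot_repr q).
move: (quot_repr q) => s /cz/frame_global[c1 [c2 [c3 sE]]].
pose c i : bool := nth false [:: c1; c2; c3] i.
exists (\row_(i < 3) (if c i then 1 else 0)); rewrite /= /g.
congr (quot_pi _ _); apply: val_inj; rewrite /= sE /cb.
have bE i : (i < 3)%N -> b (\row_(i < 3) (if c i then 1 else 0)) i = c i.
  by move=> i3; rewrite /b mxE inordK //; case: (c i).
by rewrite !bE.
Qed.

Section Relative.
Context (A : set R) (c : A).
Hypothesis chA : interval_chart (set_val : A -> R).
Let T := sheaf_restriction A S.
Let rho := godement_map (@inclusion_continuous R A)
  (inverse_image_comap (@inclusion_continuous R A) S).

Lemma restriction_section (s : serrations S) (y : A) :
  section_at S (set_val y) s -> section_at T y (rho 0 s).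
Proof. exact: (@inverse_image_comap_subproof _ _ _ (@inclusion_continuous R A)). Qed.

Lemma restriction_section_near (u : serrations T) (y : A) :
  section_at T y u -> exists2 s : serrations S, section_at S (set_val y) s &
    \forall z \near y, u z = rho 0 s z.
Proof. by []. Qed.

(** The right-hand side is a section on all of A, since A avoids 0 when f occurs; two sections over
    the interval A that agree at x are equal. *)
Lemma restriction_section_global (u : serrations T) (x : A)
    (c1 c2 c3 d : bool) :
  (forall y, section_at T y u) -> (d -> ~ A 0) ->
  u x = comb c1 c2 c3 d (set_val x) -> u = rho 0 (comb c1 c2 c3 d).
Proof.
move=> Tu dA ux; apply/eqP; rewrite -subr_eq0; apply/eqP.
have Tuc (y : A) : section_at T y (u - rho 0 (comb c1 c2 c3 d)).
  apply: sgB => //; apply: restriction_section; apply: comb_section => dd.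
  by apply/eqP => y0; apply: (dA dd); rewrite -y0; exact: set_valP.
apply: (section_identity (x := x) chA Tuc); last first.
  by rewrite serrB ux; exact: subrr.
move=> y y0; have [s Ss us] := restriction_section_near (Tuc y).
have sy : s (set_val y) != 0.
  have e : (u - rho 0 (comb c1 c2 c3 d)) y = s (set_val y) := nbhs_singleton us.
  by rewrite -e.
have := @inclusion_continuous R A y _ (frame_near_neq0 Ss sy).
move=> ns; near=> z.
have -> : (u - rho 0 (comb c1 c2 c3 d)) z = rho 0 s z by near: z.
by near: z; exact: ns.
Unshelve. all: by end_near. Qed.

Hypothesis extR : extends_right (set_val : A -> R) T c.
Hypothesis extL : extends_right (fun y : A => - set_val y) T c.

(** In degree 0 a section that vanishes at c is zero. In degree 1 a section over A is compared at 0
    with a combination free of f, which extends to the line. Above, both the line and A are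
    acyclic. *)
Lemma frame_relative_trivial k : k <> 1%N \/ A 0 ->
  trivial_group (relative_cohomology A S k).
Proof.
case: k => [|[|k]] H.
- apply: relative_cohomology0 => s Ss s0.
  apply: (section_identity (x := set_val c) (@interval_chart_id R) Ss) => //.
  by move=> x; exact: frame_near_neq0.
- have A0 : A 0 by case: H.
  apply: (relative_cohomology1_trivial frame_lift) => u Tu.
  pose x : A := SigSub (mem_set A0).
  have [c1 [c2 [c3 [d [d0 ux]]]]] := frame_span F (u x : S 0).
  have {d0}dF : d = false by apply/negP => /d0; rewrite eqxx.
  rewrite {}dF in ux; exists (comb c1 c2 c3 false).
    by move=> y; exact: comb_section.
  by apply/esym/(restriction_section_global (x := x)).
- apply: (relative_cohomology_ge2 frame_lift) => s.
  exact: (gdiff_lift chA extR extL).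
Qed.

Lemma frame_relative_Z2 : ~ A 0 -> iso_group (relative_cohomology A S 1) 'Z_2.
Proof.
move=> A0; have y0 (y : A) : set_val y != 0.
  by apply/eqP => e; apply: A0; rewrite -e; exact: set_valP.
apply: (relative_cohomology1_Z2 frame_lift (w := f)).
- by move=> y; apply: restriction_section; apply: frame_f F _ _.
- move=> u Tu.
  have [c1 [c2 [c3 [d [d0 ux]]]]] := frame_span F (u c : S (set_val c)).
  (* The part free of f extends to the line; the coefficient d is the class of u in the cokernel. *)
  exists (comb c1 c2 c3 false); first by move=> y; exact: comb_section.
  have -> : u = rho 0 (comb c1 c2 c3 d) by apply: (restriction_section_global (x := c)).
  case: d {d0 ux}; [right|by left].
  rewrite -raddfD; congr (rho 0 _); apply: functional_extensionality_dep => x.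
  rewrite -[RHS]/(comb c1 c2 c3 false x + f x).
  by rewrite /comb /frame_comb mulr0n addr0.
- move=> g /frame_global[c1 [c2 [c3 ->]]] /(congr1 (@^~ c)) e.
  have dc : true -> set_val c != 0 by [].
  have [] // := frame_free F (c1 := c1) (c2 := c2) (c3 := c3) dc.
  move: e; rewrite /= /serr_comap /= /comb /frame_comb mulr0n addr0 => ->.
  exact: frame_char2 F _ _.
Qed.

End Relative.

End Frame.

(** * Closed half-lines *)

Section FrameHalfLines.
Context (R : realType) (S : sheaf R) (e1 e2 e3 f : serrations S).
Hypothesis F : frame e1 e2 e3 f.

Lemma interval_chart_right (a : R) :
  interval_chart (set_val : `[a, +oo[%classic -> R).
Proof.
apply: interval_chart_set_val => [x z r|x r|x r]; rewrite /= !in_itv /= !andbT.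
- by move=> ax az /andP[xr rz]; exact: le_trans xr.
- by move=> ax xr; exists r; rewrite /= in_itv /= (le_trans ax xr).
- move=> ax rx; have [ar|/ltW ra] := leP a r.
    by exists r; rewrite /= in_itv /= ar.
  by exists a; rewrite /= in_itv /= lexx; split=> // y; rewrite in_itv /= andbT.
Qed.

Lemma interval_chart_left (a : R) :
  interval_chart (set_val : `]-oo, a]%classic -> R).
Proof.
apply: interval_chart_set_val => [x z r|x r|x r]; rewrite /= !in_itv /=.
- by move=> ax az /andP[xr rz]; exact: le_trans az.
- move=> ax rx; have [ar|/ltW ra] := leP r a.
    by exists r; rewrite /= in_itv /= ar.
  by exists a; rewrite /= in_itv /= lexx; split=> // y; rewrite in_itv /=.
- by move=> ax rx; exists r; rewrite /= in_itv /= (le_trans rx ax).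
Qed.

Lemma restrict_extends_right (A : set R) (c : A) : 0 <= set_val c ->
  extends_right (set_val : A -> R) (sheaf_restriction A S) c.
Proof.
move=> c0 p cp a.
have [r rp Sr] := frame_extends_right F (le_trans c0 cp : id 0 <= id (set_val p)) a.
exists (fun z => r (set_val z)) => // y /Sr Sy.
exact: (@restriction_section R S A r y).
Qed.

Lemma restrict_extends_left (A : set R) (c : A) : set_val c <= 0 ->
  extends_right (fun y : A => - set_val y) (sheaf_restriction A S) c.
Proof.
move=> c0 p; rewrite lerN2 => cp a.
have p0 : - (0 : R) <= - set_val p by rewrite lerN2 (le_trans cp).
have [r rp Sr] := frame_extends_left F p0 a.
exists (fun z => r (set_val z)) => // y /Sr Sy.
exact: (@restriction_section R S A r y).
Qed.

(** At a last point c the only half-line to extend over is {c}, so any local section through the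
    germ serves. *)
Lemma extends_right_max (X : topologicalType) (v : X -> R) (T : sheaf X) c :
  injective v -> (forall y, v y <= v c) -> extends_right v T c.
Proof.
move=> vI cm p cp a; have [s Ss sa] := section_surj a; exists s => // y py.
suff -> : y = p by [].
apply: vI; apply/eqP; rewrite eq_le py andbT; exact: le_trans (cm y) cp.
Qed.

(** The base point is 0 if the half-line contains it, so that both directions point away from 0.
    Otherwise it is the end a, and leftward extension reduces to [extends_right_max]. *)
Lemma frame_right_base (a : R) : exists c : `[a, +oo[%classic,
  extends_right (set_val : `[a, +oo[%classic -> R) (sheaf_restriction _ S) c /\
  extends_right (fun y : `[a, +oo[%classic => - set_val y) (sheaf_restriction _ S) c.
Proof.
have cA : `[a, +oo[%classic (Num.max a 0) by rewrite /= in_itv /= le_max lexx.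
exists (SigSub (mem_set cA)); split.
  by apply: restrict_extends_right; rewrite /= le_max lexx orbT.
have [a0|] := boolP (a <= 0); last rewrite -ltNge => a0.
  by apply: restrict_extends_left; rewrite -[set_val _]/(Num.max a 0) (max_r a0).
apply: extends_right_max => [x y /oppr_inj|y]; first exact: val_inj.
rewrite lerN2 -[leLHS]/(Num.max a 0) (max_l (ltW a0)).
by have := set_valP y; rewrite /= in_itv /= andbT.
Qed.

Lemma frame_left_base (a : R) : exists c : `]-oo, a]%classic,
  extends_right (set_val : `]-oo, a]%classic -> R) (sheaf_restriction _ S) c /\
  extends_right (fun y : `]-oo, a]%classic => - set_val y) (sheaf_restriction _ S) c.
Proof.
have cA : `]-oo, a]%classic (Num.min a 0) by rewrite /= in_itv /= ge_min lexx.
exists (SigSub (mem_set cA)); split; last first.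
  by apply: restrict_extends_left; rewrite /= ge_min lexx orbT.
have [a0|] := boolP (0 <= a); last rewrite -ltNge => a0.
  by apply: restrict_extends_right; rewrite -[set_val _]/(Num.min a 0) (min_r a0).
apply: extends_right_max; first exact: val_inj.
move=> y; rewrite -[leRHS]/(Num.min a 0) (min_l (ltW a0)).
by have := set_valP y; rewrite /= in_itv /=.
Qed.

Lemma frame_relative_half_lines (a : R) (k : nat) :
  ((k = 1%N /\ 0 < a ->
      iso_group (relative_cohomology `[a, +oo[ S k) 'Z_2) /\
   (k <> 1%N \/ a <= 0 ->
      trivial_group (relative_cohomology `[a, +oo[ S k))) /\
  ((k = 1%N /\ a < 0 ->
      iso_group (relative_cohomology `]-oo, a] S k) 'Z_2) /\
   (k <> 1%N \/ 0 <= a ->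
      trivial_group (relative_cohomology `]-oo, a] S k))).
Proof.
have [c [cR cL]] := frame_right_base a.
have [b [bR bL]] := frame_left_base a.
split; split.
- move=> [-> a0]; apply: (frame_relative_Z2 F c (@interval_chart_right a)).
  by rewrite /= in_itv /= andbT; lra.
- move=> H; apply: (frame_relative_trivial F (@interval_chart_right a) cR cL).
  by case: H => [|a0]; [left|right; rewrite /= in_itv /= andbT].
- move=> [-> a0]; apply: (frame_relative_Z2 F b (@interval_chart_left a)).
  by rewrite /= in_itv /=; lra.
- move=> H; apply: (frame_relative_trivial F (@interval_chart_left a) bR bL).
  by case: H => [|a0]; [left|right; rewrite /= in_itv /=].
Qed.

End FrameHalfLines.

(** * Clopens of the Priestley spectrum *)

Section Spectrum.
Context d (L : tbDistrLatticeType d).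
Implicit Types (A B : L) (I J : spectrum L).

Lemma spectrum_cvg (F : set_system (spectrum L)) I : Filter F ->
  (forall A, F [set J : spectrum L | J A = I A]) -> F --> I.
Proof.
move=> FF H N; rewrite nbhsE => -[B [[C oC CB] BI] BN].
suff : (@ideal _ L) @ F --> (ideal I : {ptws L -> bool}).
  move=> /(_ C) FC; rewrite nbhs_simpl.
  have : F (@ideal _ L @^-1` C).
    by apply: FC; apply: open_nbhs_nbhs; split=> //; rewrite -CB in BI.
  by rewrite CB; exact: filterS.
apply/cvg_sup => A U.
have /= -> := @nbhsE (initial_topology (fun f : L -> bool => f A)) (ideal I).
move=> [B' [[W oW <-] WI]] /filterS; apply.
have : F [set J : spectrum L | W (J A)].
  by apply: (filterS _ (H A)) => J JA; move: WI; rewrite /= -JA.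
by [].
Qed.

Lemma spectrum_near_eq I A : \forall J \near I, @ideal _ L J A = I A.
Proof.
have : nbhs (ideal I : {ptws L -> bool}) [set f | f A = I A].
  have := @proj_continuous _ (fun=> bool) A (ideal I : {ptws L -> bool}).
  move=> /(_ [set b | b = I A]); apply.
  by apply: open_nbhs_nbhs; split=> //; exact: discrete_open.
exact: (@initial_continuous _ {ptws L -> bool} (@ideal _ L) I).
Qed.

(** An ultrafilter F of prime ideals converges to the set of all A that belong to F-almost every
    ideal; the axioms of a prime ideal pass to this limit, primality because F decides every set. *)
Lemma spectrum_compact : compact [set: spectrum L].
Proof.
rewrite compact_ultra => F UF _.
have FN (P : set (spectrum L)) : ~ F P -> F (~` P).
  by case: (in_ultra_setVsetC P UF).
have Fex (P : set (spectrum L)) : F P -> exists J, P J by exact: filter_ex.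
pose I A : bool := `[< F [set J : spectrum L | J A] >].
have IF A : F [set J : spectrum L | J A = I A].
  rewrite /I; case: asboolP => // /FN; apply: filterS => J /= /negP.
  exact: negbTE.
have pI : prime_ideal I.
  split.
  - by apply/asboolP; apply: filterS filterT => J _; have [] := idealP J.
  - by apply/asboolPn => /Fex[J]; have [_ /negP] := idealP J.
  - move=> x y xy /asboolP Fy; apply/asboolP; apply: filterS Fy => J /=.
    by have [_ _ + _ _] := idealP J; apply.
  - move=> x y /asboolP Fx /asboolP Fy; apply/asboolP.
    apply: filterS (filterI Fx Fy) => J /= [Jx Jy].
    by have [_ _ _ + _] := idealP J; apply.
  - move=> x y /asboolP Fxy; have [Fx|/FN Fx] := pselect (F [set J : spectrum L | J x]).
      by left; apply/asboolP.
    right; apply/asboolP; apply: filterS (filterI Fx Fxy) => J /= [Jx].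
    by have [_ _ _ _ H] := idealP J => /H[].
exists (PrimeIdeal pI); split => //.
exact: spectrum_cvg.
Qed.

Lemma clopen_near C I : clopen C -> \forall J \near I, C J <-> C I.
Proof.
move=> [oC cC]; have [CI|nCI] := pselect (C I).
  have : nbhs I C by apply: open_nbhs_nbhs.
  by apply: filterS => J CJ; split.
have : nbhs I (~` C) by apply: open_nbhs_nbhs; split=> //; exact: closed_openC.
by apply: filterS => J nCJ; split.
Qed.

(** Each point has a neighbourhood given by finitely many coordinates on which membership in C is
    constant. Compactness makes one finite list of coordinates serve all points. *)
Lemma clopen_finitary (C : set (spectrum L)) : clopen C ->
  exists l : seq L, forall I J, (forall A, A \in l -> I A = J A) -> C I -> C J.
Proof.
move=> clC.
(* The filter of large finite lists: compactness, in its near-covering form, is applied along it. *)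
pose F : set_system (seq L) :=
  [set Q | exists l0 : seq L, forall l : seq L, {subset l0 <= l} -> Q l].
have FF : Filter F.
  split.
  - by exists [::].
  - move=> P Q [l1 H1] [l2 H2]; exists (l1 ++ l2) => l sl; split.
      by apply: H1 => x xl; apply: sl; rewrite mem_cat xl.
    by apply: H2 => x xl; apply: sl; rewrite mem_cat xl orbT.
  - by move=> P Q PQ [l H]; exists l => l' /H/PQ.
pose P (l : seq L) I := forall J, (forall A, A \in l -> I A = J A) -> (C I <-> C J).
have near_finitary (N : set (spectrum L)) I : nbhs I N ->
    exists l : seq L, forall J, (forall A, A \in l -> J A = I A) -> N J.
  pose G : set_system (spectrum L) :=
    [set N | exists l : seq L, forall J, (forall A, A \in l -> J A = I A) -> N J].
  have FG : Filter G.
    split.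
    - by exists [::].
    - move=> Q1 Q2 [l1 H1] [l2 H2]; exists (l1 ++ l2) => J HJ; split.
        by apply: H1 => A Al; apply: HJ; rewrite mem_cat Al.
      by apply: H2 => A Al; apply: HJ; rewrite mem_cat Al orbT.
    - by move=> Q1 Q2 Q12 [l H]; exists l => J /H/Q12.
  suff : G --> I by apply.
  apply: spectrum_cvg => A; exists [:: A] => J; apply.
  by rewrite mem_head.
have : \near F, [set: spectrum L] `<=` P F.
  apply: (compact_near_coveringP _).1 => //; first exact: spectrum_compact.
  move=> I _; have [l Hl] := near_finitary _ _ (clopen_near I clC).
  exists ([set J : spectrum L | forall A, A \in l -> J A = I A],
    [set l' | {subset l <= l'}]).
    split; last by exists l.
    elim: l {Hl} => [|A l IH]; first by apply: filterS filterT.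
    apply: filterS2 IH (spectrum_near_eq I A) => J /= HJ JA B.
    by rewrite inE => /predU1P[->|/HJ].
  move=> [J l'] /= [HJ ll'] K HK; apply: (iff_trans (Hl _ HJ)).
  apply: iff_sym; apply: Hl => A Al; rewrite -HK ?HJ //; exact: ll'.
by move=> [l /(_ l (fun _ => id)) H]; exists l => I J /(H I Logic.I) [].
Qed.

Lemma nonmember_clopen A : clopen [set I : spectrum L | ~~ I A].
Proof.
split.
- rewrite openE => I /= IA; have := spectrum_near_eq I A.
  by apply: filterS => J /= ->.
- rewrite -[X in closed X]setCK; apply: open_closedC.
  rewrite openE => I /= /negP; rewrite negbK => IA; have := spectrum_near_eq I A.
  by apply: filterS => J /= ->; rewrite IA.
Qed.

(** The canonical embedding of L in its Booleanization. The points are ideals, so it is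
    nonmembership that makes the map increasing. *)
Definition lattice_clopen A : booleanization L := Clopen (nonmember_clopen A).

Lemma lattice_clopen0 : lattice_clopen \bot%O = 0.
Proof.
apply: booleanization_eq; apply/seteqP; split=> // I /=.
by have [-> ] := idealP I.
Qed.

Lemma lattice_clopenT : lattice_clopen \top%O = 1.
Proof.
apply: booleanization_eq; apply/seteqP; split=> // I _ /=.
by have [_ ->] := idealP I.
Qed.

Lemma lattice_clopenI A B :
  lattice_clopen (A `&` B)%O = lattice_clopen A * lattice_clopen B.
Proof.
apply: booleanization_eq; apply/seteqP; split=> I /=; have [_ _ le _ pr] := idealP I.
  move=> nAB; split; apply: contra nAB; apply: le; [exact: leIl|exact: leIr].
by move=> [nA nB]; apply/negP => /pr[]; apply/negP.
Qed.

(** Inclusion-exclusion, with the symmetric difference as sum. *)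
Lemma lattice_clopenU A B : lattice_clopen (A `|` B)%O =
  lattice_clopen A + lattice_clopen B + lattice_clopen (A `&` B)%O.
Proof.
rewrite lattice_clopenI.
apply: booleanization_eq; apply/seteqP; split=> I /=;
  have [_ _ le jn _] := idealP I; rewrite /setY /setD /=;
  have jnE : ~~ I (A `|` B)%O <-> (~~ I A) \/ (~~ I B).
1,3: split=> [|[|]]; [|by apply: contra; apply: le; exact: leUl
                       |by apply: contra; apply: le; exact: leUr].
1,2: by move=> nAB; apply/orP; rewrite -negb_and;
  apply: contra nAB => /andP[]; exact: jn.
all: have := EM (~~ I A); have := EM (~~ I B); tauto.
Qed.

Lemma booleanization_char2 (C : booleanization L) : C + C = 0.
Proof. by apply: booleanization_eq; exact: setYK. Qed.

(** A clopen is a boolean function of finitely many memberships, hence a polynomial in lattice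
    elements. Products of lattice elements are meets, so sums are enough. *)
Lemma booleanization_span (C : booleanization L) :
  exists l : seq L, C = \sum_(A <- l) lattice_clopen A.
Proof.
pose span (C : booleanization L) :=
  exists l : seq L, C = \sum_(A <- l) lattice_clopen A.
have spD C1 C2 : span C1 -> span C2 -> span (C1 + C2).
  by move=> [l1 ->] [l2 ->]; exists (l1 ++ l2); rewrite big_cat.
have spM A C1 : span C1 -> span (lattice_clopen A * C1).
  move=> [l ->]; exists [seq (A `&` B)%O | B <- l]; rewrite big_map mulr_sumr.
  by apply: eq_bigr => B _; rewrite lattice_clopenI.
have span0 : span 0 by exists [::]; rewrite big_nil.
have span1 : span 1 by exists [:: \top%O]; rewrite big_seq1 lattice_clopenT.
have H (l : seq L) (g : seq bool -> bool) :
    exists2 C', span C' & forall I, clopen_set C' I <-> g (map (ideal I) l).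
  elim: l g => [|A l IH] g.
    exists (if g [::] then 1 else 0); first by case: ifP.
    by move=> I /=; case: ifP.
  have [C1 s1 H1] := IH (fun s => g (true :: s)).
  have [C2 s2 H2] := IH (fun s => g (false :: s)).
  (* Case distinction on A as a polynomial, (1 + A) C1 + A C2; the clopen of A is the locus where
     the bit of A is false, so there C2 is selected. *)
  exists (C1 + lattice_clopen A * C1 + lattice_clopen A * C2).
    apply: (spD); last exact: (spM).
    by apply: spD => //; exact: spM.
  move=> I /=; have := H1 I; have := H2 I; rewrite /setY /setD /=.
  have := EM (clopen_set C1 I); have := EM (clopen_set C2 I).
  case: (I A) => /=; last first.
    have t : ~~ false by []. tauto.
  have t : ~ (~~ true) by []. tauto.
have [l Hl] := clopen_finitary (clopen_setP C).
have [C' spC' HC'] := H l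
  (fun s => `[< exists2 I, map (@ideal _ L I) l = s & clopen_set C I >]).
suff -> : C = C' by [].
apply: booleanization_eq; apply/seteqP; split=> I.
  by move=> CI; apply/HC'; apply/asboolP; exists I.
move=> /HC'/asboolP[J /eq_in_map JI CJ]; exact: Hl CJ.
Qed.

End Spectrum.

(** * Attractors and fixed points *)

Section LimitSets.
Context (R : realType) (X : topologicalType) (phi : dynsys R X).
Implicit Types (U W A N : set X) (q y : X).

Definition fixed_point q := forall t, phi t q = q.

Definition alpha_cluster y q := forall N, nbhs q N -> forall T : R,
  exists2 t, T <= t & N (phi (- t) y).

Definition omega_cluster y q := forall N, nbhs q N -> forall T : R,
  exists2 t, T <= t & N (phi t y).

Lemma fixed_point_omega q U : fixed_point q -> closure U q -> omega phi U q.
Proof.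
move=> fq clq t t0 N qN.
have /clq[y [Uy Ny]] : nbhs q (phi t @^-1` N) by apply: flow_cont; rewrite fq.
by exists (phi t y); split=> //; exists t => //=; exists y.
Qed.

Lemma attractor_closed A : attractor phi A -> closed A.
Proof. by move=> [U _ ->]; exact: omega_closed. Qed.

Lemma attractor_flow A t y : attractor phi A -> A y -> A (phi t y).
Proof. by move=> [U _ ->]; exact: omega_flow. Qed.

Lemma attractor_omega_cluster A y q : attractor phi A -> omega_cluster y q ->
  A y -> A q.
Proof.
move=> aA yq Ay; apply: (attractor_closed aA) => N /yq/(_ 0)[t _ Nt].
by exists (phi t y); split=> //; exact: attractor_flow.
Qed.

(** From y to q: A is closed and invariant. From q to y: the backward orbit of y returns to an
    attracting neighbourhood U of q at arbitrarily late times s, so y lies in the time-s image of U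
    for such s. *)
Lemma attractor_alpha_cluster A y q : attractor phi A -> alpha_cluster y q ->
  (A y <-> A q).
Proof.
move=> aA yq; split=> [Ay|].
  apply: (attractor_closed aA) => N /yq/(_ 0)[t _ Nt].
  by exists (phi (- t) y); split=> //; exact: attractor_flow.
move: aA => [U nU ->] /nU; rewrite /interior => /yq qU t t0.
have [s ts Us] := qU t; apply: subset_closure; exists s => //.
by exists (phi (- s) y) => //; exact: flowNK.
Qed.

(** The omega-limit set stays in the closed set U. It is invariant, so each of its points is the
    time-1 image of a point of U and is therefore interior. *)
Lemma trapping_attracting U : closed U ->
  (forall t y, 0 < t -> U y -> U^° (phi t y)) -> attracting_nbhd phi U.
Proof.
move=> cU tU.
have oU : omega phi U `<=` U.
  move=> x /(_ 0 (lexx 0)) Ux; rewrite ((closure_id U).1 cU).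
  apply: closure_subset Ux => y [s /=]; rewrite le_eqVlt => /predU1P[<-|s0] [z Uz <-].
    by rewrite flow0.
  by apply: (@interior_subset _ U); exact: tU.
move=> x Ux; rewrite -(flowNK phi 1 x); apply: tU => //; apply: oU.
exact: omega_flow.
Qed.

Lemma attractor_fixed_point U q : attracting_nbhd phi U -> fixed_point q ->
  (omega phi U q <-> U q).
Proof.
move=> nU fq; split=> [/nU|Uq]; first exact: interior_subset.
by apply: fixed_point_omega => //; exact: subset_closure.
Qed.

End LimitSets.

(** * Persistence of attracting neighbourhoods under the parameter *)

Section ParameterStability.
Context (R : realType) (Lambda X : topologicalType) (phi : pdynsys R Lambda X).
Hypothesis compactX : compact [set: X].

(** The closed sets K t decrease to the omega-limit set, so by compactness one of them already lies
    in O. Continuity of each time-t map extends this from U to its closure. *)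
Lemma omega_uniform (psi : dynsys R X) U (O : set X) : open O ->
  omega psi U `<=` O -> exists T : R, forall t y, T <= t -> closure U y ->
  O (psi t y).
Proof.
move=> oO UO.
pose K t := closure (\bigcup_(s in [set s : R | t <= s]) (psi s @` U)).
have Kmono t t' : t <= t' -> K t' `<=` K t.
  move=> tt'; apply: closure_subset => y [s /= ts' sy]; exists s => //=.
  exact: le_trans ts'.
have : \forall t \near +oo, [set: X] `<=` (fun y => K t y -> O y).
  apply: (compact_near_coveringP _).1 => // y _.
  have [Oy|nOy] := pselect (O y).
    have : nbhs y O by apply: open_nbhs_nbhs.
    by move=> nO; exists (O, setT) => [|[z t] [/= Oz _] _] //; split=> //;
      exact: filterT.
  have /existsNP[t0 /not_implyP[t00 nK]] : ~ omega psi U y by move/UO.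
  exists (~` K t0, [set t | t0 <= t]).
    split; last by apply: nbhs_pinfty_ge; exact: num_real.
    by apply: open_nbhs_nbhs; split=> //; apply: closed_openC; exact: closed_closure.
  by move=> [z t] /= [nKz /Kmono Kt] /Kt.
move=> [M [_ HM]]; exists (M + 1) => t y Mt Uy; apply: (HM t _ _ Logic.I).
  by apply: lt_le_trans Mt; rewrite ltrDl.
move=> N /(@flow_cont _ _ psi t y) /Uy[z [Uz Nz]].
by exists (psi t z); split=> //; exists t => //=; exists z.
Qed.

(** Continuity controls nearby parameters only on compact time intervals. The window [T, 2T] is
    enough: every longer time is a sum of steps within it, and each step returns to U. *)
Lemma attracting_nbhd_near l U : attracting_nbhd (phi l) U ->
  \forall m \near l, attracting_nbhd (phi m) U.
Proof.
move=> /(omega_uniform (@open_interior _ U))[T0 HT0].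
(* The maximum with 1 makes the step length positive. *)
pose T := Num.max T0 1.
have T1 : 1 <= T by rewrite le_max lexx orbT.
have T_gt0 : 0 < T by exact: lt_le_trans T1.
have HT t y : T <= t -> closure U y -> U^° (phi l t y).
  by move=> Tt; apply: HT0 => //; apply: le_trans Tt; rewrite le_max lexx.
have cK : compact ([set` `[T, T + T]] `*` closure U).
  apply: compact_setX; first exact: segment_compact.
  by apply: (subclosed_compact _ compactX) => //; exact: closed_closure.
have : \forall m \near l, [set` `[T, T + T]] `*` closure U `<=`
    (fun z => U^° (phi m z.1 z.2)).
  apply: (compact_near_coveringP _).1 => // -[t y] [/= tT Uy].
  have : nbhs (t, y, l) [set z : R * X * Lambda | U^° (phi z.2 z.1.1 z.1.2)].
    apply: (@pflow_continuous _ _ _ phi (t, y, l)); apply: open_nbhs_nbhs.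
    split; first exact: open_interior.
    by apply: HT => //=; move: tT; rewrite in_itv /= => /andP[].
  move=> [[P Q] [/= nP nQ] PQ]; exists (P, Q); first by [].
  by move=> [z m] /= [Pz Qm]; exact: (PQ (z, m)).
apply: filterS => m Hm.
have Hk (k : nat) t y : T <= t -> t <= T *+ k.+2 -> closure U y ->
    U^° (phi m t y).
  elim: k t y => [|k IH] t y Tt tk Uy.
    by apply: (Hm (t, y)); split=> //=; rewrite in_itv /= Tt -mulr2n.
  have [t2|t2] := leP t (T + T).
    by apply: (Hm (t, y)); split=> //=; rewrite in_itv /= Tt.
  have -> : t = T + (t - T) by rewrite addrC subrK.
  rewrite -flowD; apply: (Hm (T, _)); split=> /=.
    by rewrite in_itv /= lexx lerDl ltW.
  apply: subset_closure; apply: (@interior_subset _ U); apply: IH => //; first lra.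
  by rewrite lerBlDl -mulrS.
have Ht t y : T <= t -> closure U y -> U^° (phi m t y).
  move=> Tt Uy; pose k := Num.bound (t / T).
  apply: (Hk k) => //; apply: (@le_trans _ _ (T *+ k)).
    rewrite -mulr_natr mulrC -ler_pdivrMr //; apply/ltW.
    by apply: archi_boundP; apply: divr_ge0; apply/ltW => //; exact: lt_le_trans Tt.
  by apply: ler_wpMn2l; [exact: ltW|rewrite -addn2 leq_addr].
have oU : omega (phi m) U `<=` closure U.
  move=> x /(_ T (ltW T_gt0)) Ux.
  rewrite ((closure_id (closure U)).1 (@closed_closure _ U)).
  apply: closure_subset Ux => y [s /= Ts [z Uz <-]].
  apply: subset_closure; apply: (@interior_subset _ U); apply: Ht => //.
  exact: subset_closure.
move=> x Ux; rewrite -(flowNK (phi m) T x); apply: Ht => //; apply: oU.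
exact: omega_flow.
Qed.

(** A fixed point in U is interior to U, and one outside U is outside its closure, since
    [fixed_point_omega] puts fixed points of the closure into the omega-limit set. Both cases are
    open conditions. *)
Lemma fixed_point_near (p : Lambda -> X) l U :
  {for l, continuous p} -> (forall m, fixed_point (phi m) (p m)) ->
  attracting_nbhd (phi l) U -> \forall m \near l, U (p m) <-> U (p l).
Proof.
move=> cp fp nU; have [Ul|nUl] := pselect (U (p l)).
  have : nbhs (p l) U by apply: (nU); exact: (attractor_fixed_point nU (fp l)).2.
  by move=> /cp H; apply: (filterS _ (H : \forall m \near l, U (p m))) => m Um.
have : nbhs (p l) (~` closure U).
  apply: open_nbhs_nbhs; split; first exact/closed_openC/closed_closure.
  move=> /(fixed_point_omega (fp l)) /nU H; apply: nUl.
  exact: (@interior_subset _ U).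
move=> /cp H; apply: (filterS _ (H : \forall m \near l, ~ closure U (p m))).
move=> m nUm; split=> // Um.
by case: nUm; exact: subset_closure.
Qed.

End ParameterStability.

(** * Flows on the extended line *)

(* Attracting fixed points p1, p3 and repelling ones p2, p4, with connecting
   orbits p1 <- p2 -> p3 <- p4; p2 = p3 is a semistable point. *)
Record transcritical_fiber (R : realType) (Y : topologicalType)
    (phi : dynsys R Y) (p1 p2 p3 p4 : Y) : Prop := TranscriticalFiber {
  fiber_fixed : [/\ fixed_point phi p1, fixed_point phi p2,
    fixed_point phi p3 & fixed_point phi p4];
  fiber_alpha : forall y, [\/ alpha_cluster phi y p1, alpha_cluster phi y p2,
    alpha_cluster phi y p3 | alpha_cluster phi y p4];
  fiber_connect : forall A, attractor phi A ->
    [/\ A p2 -> A p1, A p2 -> A p3 & A p4 -> A p3];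
  fiber_attractor1 : exists2 U, attracting_nbhd phi U &
    [/\ U p1, ~ U p2, ~ U p3 & ~ U p4];
  fiber_attractor123 : exists2 U, attracting_nbhd phi U &
    [/\ U p1, U p2, U p3 & ~ U p4];
  fiber_attractor3 : p2 <> p3 -> exists2 U, attracting_nbhd phi U &
    [/\ ~ U p1, ~ U p2, U p3 & ~ U p4] }.

Section LineFlow.
Context (R : realType) (Y : topologicalType) (phi : dynsys R Y).
Context (H : Y -> \bar R) (K : \bar R -> Y) (n m : R).
Hypotheses (cH : continuous H) (cK : continuous K).
Hypotheses (HK : cancel H K) (KH : cancel K H).
Hypothesis nm : n <= m.
Hypothesis fixed_ninfty : fixed_point phi (K -oo%E).
Hypothesis fixed_pinfty : fixed_point phi (K +oo%E).
Hypothesis fixed_n : fixed_point phi (K n%:E).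
Hypothesis fixed_m : fixed_point phi (K m%:E).
Hypothesis gap_left : forall y t, (H y < n%:E)%E -> (H (phi t y) < n%:E)%E.
Hypothesis gap_right : forall y t, (m%:E < H y)%E -> (m%:E < H (phi t y))%E.
Hypothesis move_left : forall y x s t, H y = x%:E -> x < n \/ m < x -> s < t ->
  (H (phi t y) < H (phi s y))%E.
Hypothesis move_right : forall y x s t, H y = x%:E -> n < x < m -> s < t ->
  (H (phi s y) < H (phi t y))%E.

Lemma ge_left y t : (n%:E <= H y)%E -> (n%:E <= H (phi t y))%E.
Proof.
rewrite !leNgt; apply: contra => /(gap_left (- t)).
by rewrite flowK.
Qed.

Lemma le_right y t : (H y <= m%:E)%E -> (H (phi t y) <= m%:E)%E.
Proof.
rewrite !leNgt; apply: contra => /(gap_right (- t)).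
by rewrite flowK.
Qed.

(** The factor s, which is 1 or -1 in the uses, treats both directions of time at once. Shifting the
    sequence by one shows that the limit is fixed by the time-s map. *)
Lemma orbit_limit y s (L : \bar R) : H (phi (s * k%:R) y) @[k --> \oo] --> L ->
  phi s (K L) = K L /\ forall N, nbhs (K L) N -> forall T : R,
    exists2 t, T <= t & N (phi (s * t) y).
Proof.
move=> uL; have yL : phi (s * k%:R) y @[k --> \oo] --> K L.
  have := cvg_comp _ _ uL (@cK L).
  by apply: cvg_trans; apply: near_eq_cvg; apply: nearW => k /=; rewrite HK.
split.
  apply: (can_inj HK); rewrite KH.
  pose u (k : nat) := H (phi s (phi (s * k%:R) y)).
  have u1 : u @ \oo --> H (phi s (K L)).
    exact: cvg_comp _ _ (cvg_comp _ _ yL (@flow_cont _ _ phi s (K L)))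
      (@cH (phi s (K L))).
  have u2 : u @ \oo --> L.
    have := uL; rewrite -cvg_shiftS; apply: cvg_trans.
    apply: near_eq_cvg; apply: nearW => k /=.
    by rewrite /u flowD -[k.+1]addn1 natrD mulrDr mulr1 addrC.
  exact: (cvg_unique (@ereal_hausdorff R) u1 u2).
move=> N /yL[k0 _ Hk] T; pose k := maxn k0 (Num.bound `|T|).
exists k%:R; last by apply: Hk; rewrite /= leq_maxl.
apply: le_trans (ler_norm _) _; apply: le_trans (ltW (archi_boundP _)) _ => //.
by rewrite ler_nat leq_maxr.
Qed.

Lemma increasing_limit y s : {homo (fun k : nat =>
    H (phi (s * k%:R) y)) : i j / (i <= j)%N >-> (i <= j)%E} ->
  exists L, [/\ (H y <= L)%E, forall b, (forall t, (H (phi t y) <= b)%E) -> (L <= b)%E,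
    phi s (K L) = K L & forall N, nbhs (K L) N -> forall T : R,
    exists2 t, T <= t & N (phi (s * t) y)].
Proof.
move=> /ereal_nondecreasing_cvgn uL.
exists (ereal_sup (range (fun k : nat => H (phi (s * k%:R) y)))).
have [fL HL] := orbit_limit uL; split=> //.
  by apply: ereal_sup_ubound; exists 0%N => //; rewrite mulr0 flow0.
by move=> b Hb; apply: ge_ereal_sup => _ [k _ <-].
Qed.

Lemma decreasing_limit y s : {homo (fun k : nat =>
    H (phi (s * k%:R) y)) : i j / (i <= j)%N >-> (j <= i)%E} ->
  exists L, [/\ (L <= H y)%E, forall b, (forall t, (b <= H (phi t y))%E) -> (b <= L)%E,
    phi s (K L) = K L & forall N, nbhs (K L) N -> forall T : R,
    exists2 t, T <= t & N (phi (s * t) y)].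
Proof.
move=> /ereal_nonincreasing_cvgn uL.
exists (ereal_inf (range (fun k : nat => H (phi (s * k%:R) y)))).
have [fL HL] := orbit_limit uL; split=> //.
  by apply: ereal_inf_lbound; exists 0%N => //; rewrite mulr0 flow0.
by move=> b Hb; apply: le_ereal_inf_tmp => _ [k _ <-].
Qed.

Lemma not_fixed_left (s : R) (x : R) : s != 0 -> x < n \/ m < x ->
  phi s (K x%:E) <> K x%:E.
Proof.
move=> s0 hx e; have [s_gt|s_lt|s00] := ltgtP 0 s; last by rewrite -s00 eqxx in s0.
  by have := move_left (KH x%:E) hx s_gt; rewrite e flow0 ltxx.
by have := move_left (KH x%:E) hx s_lt; rewrite e flow0 ltxx.
Qed.

Lemma not_fixed_right (s : R) (x : R) : s != 0 -> n < x < m ->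
  phi s (K x%:E) <> K x%:E.
Proof.
move=> s0 hx e; have [s_gt|s_lt|s00] := ltgtP 0 s; last by rewrite -s00 eqxx in s0.
  by have := move_right (KH x%:E) hx s_gt; rewrite e flow0 ltxx.
by have := move_right (KH x%:E) hx s_lt; rewrite e flow0 ltxx.
Qed.

Let N1 : (-1 : R) != 0. Proof. by rewrite oppr_eq0 oner_eq0. Qed.
Let I1 : (1 : R) != 0. Proof. exact: oner_neq0. Qed.

Lemma decreasing_orbit_backward y : (forall s t, s < t -> (H (phi t y) < H (phi s y))%E) ->
  {homo (fun k : nat => H (phi (-1 * k%:R) y)) : i j / (i <= j)%N >-> (i <= j)%E}.
Proof.
move=> Hy i j; rewrite leq_eqVlt => /predU1P[-> //|ij].
by apply/ltW/Hy; rewrite !mulN1r ltrN2 ltr_nat.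
Qed.

Lemma decreasing_orbit_forward y : (forall s t, s < t -> (H (phi t y) < H (phi s y))%E) ->
  {homo (fun k : nat => H (phi (1 * k%:R) y)) : i j / (i <= j)%N >-> (j <= i)%E}.
Proof.
move=> Hy i j; rewrite leq_eqVlt => /predU1P[-> //|ij].
by apply/ltW/Hy; rewrite !mul1r ltr_nat.
Qed.

Lemma increasing_orbit_backward y : (forall s t, s < t -> (H (phi s y) < H (phi t y))%E) ->
  {homo (fun k : nat => H (phi (-1 * k%:R) y)) : i j / (i <= j)%N >-> (j <= i)%E}.
Proof.
move=> Hy i j; rewrite leq_eqVlt => /predU1P[-> //|ij].
by apply/ltW/Hy; rewrite !mulN1r ltrN2 ltr_nat.
Qed.

Lemma increasing_orbit_forward y : (forall s t, s < t -> (H (phi s y) < H (phi t y))%E) ->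
  {homo (fun k : nat => H (phi (1 * k%:R) y)) : i j / (i <= j)%N >-> (i <= j)%E}.
Proof.
move=> Hy i j; rewrite leq_eqVlt => /predU1P[-> //|ij].
by apply/ltW/Hy; rewrite !mul1r ltr_nat.
Qed.

(** The backward orbit increases and cannot cross n. Its limit is fixed by the time -1 map, which
    fixes no point below n. The five lemmas that follow vary this argument. *)
Lemma alpha_left y x : H y = x%:E -> x < n -> alpha_cluster phi y (K n%:E).
Proof.
move=> yx xn; have ml := move_left yx (or_introl xn).
have [L [yL Lb fL HL]] := increasing_limit (decreasing_orbit_backward (ml)).
have Ln : (L <= n%:E)%E.
  by apply: Lb => t; apply/ltW/gap_left; rewrite yx lte_fin.
move: L yL Ln fL HL {Lb} => [z| |]; rewrite yx ?lee_fin // => xz zn fz Hz.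
suff -> : n = z.
  by move=> N /Hz NT T; have [t Tt] := NT T; exists t => //; rewrite -mulN1r.
apply/eqP; rewrite eq_le zn andbT leNgt; apply/negP => zn'.
exact: (not_fixed_left N1 (or_introl zn') fz).
Qed.

Lemma omega_left y x : H y = x%:E -> x < n -> omega_cluster phi y (K -oo%E).
Proof.
move=> yx xn; have ml := move_left yx (or_introl xn).
have [L [yL Lb fL HL]] := decreasing_limit (decreasing_orbit_forward (ml)).
move: L yL fL HL {Lb} => [z| |]; rewrite yx ?lee_fin // => xz fz Hz.
  by case: (not_fixed_left I1 (or_introl (le_lt_trans xz xn)) fz).
by move=> N /Hz NT T; have [t Tt] := NT T; exists t => //; rewrite -[t]mul1r.
Qed.

Lemma alpha_right y x : H y = x%:E -> m < x -> alpha_cluster phi y (K +oo%E).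
Proof.
move=> yx xn; have ml := move_left yx (or_intror xn).
have [L [yL Lb fL HL]] := increasing_limit (decreasing_orbit_backward (ml)).
move: L yL fL HL {Lb} => [z| |]; rewrite yx ?lee_fin // => xz fz Hz.
  by case: (not_fixed_left N1 (or_intror (lt_le_trans xn xz)) fz).
by move=> N /Hz NT T; have [t Tt] := NT T; exists t => //; rewrite -mulN1r.
Qed.

Lemma omega_right y x : H y = x%:E -> m < x -> omega_cluster phi y (K m%:E).
Proof.
move=> yx xn; have ml := move_left yx (or_intror xn).
have [L [yL Lb fL HL]] := decreasing_limit (decreasing_orbit_forward (ml)).
have Ln : (m%:E <= L)%E.
  by apply: Lb => t; apply/ltW/gap_right; rewrite yx lte_fin.
move: L yL Ln fL HL {Lb} => [z| |]; rewrite yx ?lee_fin // => xz zn fz Hz.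
suff -> : m = z.
  by move=> N /Hz NT T; have [t Tt] := NT T; exists t => //; rewrite -[t]mul1r.
apply/eqP; rewrite eq_le zn /= leNgt; apply/negP => zn'.
exact: (not_fixed_left I1 (or_intror zn') fz).
Qed.

Lemma alpha_mid y x : H y = x%:E -> n < x < m -> alpha_cluster phi y (K n%:E).
Proof.
move=> yx nxm; have ml := move_right yx nxm.
have /andP[nx xm] := nxm.
have [L [yL Lb fL HL]] := decreasing_limit (increasing_orbit_backward (ml)).
have Ln : (n%:E <= L)%E.
  by apply: Lb => t; apply: ge_left; rewrite yx lee_fin ltW.
move: L yL Ln fL HL {Lb} => [z| |]; rewrite yx ?lee_fin // => zx zn fz Hz.
suff -> : n = z.
  by move=> N /Hz NT T; have [t Tt] := NT T; exists t => //; rewrite -mulN1r.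
apply/eqP; rewrite eq_le zn /= leNgt; apply/negP => zn'.
by case: (not_fixed_right N1 _ fz); rewrite zn' (le_lt_trans zx).
Qed.

Lemma omega_mid y x : H y = x%:E -> n < x < m -> omega_cluster phi y (K m%:E).
Proof.
move=> yx nxm; have ml := move_right yx nxm.
have /andP[nx xm] := nxm.
have [L [yL Lb fL HL]] := increasing_limit (increasing_orbit_forward (ml)).
have Ln : (L <= m%:E)%E.
  by apply: Lb => t; apply: le_right; rewrite yx lee_fin ltW.
move: L yL Ln fL HL {Lb} => [z| |]; rewrite yx ?lee_fin // => zx zn fz Hz.
suff -> : m = z.
  by move=> N /Hz NT T; have [t Tt] := NT T; exists t => //; rewrite -[t]mul1r.
apply/eqP; rewrite eq_le zn andbT leNgt; apply/negP => zn'.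
by case: (not_fixed_right I1 _ fz); rewrite zn' (lt_le_trans nx).
Qed.

Lemma fixed_alpha q : fixed_point phi q -> alpha_cluster phi q q.
Proof.
move=> fq N qN T; exists T => //; rewrite fq; exact: nbhs_singleton.
Qed.

Lemma line_alpha y : [\/ alpha_cluster phi y (K -oo%E),
  alpha_cluster phi y (K n%:E), alpha_cluster phi y (K m%:E) |
  alpha_cluster phi y (K +oo%E)].
Proof.
case: (H y) (HK y) (erefl (H y)) => [x| |] <- e; last 2 first.
- by constructor 4; exact: fixed_alpha.
- by constructor 1; exact: fixed_alpha.
have [xn|nx|->] := ltgtP x n; last by constructor 2; exact: fixed_alpha.
  by constructor 2; apply: alpha_left xn; rewrite KH.
have [xm|mx|->] := ltgtP x m; last by constructor 3; exact: fixed_alpha.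
  by constructor 2; apply: (@alpha_mid _ x); rewrite ?KH ?nx.
by constructor 4; apply: alpha_right mx; rewrite KH.
Qed.

(** One sample orbit in each gap suffices: A contains it once A contains its alpha limit, and then A
    contains its omega limit. *)
Lemma line_connect A : attractor phi A ->
  [/\ A (K n%:E) -> A (K -oo%E), A (K n%:E) -> A (K m%:E) &
      A (K +oo%E) -> A (K m%:E)].
Proof.
move=> aA; split.
- have n1 : n - 1 < n by lra.
  rewrite -(attractor_alpha_cluster aA (alpha_left (KH (n - 1)%:E) n1)).
  exact: attractor_omega_cluster aA (omega_left (KH (n - 1)%:E) n1).
- move: nm; rewrite le_eqVlt => /predU1P[-> //|nm'].
  have h : n < (n + m) / 2 < m by apply/andP; split; lra.
  rewrite -(attractor_alpha_cluster aA (alpha_mid (KH ((n + m) / 2)%:E) h)).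
  exact: attractor_omega_cluster aA (omega_mid (KH ((n + m) / 2)%:E) h).
- have m1 : m < m + 1 by lra.
  rewrite -(attractor_alpha_cluster aA (alpha_right (KH (m + 1)%:E) m1)).
  exact: attractor_omega_cluster aA (omega_right (KH (m + 1)%:E) m1).
Qed.

Lemma open_lt_coord (c : \bar R) : open [set y | (H y < c)%E].
Proof.
apply: (@open_comp _ _ H [set z | (z < c)%E]) => [y _|]; first exact: cH.
exact: open_ereal_lt_ereal.
Qed.

Lemma open_gt_coord (c : \bar R) : open [set y | (c < H y)%E].
Proof.
apply: (@open_comp _ _ H [set z | (c < z)%E]) => [y _|]; first exact: cH.
exact: open_ereal_gt_ereal.
Qed.

Lemma closed_le_coord (c : \bar R) : closed [set y | (H y <= c)%E].
Proof.
rewrite -[X in closed X]setCK; apply: open_closedC.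
rewrite (_ : ~` _ = [set y | (c < H y)%E]); first exact: open_gt_coord.
by apply/seteqP; split=> y /=; rewrite ltNge => /negP.

Qed.

Lemma closed_ge_coord (c : \bar R) : closed [set y | (c <= H y)%E].
Proof.
rewrite -[X in closed X]setCK; apply: open_closedC.
rewrite (_ : ~` _ = [set y | (H y < c)%E]); first exact: open_lt_coord.
by apply/seteqP; split=> y /=; rewrite ltNge => /negP.

Qed.

(** Outside [n, m] points move left. Those in [n, m] may move right, but matter only if m < c, and
    then m is a barrier below c. *)
Lemma left_strict c t y : c < n \/ m < c -> 0 < t -> (H y <= c%:E)%E ->
  (H (phi t y) < c%:E)%E.
Proof.
move=> hc t0 yc.
case yx : (H y) yc => [x| |]; rewrite ?leye_eq //; last first.
  by move=> _; rewrite -[y]HK yx fixed_ninfty KH ltNye.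
rewrite lee_fin => xc.
have [xm|mx] := leP x m; last first.
  have := move_left yx (or_intror mx) t0; rewrite flow0 yx.
  by move=> /lt_le_trans; apply; rewrite lee_fin.
have [xn|nx] := ltP x n.
  have := move_left yx (or_introl xn) t0; rewrite flow0 yx.
  by move=> /lt_le_trans; apply; rewrite lee_fin.
case: hc => hc; first by have := lt_le_trans hc nx; rewrite ltNge xc.
by apply: le_lt_trans (le_right t _) _; rewrite ?yx ?lee_fin ?lte_fin.
Qed.

Lemma right_strict c t y : n < c < m -> 0 < t -> (c%:E <= H y)%E ->
  (c%:E < H (phi t y))%E.
Proof.
move=> /andP[nc cm] t0 yc.
have [my|ym] := ltP m%:E (H y).
  by apply: lt_trans (gap_right t my); rewrite lte_fin.
case yx : (H y) yc ym => [x| |] //; rewrite !lee_fin => cx.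
rewrite le_eqVlt => /predU1P[xm|xm].
  by rewrite -[y]HK yx xm fixed_m KH lte_fin.
have nxm : n < x < m by rewrite xm (lt_le_trans nc).
by have := move_right yx nxm t0; rewrite flow0 yx; apply: le_lt_trans; rewrite lee_fin.
Qed.

Lemma subset_open_interior (O U : set Y) y : open O -> O `<=` U -> O y -> U^° y.
Proof. by move=> oO; rewrite open_subsetE // => OU; exact: OU. Qed.

Lemma left_attracting c : c < n \/ m < c ->
  attracting_nbhd phi [set y | (H y <= c%:E)%E].
Proof.
move=> hc; apply: trapping_attracting; first exact: closed_le_coord.
move=> t y t0 yc; apply: (@subset_open_interior [set y | (H y < c%:E)%E]).
- exact: open_lt_coord.
- by move=> z /ltW.
- exact: left_strict.
Qed.

Lemma mid_attracting c d : n < c < m -> m < d ->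
  attracting_nbhd phi [set y | (c%:E <= H y)%E /\ (H y <= d%:E)%E].
Proof.
move=> hc hd; apply: trapping_attracting.
  by apply: closedI; [exact: closed_ge_coord|exact: closed_le_coord].
move=> t y t0 [cy yd].
apply: (@subset_open_interior [set y | (c%:E < H y)%E /\ (H y < d%:E)%E]).
- by apply: openI; [exact: open_gt_coord|exact: open_lt_coord].
- by move=> z [/ltW ? /ltW].
- by split; [exact: right_strict|apply: left_strict => //; right].
Qed.

Lemma line_transcritical_fiber : transcritical_fiber phi (K -oo%E) (K n%:E)
  (K m%:E) (K +oo%E).
Proof.
split=> //; first exact: line_alpha; first exact: line_connect.
- exists [set y | (H y <= (n - 1)%:E)%E]; first by apply: left_attracting; left; lra.
  rewrite /= !KH leNye leye_eq !lee_fin; move: nm => nm'.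
  by split=> //; apply/negP; rewrite -ltNge; lra.
- exists [set y | (H y <= (m + 1)%:E)%E]; first by apply: left_attracting; right; lra.
  by rewrite /= !KH leNye leye_eq !lee_fin; move: nm => nm'; split=> //; lra.
- move=> nmK; have nm' : n < m.
    by rewrite lt_neqAle nm andbT; apply/eqP => e; apply: nmK; rewrite e.
  exists [set y | (((n + m) / 2)%:E <= H y)%E /\ (H y <= (m + 1)%:E)%E].
    by apply: mid_attracting; [apply/andP; split|]; lra.
  rewrite /= !KH leNye !leye_eq !lee_fin; split.
  + by case; rewrite leeNy_eq.
  + by case => h _; move: h; apply/negP; rewrite -ltNge; lra.
  + by split; lra.
  + by case.
Qed.

End LineFlow.

(** * The transcritical equation *)

Lemma is_derive_continuous (R : realType) (f : R -> R) (x df : R) :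
  is_derive x 1 f df -> {for x, continuous f}.
Proof.
move=> H; apply: differentiable_continuous; apply/derivable1_diffP.
exact: ex_derive.
Qed.

Lemma IVT_avoid (R : realType) (f : R -> R) (r s t : R) :
  continuous f -> (forall u, f u <> r) -> f s < r -> f t < r.
Proof.
move=> cf fr fs; rewrite ltNge; apply/negP => ft.
have cfw a b : {within `[a, b], continuous f} by apply: continuous_subspaceT.
have [st|/ltW ts] := leP s t.
  have [|c _ /fr//] := @IVT _ f s t r st (@cfw _ _).
  by rewrite ge_min le_max (ltW fs) ft orbT.
have [|c _ /fr//] := @IVT _ f t s r ts (@cfw _ _).
by rewrite ge_min le_max (ltW fs) ft !orbT.
Qed.

Section ScalarODE.
Context (R : realType) (psi : dynsys R (\bar R)) (c : R -> R) (l n m : R).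
Hypotheses (cc : continuous c) (c_gt0 : forall z, 0 < c z).
Hypotheses (nm : n <= m) (nml : n + m = l) (nm0 : n * m = 0).
Hypothesis psi_ode : forall x : R, exists xi : R -> R, forall t,
  psi t x%:E = (xi t)%:E /\
  is_derive t 1 xi (c (xi t) * (l * xi t - xi t ^+ 2)).
Hypothesis psi_infty : forall t, psi t +oo%E = +oo%E /\ psi t -oo%E = -oo%E.

(** Any time t is an integer multiple of a time of absolute value at most d. *)
Lemma fixed_of_near (q : \bar R) d : 0 < d ->
  (forall t, `|t| <= d -> psi t q = q) -> fixed_point psi q.
Proof.
move=> d0 Hq t.
have [k kt] : exists k : nat, `|t| / d < k%:R.
  exists (Num.bound (`|t| / d)); apply: archi_boundP.
  by apply: divr_ge0 => //; exact: ltW.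
have k0 : (0 : R) < k%:R by apply: le_lt_trans kt; apply: divr_ge0 => //; exact: ltW.
pose u := t / k%:R.
have Hu : psi u q = q.
  apply: Hq; rewrite /u normrM normfV (ger0_norm (ltW k0)) ler_pdivrMr //.
  by rewrite mulrC -ler_pdivrMr // ltW.
have -> : t = u * k%:R by rewrite /u divfK // gt_eqF.
elim: {kt k0 Hq}(k) (u) Hu => [|j IH] v Hv; first by rewrite mulr0 flow0.
by rewrite -addn1 natrD mulrDr mulr1 addrC -flowD IH.
Qed.

(** The speed c is only continuous, but the polynomial factor gives (xi - r)' = k (xi - r) with k
    continuous along the solution. On a short interval around 0 the maximum of |xi - r| is then at
    most half of itself, so xi = r there. *)
Lemma root_fixed (r : R) : r * (l - r) = 0 -> fixed_point psi r%:E.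
Proof.
move=> rl; have [xi Hxi] := psi_ode r.
have xi0 : xi 0 = r by have [+ _] := Hxi 0; rewrite flow0 => -[].
have cxi : continuous xi by move=> t; apply: is_derive_continuous (Hxi t).2.
pose k t := c (xi t) * (l - r - xi t).
have ck : continuous k.
  move=> t; apply: cvgM; first exact: (cvg_comp _ _ (@cxi t) (@cc (xi t))).
  by apply: cvgB; [exact: cvg_cst|exact: cxi].
have dxi (t : R) : is_derive t (1 : R) xi (k t * (xi t - r)).
  have -> : k t * (xi t - r) = c (xi t) * (l * xi t - xi t ^+ 2).
    rewrite /k -mulrA; congr (_ * _).
    have -> : (l - r - xi t) * (xi t - r) =
      l * xi t - xi t ^+ 2 - r * (l - r) by lra.
    by rewrite rl subr0.
  exact: (Hxi t).2.
have cw (f : R -> R) a b : continuous f -> {within `[a, b], continuous f}.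
  by move=> cf; apply: continuous_subspaceT.
have [C [C0 HC]] : exists C, 0 < C /\ forall t, `|t| <= 1 -> `|k t| <= C.
  have ckn : continuous (fun t => `|k t|).
    by move=> t; apply: cvg_norm; exact: ck.
  have N11 : (-1 : R) <= 1 by lra.
  have [z _ Hz] := EVT_max N11 (cw _ _ _ ckn).
  exists (`|k z| + 1); split; first by rewrite ltr_wpDl.
  move=> t; rewrite ler_norml => t1; apply: le_trans (Hz t _) _; rewrite ?in_itv //=.
  by rewrite lerDl.
(* C * d <= 1/2 produces the factor one half, and d <= 1 stays in the range where C bounds k. *)
pose d := Num.min 1 (2 * C)^-1.
have d0 : 0 < d by rewrite lt_min ltr01 invr_gt0 mulr_gt0.
have d1 : d <= 1 by rewrite ge_min lexx.
have dC : C * d <= 2^-1.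
  have : d <= (2 * C)^-1 by rewrite ge_min lexx orbT.
  rewrite -(ler_pM2l C0) => /le_trans; apply.
  by rewrite invfM mulrCA divff ?mulr1 // gt_eqF.
apply: (fixed_of_near d0) => t td.
have cxin : continuous (fun t => `|xi t - r|).
  by move=> u; apply: cvg_norm; apply: cvgB; [exact: cxi|exact: cvg_cst].
have Ndd : - d <= d by lra.
have [z zd Hz] := EVT_max Ndd (cw _ _ _ cxin).
have {}Hz u : `|u| <= d -> `|xi u - r| <= `|xi z - r|.
  by rewrite ler_norml => ud; apply: Hz; rewrite in_itv.
have {}zd : `|z| <= d by rewrite ler_norml; rewrite in_itv in zd.
suff M0 : `|xi z - r| <= 0.
  have := le_trans (Hz t td) M0; rewrite normr_le0 subr_eq0 => /eqP e.
  by rewrite (Hxi t).1 e.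
(* Mean value theorem between 0, where xi = r, and the point z where |xi - r| is largest. *)
have [w wz e] : exists2 w, `|w| <= `|z| & `|xi z - r| = `|k w * (xi w - r)| * `|z|.
  have [z0|z0] := leP 0 z.
    have [w] := MVT_segment z0 (fun x _ => dxi x) (cw _ _ _ cxi).
    rewrite in_itv /= xi0 => /andP[w0 wz] e; exists w.
      by rewrite !ger0_norm.
    by rewrite -normrM e subr0.
  have [w] := MVT_segment (ltW z0) (fun x _ => dxi x) (cw _ _ _ cxi).
  rewrite in_itv /= xi0 => /andP[zw w0] e; exists w.
    by rewrite !ler0_norm ?lerN2 // ltW.
  by rewrite distrC e sub0r mulrN normrN normrM.
have wd : `|w| <= d := le_trans wz zd.
have : `|xi z - r| <= C * `|xi z - r| * d.
  rewrite {1}e normrM; apply: ler_pM => //; apply: ler_pM => //; last exact: Hz.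
  by apply: HC; apply: le_trans d1.
rewrite mulrAC => h.
have : C * d * `|xi z - r| <= 2^-1 * `|xi z - r| by exact: ler_wpM2r.
lra.
Qed.

Lemma ode_fixed_n : fixed_point psi n%:E.
Proof. by apply: root_fixed; rewrite -nml addrAC subrr add0r. Qed.

Lemma ode_fixed_m : fixed_point psi m%:E.
Proof. by apply: root_fixed; rewrite -nml addrK mulrC. Qed.

(** Flowing back from a fixed point gives the same point. By the intermediate value theorem orbits
    then stay on one side of each fixed point. *)
Lemma orbit_avoids (x t : R) (q : \bar R) : fixed_point psi q ->
  x%:E <> q -> psi t x%:E <> q.
Proof.
move=> fq xq e; apply: xq; rewrite -(flowK psi t x%:E) e; exact: fq.
Qed.

Lemma solution_continuous (xi : R -> R) (df : R -> R) :
  (forall t : R, is_derive t (1 : R) xi (df t)) -> continuous xi.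
Proof. by move=> H t; exact: is_derive_continuous (H t). Qed.

Lemma orbit_lt (x r t : R) : fixed_point psi r%:E -> x < r ->
  (psi t x%:E < r%:E)%E.
Proof.
move=> fr xr; have [xi Hxi] := psi_ode x; rewrite (Hxi t).1 lte_fin.
have cxi := solution_continuous (fun t => (Hxi t).2).
apply: (@IVT_avoid _ _ _ 0 _ cxi).
  move=> u e; apply: (@orbit_avoids x u _ fr).
    by move=> -[xr']; rewrite xr' ltxx in xr.
  by rewrite (Hxi u).1 e.
by have [+ _] := Hxi 0; rewrite flow0 => -[<-].
Qed.

Lemma orbit_gt (x r t : R) : fixed_point psi r%:E -> r < x ->
  (r%:E < psi t x%:E)%E.
Proof.
move=> fr xr; have [xi Hxi] := psi_ode x; rewrite (Hxi t).1 lte_fin.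
have cxi := solution_continuous (fun t => (Hxi t).2).
rewrite -ltrN2; apply: (@IVT_avoid _ (fun t => - xi t) _ 0).
- by move=> u; apply: cvgN; exact: cxi.
- move=> u /oppr_inj e; apply: (@orbit_avoids x u _ fr).
    by move=> -[xr']; rewrite xr' ltxx in xr.
  by rewrite (Hxi u).1 e.
- by have [+ _] := Hxi 0; rewrite flow0 ltrN2 => -[<-].
Qed.

Lemma ode_gap_left y t : (y < n%:E)%E -> (psi t y < n%:E)%E.
Proof.
case: y => [x| |] //; last by rewrite (psi_infty t).2.
by rewrite lte_fin; exact/orbit_lt/ode_fixed_n.
Qed.

Lemma ode_gap_right y t : (m%:E < y)%E -> (m%:E < psi t y)%E.
Proof.
case: y => [x| |] //; first by rewrite lte_fin; exact/orbit_gt/ode_fixed_m.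
by rewrite (psi_infty t).1.
Qed.

Lemma field_factor (z : R) : l * z - z ^+ 2 = - ((z - n) * (z - m)).
Proof. by rewrite -nml -[LHS]subr0 -nm0; lra. Qed.

Lemma ode_move_left (x s t : R) : x < n \/ m < x -> s < t ->
  (psi t x%:E < psi s x%:E)%E.
Proof.
move=> hx st; have [xi Hxi] := psi_ode x.
rewrite (Hxi t).1 (Hxi s).1 lte_fin -subr_lt0.
have cxi := solution_continuous (fun t => (Hxi t).2).
have [|z _ ->] := MVT st (fun u _ => (Hxi u).2); first exact: continuous_subspaceT.
rewrite pmulr_llt0 ?subr_gt0 // pmulr_rlt0 // field_factor oppr_lt0.
case: hx => hx.
  have := orbit_lt z ode_fixed_n hx; rewrite (Hxi z).1 lte_fin => zn.
  by rewrite nmulr_lgt0 subr_lt0 // (lt_le_trans zn).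
have := orbit_gt z ode_fixed_m hx; rewrite (Hxi z).1 lte_fin => zm.
by apply: mulr_gt0; rewrite subr_gt0 // (le_lt_trans nm).
Qed.

Lemma ode_move_right (x s t : R) : n < x < m -> s < t ->
  (psi s x%:E < psi t x%:E)%E.
Proof.
move=> /andP[nx xm] st; have [xi Hxi] := psi_ode x.
rewrite (Hxi t).1 (Hxi s).1 lte_fin -subr_gt0.
have cxi := solution_continuous (fun t => (Hxi t).2).
have [|z _ ->] := MVT st (fun u _ => (Hxi u).2); first exact: continuous_subspaceT.
rewrite pmulr_lgt0 ?subr_gt0 // pmulr_rgt0 // field_factor oppr_gt0.
have := orbit_gt z ode_fixed_n nx; rewrite (Hxi z).1 lte_fin => zn.
have := orbit_lt z ode_fixed_m xm; rewrite (Hxi z).1 lte_fin => zm.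
by rewrite pmulr_rlt0 ?subr_gt0 // subr_lt0.
Qed.

End ScalarODE.

(** * Conjugacies *)

Lemma pair_continuous (T U V : topologicalType) (f : T -> U) (g : T -> V) :
  continuous f -> continuous g -> continuous (fun x => (f x, g x)).
Proof.
move=> cf cg x; apply: (@cvg_pair _ _ _ (nbhs x) (nbhs (f x)) (nbhs (g x))).
  exact: cf.
exact: cg.
Qed.

Lemma comp_continuous (T U V : topologicalType) (f : T -> U) (g : U -> V) :
  continuous f -> continuous g -> continuous (fun x => g (f x)).
Proof. by move=> cf cg x; apply: continuous_comp; [exact: cf|exact: cg]. Qed.

(** A tube argument: for y other than K l0 x0 the values h (l0, y) and x0 are separated by open
    sets, so near (l0, x0) no solution of h (l, y') = x is close to y. Compactness of Y leaves only
    solutions in N. *)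
Lemma fiberwise_inverse_continuous (Lambda X Y : topologicalType)
    (h : Lambda * Y -> X) (K : Lambda -> X -> Y) :
  compact [set: Y] -> hausdorff_space X -> continuous h ->
  (forall l, cancel (fun y => h (l, y)) (K l)) ->
  (forall l, cancel (K l) (fun y => h (l, y))) ->
  continuous (fun z : Lambda * X => K z.1 z.2).
Proof.
move=> cY hX ch hK Kh [l0 x0] N /= KN.
have : \forall z \near (l0, x0), [set: Y] `<=`
    (fun y => h (z.1, y) = z.2 -> N y).
  apply: ((compact_near_coveringP [set: Y]).1 cY _ (nbhs (l0, x0))
    (fun z y => h (z.1, y) = z.2 -> N y)) => y _.
  have [-> |yK] := eqVneq y (K l0 x0).
    by exists (N, setT) => [|[y' z] /= []] //; split=> //; exact: filterT.
  have hx : h (l0, y) != x0.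
    by apply: contraNneq yK => <-; rewrite hK.
  move: hX; rewrite open_hausdorff => /(_ _ _ hx)[[A B] /= [Ah Bx] [oA oB AB]].
  have : nbhs (l0, y) (h @^-1` A).
    by apply: ch; apply: open_nbhs_nbhs; split=> //; rewrite inE in Ah.
  move=> [[P Q] [/= nP nQ] PQ].
  exists (Q, [set z | P z.1 /\ B z.2]).
    split=> //=; exists (P, B); first split=> //.
      by apply: open_nbhs_nbhs; split=> //; rewrite inE in Bx.
    by move=> [a b].
  move=> [y' [l x]] /= [Qy [Pl Bx']] hx'.
  have Ahx : A (h (l, y')) by exact: (PQ (l, y')).
  have : (A `&` B) x by split=> //; rewrite -hx'.
  by rewrite (eqP AB).
move=> H; apply: (filterS _ H) => -[l x] /= Hz.
exact: (Hz (K l x) Logic.I (Kh l x)).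
Qed.

Lemma sign_constant (R : realType) (D : R * R -> R) : continuous D ->
  (forall z, D z <> 0) -> (forall z, 0 < D z) \/ (forall z, D z < 0).
Proof.
move=> cD D0.
have neg z w : D z < 0 -> D w < 0.
  move=> Dz; pose q (u : R) := D (z.1 + u * (w.1 - z.1), z.2 + u * (w.2 - z.2)).
  have cq : continuous q.
    have cf (a b : R) : continuous (fun u : R => a + u * b).
      move=> u; apply: cvgD; first exact: cvg_cst.
      by apply: cvgM; [exact: cvg_id|exact: cvg_cst].
    exact: (comp_continuous (pair_continuous (cf _ _) (cf _ _)) cD).
  have q0 : q 0 < 0 by rewrite /q !mul0r !addr0 -surjective_pairing.
  have : q 1 < 0 by apply: (@IVT_avoid _ q _ 0) => // u; exact: D0.
  by rewrite /q !mul1r !subrKC -surjective_pairing.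
have [[z Dz]|nD] := pselect (exists z, D z < 0).
  by right=> w; exact: neg Dz.
left=> z; have [Dz|//|/D0//] := ltgtP (D z) 0.
by case: nD; exists z.
Qed.

Section Conjugacy.
Context (R : realType) (Y : topologicalType)
  (psi : pdynsys R R (\bar R)) (phi : pdynsys R R Y).
Hypothesis compactY : compact [set: Y].
Hypothesis psi_tc : transcritical psi.
Context (h : R * Y -> \bar R) (tau : R * R * Y -> R) (K : R -> \bar R -> Y).
Hypotheses (ch : continuous h) (ctau : continuous tau).
Hypotheses (hc : forall l, continuous (fun y => h (l, y))).
Hypotheses (Kc : forall l, continuous (K l)).
Hypotheses (hK : forall l, cancel (fun y => h (l, y)) (K l)).
Hypotheses (Kh : forall l, cancel (K l) (fun y => h (l, y))).
Hypothesis tau0 : forall l y, tau (l, 0, y) = 0.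
Hypothesis tau_mono : forall l y, strictly_monotone (fun t => tau (l, t, y)).
Hypothesis h_flow : forall l t y, h (l, phi l t y) = psi l (tau (l, t, y)) (h (l, y)).

Let n (l : R) := Num.min 0 l.
Let m (l : R) := Num.max 0 l.

Let nm l : n l <= m l.
Proof. by rewrite /n /m ge_min le_max lexx. Qed.

Let nml l : n l + m l = l.
Proof. by rewrite /n /m addr_min_max add0r. Qed.

Let nm0 l : n l * m l = 0.
Proof. by rewrite /n /m; case: ltgtP => _; rewrite ?mul0r ?mulr0. Qed.

Lemma conj_fixed l q : fixed_point (psi l) q -> fixed_point (phi l) (K l q).
Proof.
by move=> fq t; apply: (can_inj (hK l)); rewrite h_flow Kh fq.
Qed.

Lemma tau_neq0 l y : tau (l, 1, y) <> 0.
Proof.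
have [H|H] := tau_mono l y; have := H 0 1 ltr01; rewrite tau0 => + e;
by rewrite e ltxx.
Qed.

(** [sign_constant] is applied to tau at time 1, transported to the plane of pairs (l, x) by the
    jointly continuous inverse K. Strict monotonicity in t makes this value nonzero, and its sign
    tells which monotonicity holds. *)
Lemma tau_direction :
  (forall l y x s t, h (l, y) = x%:E -> s < t -> tau (l, s, y) < tau (l, t, y)) \/
  (forall l y x s t, h (l, y) = x%:E -> s < t -> tau (l, t, y) < tau (l, s, y)).
Proof.
have cK := fiberwise_inverse_continuous compactY (@ereal_hausdorff R) ch hK Kh.
pose D (z : R * R) := tau (z.1, 1, K z.1 z.2%:E).
have cD : continuous D.
  apply: (@comp_continuous _ _ _ (fun z : R * R => (z.1, 1 : R, K z.1 z.2%:E))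
    tau _ ctau).
  apply: (@pair_continuous _ _ _ (fun z : R * R => (z.1, 1 : R))).
    by apply: pair_continuous => z; [exact: cvg_fst|exact: cvg_cst].
  apply: (@comp_continuous _ _ _ (fun z : R * R => (z.1, z.2%:E)) _ _ cK).
  apply: pair_continuous => z; first exact: cvg_fst.
  by apply: cvg_EFin; [exact: nearW|exact: cvg_snd].
have [Dpos|Dneg] := sign_constant cD (fun z => @tau_neq0 z.1 (K z.1 z.2%:E)).
- left=> l y x s t yx st; have [H|H] := tau_mono l y; first exact: H.
  have := H 0 1 ltr01; rewrite tau0 ltNge => /negP; case.
  by have := Dpos (l, x); rewrite /D /= -yx hK => /ltW.
- right=> l y x s t yx st; have [H|H] := tau_mono l y; last exact: H.
  have := H 0 1 ltr01; rewrite tau0 ltNge => /negP; case.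
  by have := Dneg (l, x); rewrite /D /= -yx hK => /ltW.
Qed.

Lemma conj_curve_continuous (x : R -> \bar R) : continuous x ->
  continuous (fun l => K l (x l)).
Proof.
have cK := fiberwise_inverse_continuous compactY (@ereal_hausdorff R) ch hK Kh.
move=> cx; apply: (@comp_continuous _ _ _ (fun l => (l, x l)) _ _ cK).
by apply: pair_continuous => // l; exact: cvg_id.
Qed.

Lemma conjugate_fibers_aux : exists p1 p2 p3 p4 : R -> Y,
  [/\ continuous p1, continuous p2, continuous p3 & continuous p4] /\
  (forall l, p2 l = p3 l <-> l = 0) /\
  forall l, transcritical_fiber (phi l) (p1 l) (p2 l) (p3 l) (p4 l).
Proof.
have cn : continuous (fun l => (n l)%:E).
  move=> l; apply: cvg_EFin; first exact: nearW.
  by apply: continuous_min; [exact: cvg_cst|exact: cvg_id].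
have cm : continuous (fun l => (m l)%:E).
  move=> l; apply: cvg_EFin; first exact: nearW.
  by apply: continuous_max; [exact: cvg_cst|exact: cvg_id].
have nmE l : K l (n l)%:E = K l (m l)%:E <-> l = 0.
  split=> [/(congr1 (fun y => h (l, y)))|->]; last by rewrite /n /m minxx maxxx.
  by rewrite !Kh => -[]; rewrite /n /m; case: ltgtP.
have [g [cg g0 ode inf _]] := psi_tc.
have cgl l : continuous (fun z => g (l, z)).
  apply: (@comp_continuous _ _ _ (fun z : R => (l, z)) g) => //.
  by apply: pair_continuous => z; [exact: cvg_cst|exact: cvg_id].
have g0l l z : 0 < g (l, z) by exact: g0.
have fn l := ode_fixed_n (cgl l) (nml l) (nm0 l) (ode l).
have fm l := ode_fixed_m (cgl l) (nml l) (nm0 l) (ode l).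
have fp l : fixed_point (psi l) +oo%E by move=> t; exact: (inf l t).1.
have fN l : fixed_point (psi l) -oo%E by move=> t; exact: (inf l t).2.
have gl l := ode_gap_left (cgl l) (nml l) (nm0 l) (ode l) (inf l).
have gr l := ode_gap_right (cgl l) (nml l) (nm0 l) (ode l) (inf l).
have ml l := ode_move_left (cgl l) (g0l l) (nm l) (nml l) (nm0 l) (ode l).
have mr l := ode_move_right (cgl l) (g0l l) (nml l) (nm0 l) (ode l).
have [inc|dec] := tau_direction.
- exists (fun l => K l -oo%E), (fun l => K l (n l)%:E), (fun l => K l (m l)%:E),
    (fun l => K l +oo%E).
  split; first by split; apply: conj_curve_continuous => // l; exact: cvg_cst.
  split=> // l.
  apply: (@line_transcritical_fiber _ _ (phi l) (fun y => h (l, y)) (K l)) => //.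
  + exact: conj_fixed.
  + exact: conj_fixed.
  + exact: conj_fixed.
  + exact: conj_fixed.
  + by move=> y t yn; rewrite h_flow; exact: gl.
  + by move=> y t yn; rewrite h_flow; exact: gr.
  + move=> y x s t yx hx st; rewrite !h_flow yx; apply: ml => //.
    exact: inc yx st.
  + move=> y x s t yx hx st; rewrite !h_flow yx; apply: mr => //.
    exact: inc yx st.
- exists (fun l => K l +oo%E), (fun l => K l (m l)%:E), (fun l => K l (n l)%:E),
    (fun l => K l -oo%E).
  split; first by split; apply: conj_curve_continuous => // l; exact: cvg_cst.
  split=> [l|l]; first by rewrite -nmE; split=> /esym.
  have := @line_transcritical_fiber _ _ (phi l) (fun y => - h (l, y))%E
    (fun z => K l (- z)%E) (- m l) (- n l).
  rewrite /= !opprK; apply.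
  + by move=> y; apply: cvgeN; exact: hc.
  + move=> z; apply: (cvg_comp (fun z => - z)%E (K l)); last exact: Kc.
    by apply: cvgeN; exact: cvg_id.
  + by move=> y; rewrite oppeK hK.
  + by move=> z; rewrite Kh oppeK.
  + by rewrite lerN2.
  + exact: conj_fixed.
  + exact: conj_fixed.
  + exact: conj_fixed.
  + exact: conj_fixed.
  + by move=> y t; rewrite EFinN !lteN2 h_flow; exact: gr.
  + by move=> y t; rewrite EFinN !lteN2 h_flow; exact: gl.
  + move=> y x s t yx hx st; rewrite !h_flow lteN2.
    have yx' : h (l, y) = (- x)%:E by rewrite EFinN -yx oppeK.
    rewrite yx'; apply: ml; last exact: dec yx' st.
    by case: hx => hx; [right; rewrite ltrNr|left; rewrite ltrNl].
  + move=> y x s t yx hx st; rewrite !h_flow lteN2.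
    have yx' : h (l, y) = (- x)%:E by rewrite EFinN -yx oppeK.
    rewrite yx'; apply: mr; last exact: dec yx' st.
    by move: hx => /andP[h1 h2]; rewrite ltrNr h2 ltrNl.
Qed.

End Conjugacy.

Lemma conjugate_fibers (R : realType) (Y : topologicalType)
    (psi : pdynsys R R (\bar R)) (phi : pdynsys R R Y) :
  compact [set: Y] -> transcritical psi -> conjugate phi psi ->
  exists p1 p2 p3 p4 : R -> Y,
  [/\ continuous p1, continuous p2, continuous p3 & continuous p4] /\
  (forall l, p2 l = p3 l <-> l = 0) /\
  forall l, transcritical_fiber (phi l) (p1 l) (p2 l) (p3 l) (p4 l).
Proof.
move=> cY tc [h [tau [[ch ctau] hom tauP hflow _]]].
pose K l := projT1 (cid (hom l)).
have KP l : [/\ continuous (fun y => h (l, y)), continuous (K l),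
    cancel (fun y => h (l, y)) (K l) & cancel (K l) (fun y => h (l, y))].
  by rewrite /K; case: cid.
apply: (conjugate_fibers_aux cY tc (K := K) ch ctau) => //.
- by move=> l; case: (KP l).
- by move=> l; case: (KP l).
- by move=> l; case: (KP l).
- by move=> l; case: (KP l).
- by move=> l y; case: (tauP l y).
- by move=> l y; case: (tauP l y).
Qed.

(** * Stalks of the attractor sheaf *)

Lemma germ_restrict (X : topologicalType) (F : presheaf X) x (U V : opens X)
    (VU : V `<=` U) (Ux : open_set U x) (Vx : open_set V x) (s : F U) :
  germ Vx (res F VU s) = germ Ux s.
Proof. by rewrite germ_res; congr (germ _ s); exact: Prop_irrelevance. Qed.

Section AttractorGerms.
Context (R : realType) (Lambda X : topologicalType) (phi : pdynsys R Lambda X).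
Let F := attractor_presheaf phi.
Implicit Types (U V W : opens Lambda).

Definition opens_pt U x (Ux : open_set U x) : U := SigSub (mem_set Ux).

Lemma opens_ptE U (l : U) x (Ux : open_set U x) : val l = x -> l = opens_pt Ux.
Proof. by move=> lx; apply: val_inj; rewrite lx. Qed.

Lemma booleanization_map_clopen d (L : tbDistrLatticeType d) d'
    (M : tbDistrLatticeType d') (f : blattice_hom L M) (A : L) :
  booleanization_map f (lattice_clopen A) = lattice_clopen (f A).
Proof. exact: booleanization_eq. Qed.

Lemma attractor_germ_eq U V x (Ux : open_set U x) (Vx : open_set V x)
    (A : attractor_section phi U) (B : attractor_section phi V) :
  (\forall y \near x, forall (l : U) (l' : V), val l = y -> val l' = y ->
     att A l = att B l') ->
  germ (F := F) Ux (lattice_clopen A) = germ (F := F) Vx (lattice_clopen B).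
Proof.
rewrite -[X in X -> _]/(nbhs x _); rewrite nbhsE => -[N [oN Nx] HN].
pose W := opensI (opensI U V) (Opens oN).
have WU : W `<=` U by move=> y [[]].
have WV : W `<=` V by move=> y [[]].
have Wx : open_set W x by [].
rewrite -(germ_restrict (F := F) WU Ux Wx) -(germ_restrict (F := F) WV Vx Wx).
congr (germ _ _).
rewrite /= !booleanization_map_clopen; congr lattice_clopen.
apply: attractor_section_eq => l /=; apply: (HN (val l)) => //.
by have [] := set_valP l.
Qed.

Section PointIdeal.
Context (x : Lambda) (q : X).
Hypothesis fq : fixed_point (phi x) q.

(** Primality is the delicate axiom: the meet is the omega-limit set of the intersection and may be
    smaller than it, but a fixed point of the intersection survives. *)
Lemma point_ideal_subproof U (Ux : open_set U x) :
  prime_ideal (fun A : attractor_section phi U => `[< ~ att A (opens_pt Ux) q >]).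
Proof.
split=> /=.
- by apply/asboolP => H; exact: (H : set0 q).
- apply/negP => /asboolP H; apply: H.
  suff : omega (phi (val (opens_pt Ux))) setT q by [].
  by rewrite omegaT.
- move=> A B /asboolP AB /asboolP Bq; apply/asboolP; apply: contra_not Bq => Aq.
  have : att (att_meet A B) (opens_pt Ux) q by rewrite AB.
  by move=> /att_meet_le[].
- by move=> A B /asboolP Aq /asboolP Bq; apply/asboolP => -[].
- move=> A B /asboolP ABq; apply: contrapT => /not_orP[nA nB].
  apply: ABq; apply: fixed_point_omega => //; apply: subset_closure.
  by split; apply: contrapT => H; [apply: nA|apply: nB]; exact/asboolP.
Qed.

Definition point_ideal U (Ux : open_set U x) : spectrum (attractor_section phi U) :=
  PrimeIdeal (point_ideal_subproof Ux).

Lemma spectrum_map_point_ideal U V (VU : V `<=` U) (Ux : open_set U x)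
    (Vx : open_set V x) :
  spectrum_map (att_res_hom phi VU) (point_ideal Vx) = point_ideal Ux.
Proof.
apply: spectrum_eq => A /=; congr `[< ~ _ >].
by rewrite (_ : opens_incl _ _ = opens_pt Ux) //; exact: opens_ptE.
Qed.

(** A Z_2-valued character of the stalk, additive by [germ_evalD]; [germ_evalE] shows that the
    representative is immaterial. *)
Definition germ_eval (g : germs F x) : bool :=
  `[< clopen_set (pregerm_val (of_germ g)) (point_ideal (pregerm_mem (of_germ g))) >].

Lemma germ_evalE U (Ux : open_set U x) (s : F U) :
  germ_eval (germ (F := F) Ux s) = `[< clopen_set s (point_ideal Ux) >].
Proof.
rewrite /germ_eval.
have /to_germP[W [Wa [Wb [Wx /(congr1 (@clopen_set _ _)) e]]]] :=
  of_germK (germ (F := F) Ux s).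
apply: asbool_equiv_eq.
have := congr1 (fun S => S (point_ideal Wx)) e => /=.
rewrite /preimage /= (spectrum_map_point_ideal Wa (pregerm_mem _)).
by rewrite (spectrum_map_point_ideal Wb Ux) => ->.
Qed.

Lemma germ_evalD (g h : germs F x) :
  germ_eval (g + h) = germ_eval g (+) germ_eval h.
Proof.
rewrite -[g]of_germK -[h]of_germK.
have [W [Wx [s [t [-> ->]]]]] := germ_common (of_germ g) (of_germ h).
have -> : to_germ (Pregerm Wx s) + to_germ (Pregerm Wx t) =
    germ (F := F) Wx (s + t) by rewrite raddfD.
rewrite -!/(germ _ _) !germ_evalE; apply/asboolP/idP => /=; rewrite /setY /setD /=.
  by case=> -[] /asboolP + /asboolPn; case: asboolP; case: asboolP.
by case: asboolP; case: asboolP => //; [left|right].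
Qed.

Lemma germ_eval_clopen U (Ux : open_set U x) (A : attractor_section phi U) :
  germ_eval (germ (F := F) Ux (lattice_clopen A)) = `[< att A (opens_pt Ux) q >].
Proof.
rewrite germ_evalE; apply: asbool_equiv_eq; rewrite /=.
by split=> [/asboolPn/contrapT|Aq] //; apply/asboolPn.
Qed.

End PointIdeal.

Lemma germ_char2 x (g : germs F x) : g + g = 0.
Proof.
have [U [Ux [s ->]]] := germ_surj g.
by rewrite -raddfD (booleanization_char2 s) raddf0.
Qed.

(** [lattice_clopenU] rearranged in characteristic 2, with C the join and D the meet over a common
    domain. It rewrites a germ through attractors whose fixed points are known. *)
Lemma attractor_germ_modular U V x (Ux : open_set U x) (Vx : open_set V x)
    (A : attractor_section phi U) (B : attractor_section phi V) :
  exists W (Wx : open_set W x) (C D : attractor_section phi W),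
  germ (F := F) Ux (lattice_clopen A) + germ (F := F) Vx (lattice_clopen B) =
  germ (F := F) Wx (lattice_clopen C) + germ (F := F) Wx (lattice_clopen D) /\
  forall q, fixed_point (phi x) q ->
    (att C (opens_pt Wx) q <-> att A (opens_pt Ux) q \/ att B (opens_pt Vx) q) /\
    (att D (opens_pt Wx) q <-> att A (opens_pt Ux) q /\ att B (opens_pt Vx) q).
Proof.
pose W := opensI U V; have Wx : open_set W x by [].
have WU : W `<=` U by move=> y [].
have WV : W `<=` V by move=> y [].
pose A' := att_res WU A; pose B' := att_res WV B.
exists W, Wx, (A' `|` B')%O, (A' `&` B')%O; split.
  rewrite -(germ_restrict (F := F) WU Ux Wx) -(germ_restrict (F := F) WV Vx Wx) /=.
  rewrite !booleanization_map_clopen -!raddfD; congr (germ _ _).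
  rewrite lattice_clopenU -addrA [X in _ = _ + X]booleanization_char2 addr0.
  by [].
move=> q fq.
have eA : att A' (opens_pt Wx) = att A (opens_pt Ux).
  by rewrite /=; congr (att A _); exact: opens_ptE.
have eB : att B' (opens_pt Wx) = att B (opens_pt Vx).
  by rewrite /=; congr (att B _); exact: opens_ptE.
rewrite -eA -eB; split; first by [].
split=> [/att_meet_le//|ABq].
exact/(fixed_point_omega fq)/subset_closure.
Qed.

Lemma attractor_section_near U (A : attractor_section phi U) (l : U)
    (p : Lambda -> X) : continuous p ->
  (forall m, fixed_point (phi m) (p m)) ->
  \forall y \near val l, forall l' : U, val l' = y ->
    (att A l' (p y) <-> att A l (p (val l))).
Proof.
move=> cp fp; have [U0 [W [U0U U0l HU]]] := (attP A).2 l.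
have [nl ->] := HU l U0l.
have nO : nbhs (val l) U0 by apply: open_nbhs_nbhs; split=> //; exact: open_setP.
have := fixed_point_near (@cp (val l)) fp nl => nW.
apply: (filterS _ (filterI nO nW)) => y [Oy Wy] l' l'y.
have U0l' : open_set U0 (val l') by rewrite l'y.
have [nl' ->] := HU l' U0l'.
rewrite -{1}l'y (attractor_fixed_point nl' (fp (val l'))) l'y Wy.
by rewrite (attractor_fixed_point nl (fp (val l))).
Qed.

End AttractorGerms.

(** * The frame of the attractor sheaf *)

Section TranscriticalFrame.
Context (R : realType) (Y : topologicalType) (phi : pdynsys R R Y).
Hypothesis compactY : compact [set: Y].
Context (p1 p2 p3 p4 : R -> Y).
Hypotheses (cp1 : continuous p1) (cp2 : continuous p2)
  (cp3 : continuous p3) (cp4 : continuous p4).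
Hypothesis p23 : forall l, p2 l = p3 l <-> l = 0.
Hypothesis fib : forall l, transcritical_fiber (phi l) (p1 l) (p2 l) (p3 l) (p4 l).
Let F := attractor_presheaf phi.
Let S := attractor_sheaf phi.

Let fp1 l : fixed_point (phi l) (p1 l). Proof. by case: (fiber_fixed (fib l)). Qed.
Let fp2 l : fixed_point (phi l) (p2 l). Proof. by case: (fiber_fixed (fib l)). Qed.
Let fp3 l : fixed_point (phi l) (p3 l). Proof. by case: (fiber_fixed (fib l)). Qed.
Let fp4 l : fixed_point (phi l) (p4 l). Proof. by case: (fiber_fixed (fib l)). Qed.

Definition pattern (A : set Y) (l : R) (b1 b2 b3 b4 : bool) :=
  [/\ A (p1 l) <-> b1, A (p2 l) <-> b2, A (p3 l) <-> b3 & A (p4 l) <-> b4].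

Lemma pattern_exists (A : set Y) l : exists b1 b2 b3 b4, pattern A l b1 b2 b3 b4.
Proof.
exists `[< A (p1 l) >], `[< A (p2 l) >], `[< A (p3 l) >], `[< A (p4 l) >].
by split; split=> /asboolP.
Qed.

Lemma pattern_eq (A B : set Y) l b1 b2 b3 b4 :
  attractor (phi l) A -> attractor (phi l) B ->
  pattern A l b1 b2 b3 b4 -> pattern B l b1 b2 b3 b4 -> A = B.
Proof.
move=> aA aB [A1 A2 A3 A4] [B1 B2 B3 B4]; apply/funext => y; apply/propext.
case: (fiber_alpha (fib l) y) => ya;
  rewrite (attractor_alpha_cluster aA ya) (attractor_alpha_cluster aB ya).
- exact: iff_trans A1 (iff_sym B1).
- exact: iff_trans A2 (iff_sym B2).
- exact: iff_trans A3 (iff_sym B3).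
- exact: iff_trans A4 (iff_sym B4).
Qed.

Lemma pattern_constraints (A : set Y) l b1 b2 b3 b4 : attractor (phi l) A ->
  pattern A l b1 b2 b3 b4 -> [/\ b2 -> b1, b2 -> b3, b4 -> b3 & l = 0 -> b2 = b3].
Proof.
move=> /(fiber_connect (fib l))[h1 h2 h3] [A1 A2 A3 A4]; split.
- by move=> /A2/h1/A1.
- by move=> /A2/h2/A3.
- by move=> /A4/h3/A3.
- move=> /p23 e; rewrite e in A2; apply/idP/idP => [/A2/A3|/A3/A2] //.
Qed.

Lemma pattern_nonzero (A : set Y) l b1 b2 b3 b4 : attractor (phi l) A ->
  pattern A l b1 b2 b3 b4 -> b2 != b3 -> l != 0.
Proof.
move=> aA /(pattern_constraints aA)[_ _ _ e]; apply: contraNneq => /e ->.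
by rewrite eqxx.
Qed.

Lemma pattern_or (A B C : set Y) l a1 a2 a3 a4 b1 b2 b3 b4 :
  (forall q, fixed_point (phi l) q -> (C q <-> A q \/ B q)) ->
  pattern A l a1 a2 a3 a4 -> pattern B l b1 b2 b3 b4 ->
  pattern C l (a1 || b1) (a2 || b2) (a3 || b3) (a4 || b4).
Proof.
move=> HC [h1 h2 h3 h4] [k1 k2 k3 k4].
split; (apply: iff_trans; first exact: HC); apply: (iff_trans _ (rwP orP)); tauto.
Qed.

Lemma pattern_and (A B C : set Y) l a1 a2 a3 a4 b1 b2 b3 b4 :
  (forall q, fixed_point (phi l) q -> (C q <-> A q /\ B q)) ->
  pattern A l a1 a2 a3 a4 -> pattern B l b1 b2 b3 b4 ->
  pattern C l (a1 && b1) (a2 && b2) (a3 && b3) (a4 && b4).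
Proof.
move=> HC [h1 h2 h3 h4] [k1 k2 k3 k4].
split; (apply: iff_trans; first exact: HC); apply: (iff_trans _ (rwP andP)); tauto.
Qed.

Lemma section_pattern_near (U : opens R) (A : attractor_section phi U) (l : U)
    b1 b2 b3 b4 : pattern (att A l) (val l) b1 b2 b3 b4 ->
  \forall y \near val l, forall l' : U, val l' = y ->
    pattern (att A l') y b1 b2 b3 b4.
Proof.
move=> [A1 A2 A3 A4].
have H1 := attractor_section_near A l cp1 fp1.
have H2 := attractor_section_near A l cp2 fp2.
have H3 := attractor_section_near A l cp3 fp3.
have H4 := attractor_section_near A l cp4 fp4.
apply: (filterS _ (filterI (filterI H1 H2) (filterI H3 H4))).
move=> y [[h1 h2] [h3 h4]] l' l'y; split.
- exact: iff_trans (h1 l' l'y) A1.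
- exact: iff_trans (h2 l' l'y) A2.
- exact: iff_trans (h3 l' l'y) A3.
- exact: iff_trans (h4 l' l'y) A4.
Qed.

Lemma pattern_germ_eq (U V : opens R) x (Ux : open_set U x) (Vx : open_set V x)
    (A : attractor_section phi U) (B : attractor_section phi V) b1 b2 b3 b4 :
  pattern (att A (opens_pt Ux)) x b1 b2 b3 b4 ->
  pattern (att B (opens_pt Vx)) x b1 b2 b3 b4 ->
  germ (F := F) Ux (lattice_clopen A) = germ (F := F) Vx (lattice_clopen B).
Proof.
move=> /(@section_pattern_near U A (opens_pt Ux)) HA.
move=> /(@section_pattern_near V B (opens_pt Vx)) HB.
apply: attractor_germ_eq; apply: (filterS _ (filterI HA HB)).
move=> y [hA hB] l l' ly l'y.
apply: (pattern_eq _ _ (hA _ ly) (hB _ l'y)).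
  by rewrite -ly; exact: att_attractor.
by rewrite -l'y; exact: att_attractor.
Qed.

(** The neighbourhoods W l are chosen independently for each l. Near m the set W m is still
    attracting with the same pattern, and since a pattern determines the attractor, W m and W l
    define the same one. *)
Lemma pattern_section (U : opens R) b1 b2 b3 b4 :
  (forall l, open_set U l -> exists2 W, attracting_nbhd (phi l) W &
     pattern W l b1 b2 b3 b4) ->
  exists A : attractor_section phi U,
    forall l : U, pattern (att A l) (val l) b1 b2 b3 b4.
Proof.
move=> HW.
have omega_pattern l W : attracting_nbhd (phi l) W -> pattern W l b1 b2 b3 b4 ->
    pattern (omega (phi l) W) l b1 b2 b3 b4.
  move=> nW [W1 W2 W3 W4]; split; (apply: iff_trans; first
    (apply: attractor_fixed_point => //)) => //.
have HWU (l : U) : exists2 W, attracting_nbhd (phi (val l)) W &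
    pattern W (val l) b1 b2 b3 b4 by apply: HW; exact: set_valP.
pose W l := projT1 (cid2 (HWU l)).
have nW l : attracting_nbhd (phi (val l)) (W l) by rewrite /W; case: cid2.
have pW l : pattern (W l) (val l) b1 b2 b3 b4 by rewrite /W; case: cid2.
pose A (l : U) := omega (phi (val l)) (W l).
have AP : attractor_continuation phi A.
  split=> [l|m]; first by exists (W l).
  have [W1 W2 W3 W4] := pW m.
  have H1 := fixed_point_near (@cp1 (val m)) fp1 (nW m).
  have H2 := fixed_point_near (@cp2 (val m)) fp2 (nW m).
  have H3 := fixed_point_near (@cp3 (val m)) fp3 (nW m).
  have H4 := fixed_point_near (@cp4 (val m)) fp4 (nW m).
  have H0 := attracting_nbhd_near compactY (nW m).
  have HU : \forall y \near val m, open_set U y.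
    by apply: open_nbhs_nbhs; split; [exact: open_setP|exact: set_valP].
  have fI := @filterI _ _ (nbhs_filter (val m)).
  have := fI _ _ (fI _ _ (fI _ _ H1 H2) (fI _ _ H3 H4)) (fI _ _ H0 HU).
  rewrite nbhsE => -[N [oN Nm] HN].
  exists (Opens oN), (W m); split=> //; first by move=> y /HN[_ []].
  move=> l /HN[[[h1 h2] [h3 h4]] [nl _]]; split=> //.
  have nl' : attracting_nbhd (phi (val l)) (W m) by exact: nl.
  apply: (@pattern_eq _ _ (val l) b1 b2 b3 b4); first by exists (W l).
  - by exists (W m).
  - exact: omega_pattern (nW l) (pW l).
  - apply: omega_pattern => //; split.
    + exact: iff_trans h1 W1.
    + exact: iff_trans h2 W2.
    + exact: iff_trans h3 W3.
    + exact: iff_trans h4 W4.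
exists (AttractorSection AP) => l; exact: omega_pattern (nW l) (pW l).
Qed.

Definition full_opens : opens R := Opens openT.

Lemma open_nonzero : open [set l : R | l != 0].
Proof.
rewrite (_ : [set l : R | _] = ~` [set 0]).
  by apply: closed_openC; apply: accessible_closed_set1; exact: hausdorff_accessible.
by apply/seteqP; split=> l /= /eqP.
Qed.

Definition nonzero_opens : opens R := Opens open_nonzero.

Lemma standard_section1 : exists A : attractor_section phi full_opens,
  forall l : full_opens, pattern (att A l) (val l) true false false false.
Proof.
apply: pattern_section => l _.
by have [W nW [h1 h2 h3 h4]] := fiber_attractor1 (fib l); exists W.
Qed.

Lemma standard_section2 : exists A : attractor_section phi full_opens,
  forall l : full_opens, pattern (att A l) (val l) true true true false.
Proof.
apply: pattern_section => l _.
by have [W nW [h1 h2 h3 h4]] := fiber_attractor123 (fib l); exists W.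
Qed.

Lemma standard_section3 : exists A : attractor_section phi full_opens,
  forall l : full_opens, pattern (att A l) (val l) true true true true.
Proof.
by apply: pattern_section => l _; exists setT => //; exact: attracting_nbhdT.
Qed.

Lemma standard_section_f : exists A : attractor_section phi nonzero_opens,
  forall l : nonzero_opens, pattern (att A l) (val l) false false true false.
Proof.
apply: pattern_section => l /= l0.
have [|W nW [h1 h2 h3 h4]] := fiber_attractor3 (fib l); last by exists W.
by move=> /p23 e; rewrite e eqxx in l0.
Qed.

Let A1 := projT1 (cid standard_section1).
Let A2 := projT1 (cid standard_section2).
Let A3 := projT1 (cid standard_section3).
Let Af := projT1 (cid standard_section_f).
Let A1P : forall l : full_opens, pattern (att A1 l) (val l) true false false false.
Proof. by rewrite /A1; case: cid. Qed.
Let A2P : forall l : full_opens, pattern (att A2 l) (val l) true true true false.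
Proof. by rewrite /A2; case: cid. Qed.
Let A3P : forall l : full_opens, pattern (att A3 l) (val l) true true true true.
Proof. by rewrite /A3; case: cid. Qed.
Let AfP : forall l : nonzero_opens, pattern (att Af l) (val l) false false true false.
Proof. by rewrite /Af; case: cid. Qed.

Let fullP x : open_set full_opens x. Proof. by []. Qed.

Let e1 : serrations S := fun x => germ (F := F) (fullP x) (lattice_clopen A1).
Let e2 : serrations S := fun x => germ (F := F) (fullP x) (lattice_clopen A2).
Let e3 : serrations S := fun x => germ (F := F) (fullP x) (lattice_clopen A3).
Let f : serrations S := fun x =>
  if pselect (open_set nonzero_opens x) is left x0
  then germ (F := F) x0 (lattice_clopen Af) else 0.
Let comb := frame_comb e1 e2 e3 f.

Lemma global_section (A : attractor_section phi full_opens) x :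
  section_at S x (fun x => germ (F := F) (fullP x) (lattice_clopen A)).
Proof.
exists full_opens, (lattice_clopen A); split=> // y Uy.
by congr (germ _ _); exact: Prop_irrelevance.
Qed.

Lemma f_section x : x != 0 -> section_at S x f.
Proof.
move=> x0; exists nonzero_opens, (lattice_clopen Af); split=> // y Uy.
rewrite /f; case: pselect => // Uy'.
by congr (germ _ _); exact: Prop_irrelevance.
Qed.

Lemma fE x (x0 : open_set nonzero_opens x) :
  f x = germ (F := F) x0 (lattice_clopen Af).
Proof.
rewrite /f; case: pselect => // Uy'.
by congr (germ _ _); exact: Prop_irrelevance.
Qed.

Lemma pattern0_germ (U : opens R) x (Ux : open_set U x) (A : attractor_section phi U) :
  pattern (att A (opens_pt Ux)) x false false false false ->
  germ (F := F) Ux (lattice_clopen A) = 0.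
Proof.
move=> pA; have -> : (0 : germs F x) = germ (F := F) Ux (lattice_clopen \bot%O).
  by rewrite lattice_clopen0 raddf0.
apply: pattern_germ_eq pA _; split; split=> // H; exact: (H : set0 _).
Qed.

(** The coefficients solve the system over Z_2 in which e1, e2, e3, f have the patterns 1000, 1110,
    1111, 0010. Eight patterns satisfy the constraints; those that are not generators or zero are
    reached by the modular relation. *)
Lemma pattern_germ (U : opens R) x (Ux : open_set U x) (A : attractor_section phi U)
    b1 b2 b3 b4 : pattern (att A (opens_pt Ux)) x b1 b2 b3 b4 ->
  germ (F := F) Ux (lattice_clopen A) =
    comb (b1 (+) b2) (b4 (+) b2) b4 (b3 (+) b2) x.
Proof.
have char2 (g h k : germs F x) : g + h = k -> g = k + h.
  by move=> <-; rewrite -addrA germ_char2 addr0.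
have pat1 := A1P (opens_pt (fullP x)).
have pat2 := A2P (opens_pt (fullP x)).
have pat3 := A3P (opens_pt (fullP x)).
have p1010 (V : opens R) (Vx : open_set V x) (B : attractor_section phi V) :
    pattern (att B (opens_pt Vx)) x true false true false ->
    germ (F := F) Vx (lattice_clopen B) = e1 x + f x.
  move=> pB; have x0 : open_set nonzero_opens x :=
    pattern_nonzero (att_attractor _ _) pB isT.
  have patf := AfP (opens_pt x0).
  have [W [Wx [C [D [e HCD]]]]] := attractor_germ_modular (fullP x) x0 A1 Af.
  have pC := pattern_or (fun q fq => (HCD q fq).1) pat1 patf.
  have pD := pattern_and (fun q fq => (HCD q fq).2) pat1 patf.
  rewrite (fE x0) /e1 e (pattern0_germ pD) addr0; exact: pattern_germ_eq pB pC.
move=> pA.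
have [h1 h2 h3 _] := pattern_constraints (att_attractor A (opens_pt Ux)) pA.
rewrite /comb /frame_comb.
case: b1 b2 b3 b4 pA h1 h2 h3 => [] [] [] [] pA h1 h2 h3 /=;
  try (by case: (h1 isT)); try (by case: (h2 isT)); try (by case: (h3 isT));
  rewrite ?mulr0n ?mulr1n ?addr0 ?add0r.
- exact: pattern_germ_eq pA pat3.
- exact: pattern_germ_eq pA pat2.
(* Pattern 1011: with A2, of pattern 1110, the join is 1111 and the meet 1010. *)
- have x0 : open_set nonzero_opens x :=
    pattern_nonzero (att_attractor _ _) pA isT.
  have [W [Wx [C [D [e HCD]]]]] := attractor_germ_modular Ux (fullP x) A A2.
  have pC := pattern_or (fun q fq => (HCD q fq).1) pA pat2.
  have pD := pattern_and (fun q fq => (HCD q fq).2) pA pat2.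
  rewrite (char2 _ _ _ e) (p1010 _ _ _ pD) (pattern_germ_eq pC pat3).
  by rewrite -/(e2 x) -/(e3 x) [e3 x + _]addrCA -addrA [_ + e2 x]addrC !addrA.
- exact: p1010.
- exact: pattern_germ_eq pA pat1.
(* Pattern 0011: with A2 the join is 1111 and the meet 0010. *)
- have x0 : open_set nonzero_opens x :=
    pattern_nonzero (att_attractor _ _) pA isT.
  have patf := AfP (opens_pt x0).
  have [W [Wx [C [D [e HCD]]]]] := attractor_germ_modular Ux (fullP x) A A2.
  have pC := pattern_or (fun q fq => (HCD q fq).1) pA pat2.
  have pD := pattern_and (fun q fq => (HCD q fq).2) pA pat2.
  rewrite (char2 _ _ _ e) (pattern_germ_eq pC pat3) (pattern_germ_eq pD patf).
  by rewrite -(fE x0) -/(e2 x) -/(e3 x) addrC addrA.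
- have x0 : open_set nonzero_opens x :=
    pattern_nonzero (att_attractor _ _) pA isT.
  by rewrite (fE x0); exact: pattern_germ_eq pA (AfP (opens_pt x0)).
- exact: pattern0_germ.
Qed.

Lemma comb_add x b1 b2 b3 b4 c1 c2 c3 c4 :
  comb b1 b2 b3 b4 x + comb c1 c2 c3 c4 x =
  comb (b1 (+) c1) (b2 (+) c2) (b3 (+) c3) (b4 (+) c4) x.
Proof.
have mulrb_add (g : germs F x) (b c : bool) : g *+ b + g *+ c = g *+ (b (+) c).
  by case: b c => [] [] /=; rewrite ?mulr0n ?addr0 ?add0r // germ_char2.
rewrite /comb /frame_comb addrACA mulrb_add; congr (_ + _).
rewrite addrACA mulrb_add; congr (_ + _).
by rewrite addrACA !mulrb_add.
Qed.

Lemma germ_span x (a : S x) : exists c1 c2 c3 d : bool,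
  (d -> x != 0) /\ a = comb c1 c2 c3 d x.
Proof.
have [U [Ux [s ->]]] := germ_surj (a : germs F x).
have [l ->] := booleanization_span s.
elim: l => [|A l [c1 [c2 [c3 [d [dx IH]]]]]].
  exists false, false, false, false; split=> //.
  by rewrite big_nil raddf0 /comb /frame_comb !mulr0n !addr0.
have [b1 [b2 [b3 [b4 pA]]]] := pattern_exists (att A (opens_pt Ux)) x.
have [_ _ _ h0] := pattern_constraints (att_attractor A (opens_pt Ux)) pA.
exists ((b1 (+) b2) (+) c1), ((b4 (+) b2) (+) c2), (b4 (+) c3), ((b3 (+) b2) (+) d).
split; last by rewrite big_cons raddfD /= IH (pattern_germ pA) comb_add.
(* At x = 0 the points p2 and p3 coincide, so b2 = b3 and A contributes nothing to the coefficient
   of f. *)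
move=> H; apply/eqP => x0; move: H; rewrite (h0 x0) addbb addFb => /dx.
by rewrite x0 eqxx.
Qed.

(** Evaluation at p4, p2, p1, p3 is a triangular system for c3, c2, c1, d. If d is false the first
    three suffice; if d is true then x != 0 and f can be evaluated as well. *)
Lemma germ_free x (c1 c2 c3 d : bool) : (d -> x != 0) ->
  comb c1 c2 c3 d x = 0 -> [/\ c1 = false, c2 = false, c3 = false & d = false].
Proof.
move=> dx e.
have ev0 q (fq : fixed_point (phi x) q) : germ_eval fq 0 = false.
  have := germ_evalD fq 0 0; rewrite addr0 => ->; exact: addbb.
have evb q (fq : fixed_point (phi x) q) (g : germs F x) (b : bool) :
    germ_eval fq (g *+ b) = b && germ_eval fq g.
  by case: b; rewrite ?mulr0n ?ev0.
have E q (fq : fixed_point (phi x) q) :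
    (c1 && germ_eval fq (e1 x)) (+) (c2 && germ_eval fq (e2 x)) (+)
    (c3 && germ_eval fq (e3 x)) (+) (d && germ_eval fq (f x)) = false.
  by rewrite -!evb -!germ_evalD -(ev0 _ fq); congr germ_eval; exact: e.
have ev1 q (fq : fixed_point (phi x) q) :
    germ_eval fq (e1 x) = `[< att A1 (opens_pt (fullP x)) q >].
  exact: germ_eval_clopen.
have ev2 q (fq : fixed_point (phi x) q) :
    germ_eval fq (e2 x) = `[< att A2 (opens_pt (fullP x)) q >].
  exact: germ_eval_clopen.
have ev3 q (fq : fixed_point (phi x) q) :
    germ_eval fq (e3 x) = `[< att A3 (opens_pt (fullP x)) q >].
  exact: germ_eval_clopen.
have asb (P : Prop) (b : bool) : (P <-> b) -> `[< P >] = b.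
  by move=> Pb; apply/asboolP/idP => /Pb.
have [/asb a1 /asb a2 /asb a3 /asb a4] := A1P (opens_pt (fullP x)).
have [/asb b1 /asb b2 /asb b3 /asb b4] := A2P (opens_pt (fullP x)).
have [/asb k1 /asb k2 /asb k3 /asb k4] := A3P (opens_pt (fullP x)).
have H4 := E _ (fp4 x); have H2 := E _ (fp2 x); have H1 := E _ (fp1 x).
have H3 := E _ (fp3 x).
rewrite !ev1 !ev2 !ev3 a4 b4 k4 in H4; rewrite !ev1 !ev2 !ev3 a2 b2 k2 in H2.
rewrite !ev1 !ev2 !ev3 a1 b1 k1 in H1; rewrite !ev1 !ev2 !ev3 a3 b3 k3 in H3.
have [dT|dF] := boolP d; last first.
  move: H4 H2 H1; rewrite (negPf dF) !andbF !andbT !addbF ?addFb => -> /=.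
  by rewrite addbF => -> /=; rewrite !addbF => ->.
have x0 : open_set nonzero_opens x by exact: dx.
have evf q (fq : fixed_point (phi x) q) :
    germ_eval fq (f x) = `[< att Af (opens_pt x0) q >].
  by rewrite (fE x0); exact: germ_eval_clopen.
have [/asb l1 /asb l2 /asb l3 /asb l4] := AfP (opens_pt x0).
rewrite evf l4 in H4; rewrite evf l2 in H2; rewrite evf l1 in H1; rewrite evf l3 in H3.
move: H4 H2 H1 H3; rewrite dT.
by case: c1 c2 c3 {e dx E dT} => [] [] [].
Qed.

Lemma attractor_frame : exists e1 e2 e3 f : serrations S, frame e1 e2 e3 f.
Proof.
exists e1, e2, e3, f; split.
- exact: global_section.
- exact: global_section.
- exact: global_section.
- exact: f_section.
- by move=> x a; exact: germ_char2.
- exact: germ_span.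
- exact: germ_free.
Qed.

End TranscriticalFrame.

Theorem theorem10p16 (R : realType) (Y : metricType R)
    (psi : pdynsys R R (\bar R)) (phi : pdynsys R R Y) :
  transcritical psi ->
  compact [set: Y] ->
  conjugate phi psi ->
  acyclic (attractor_sheaf phi) /\
  iso_group (sheaf_cohomology (attractor_sheaf phi) 0) 'rV['Z_2]_3 /\
  exists l0 : R, forall (a : R) (k : nat),
    ((k = 1%N /\ l0 < a ->
        iso_group (relative_cohomology `[a, +oo[ (attractor_sheaf phi) k) 'Z_2) /\
     (k <> 1%N \/ a <= l0 ->
        trivial_group (relative_cohomology `[a, +oo[ (attractor_sheaf phi) k))) /\
    ((k = 1%N /\ a < l0 ->
        iso_group (relative_cohomology `]-oo, a] (attractor_sheaf phi) k) 'Z_2) /\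
     (k <> 1%N \/ l0 <= a ->
        trivial_group (relative_cohomology `]-oo, a] (attractor_sheaf phi) k))).
Proof.
move=> tc cY cj.
have [p1 [p2 [p3 [p4 [[cp1 cp2 cp3 cp4] [p23 fib]]]]]] := conjugate_fibers cY tc cj.
have [e1 [e2 [e3 [f F]]]] := attractor_frame cY cp1 cp2 cp3 cp4 p23 fib.
split; first exact: frame_acyclic F.
split; first exact: frame_cohomology0 F.
(* A conjugacy acts fibrewise over the parameter line, so the bifurcation value is still 0. *)
by exists 0 => a k; exact: frame_relative_half_lines F a k.
Qed.
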